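(* Let $\Bbbk$ be an algebraically closed field of characteristic zero, let $H$ be an affine Hopf algebra over $\Bbbk$ and let $C$ be a central Hopf subalgebra of $H$ such that $H$ is a finitely generated $C$-module. Then $\mathrm{Chev}_{\overline{\varepsilon}}(H,C)=\mathrm{maxSpec}\,C$ if and only if $H/\mathfrak{m}_{\overline{\varepsilon}}H$ has the Chevalley property.
   Context: Affine means finitely generated as an algebra. Let $\varepsilon$ be the counit of $H$, $\overline{\varepsilon}=\varepsilon|_C$, $\mathfrak{m}_{\overline{\varepsilon}}=\mathrm{Ker}\,\overline{\varepsilon}$. The identity fiber algebra $H/\mathfrak{m}_{\overline{\varepsilon}}H$ is a finite-dimensional Hopf algebra with structure induced from $H$. For $\mathfrak{m}\in\mathrm{maxSpec}\,C$, the coproduct induces an algebra map $H/\mathfrak{m}H\to H/\mathfrak{m}_{\overline{\varepsilon}}H\otimes H/\mathfrak{m}H$, so that $V\otimes W$ is an $H/\mathfrak{m}H$-module for any $H/\mathfrak{m}_{\overline{\varepsilon}}H$-module $V$ and $H/\mathfrak{m}H$-module $W$. $\mathrm{Irr}(A)$ denotes the set of isomorphism classes of irreducible $A$-modules. The $\overline{\varepsilon}$-Chevalley locus of $(H,C)$ is $$\mathrm{Chev}_{\overline{\varepsilon}}(H,C)=\{\mathfrak{m}\in\mathrm{maxSpec}\,C\mid V\otimes W\text{ is a completely reducible }H/\mathfrak{m}H\text{-module for all }[V]\in\mathrm{Irr}(H/\mathfrak{m}_{\overline{\varepsilon}}H),\ [W]\in\mathrm{Irr}(H/\mathfrak{m}H)\}.$$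 A Hopf algebra has the Chevalley property if the tensor product of any two of its finite-dimensional irreducible modules is completely reducible. *)

(* Defs.v *)
From HB Require Import structures.
From mathcomp Require Import all_boot all_order all_algebra.
From mathcomp Require Import boolp classical_sets.

Set Implicit Arguments.
Unset Strict Implicit.
Unset Printing Implicit Defensive.

Import GRing.Theory.

Local Open Scope classical_set_scope.
Local Open Scope ring_scope.
Local Open Scope quotient_scope.

Record is_alg_hom (k : fieldType) (A B : algType k) (f : A -> B) : Prop :=
  IsAlgHom {
    alg_hom_linear : linear f;
    alg_hom1 : f 1 = 1;
    alg_homM : {morph f : x y / x * y}
  }.

Lemma lrmorphism_hom (k : fieldType) (A B : algType k)
  (f : {lrmorphism A -> B}) : is_alg_hom f.
Proof. by split; [exact: linearP | exact: rmorph1 | exact: rmorphM]. Qed.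

Section LinearFacts.
Variables (k : fieldType) (U V : lmodType k) (f : U -> V).
Hypothesis lf : linear f.
Lemma linE0 : f 0 = 0.
Proof. by have := lf (-1) 0 0; rewrite scaler0 addr0 scaleN1r addNr. Qed.
Lemma linED x y : f (x + y) = f x + f y.
Proof. by have := lf 1 x y; rewrite !scale1r. Qed.
Lemma linEZ a x : f (a *: x) = a *: f x.
Proof. by have := lf a x 0; rewrite !addr0 linE0 addr0. Qed.
Lemma linEB x y : f (x - y) = f x - f y.
Proof. by rewrite -scaleN1r linED linEZ scaleN1r. Qed.
Lemma linE_sum I (s : seq I) (F : I -> U) :
  f (\sum_(i <- s) F i) = \sum_(i <- s) f (F i).
Proof. exact: (big_morph f linED linE0). Qed.
End LinearFacts.

Lemma lin_comp (k : fieldType) (U V W : lmodType k) (f : V -> W) (g : U -> V) :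
  linear f -> linear g -> linear (f \o g).
Proof. by move=> lf lg a x y; rewrite /= lg lf. Qed.

Lemma lin_id (k : fieldType) (U : lmodType k) : linear (@id U).
Proof. by []. Qed.

(* The tensor product over k: formal finite sums of pairs, modulo the
   congruence generated by the commutativity of addition and bilinearity. *)
Inductive tens_rel (k : fieldType) (V W : lmodType k) :
    seq (V * W) -> seq (V * W) -> Prop :=
| TensRefl s : tens_rel s s
| TensSym s t : tens_rel s t -> tens_rel t s
| TensTrans s t u : tens_rel s t -> tens_rel t u -> tens_rel s u
| TensCat s s' t t' :
    tens_rel s s' -> tens_rel t t' -> tens_rel (s ++ t) (s' ++ t')
| TensC s t : tens_rel (s ++ t) (t ++ s)
| Tens0 w : tens_rel [:: (0, w)] [::]
| TensDl v v' w : tens_rel [:: (v + v', w)] [:: (v, w); (v', w)]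
| TensDr v w w' : tens_rel [:: (v, w + w')] [:: (v, w); (v, w')]
| TensZ a v w : tens_rel [:: (a *: v, w)] [:: (v, a *: w)].

Section TensorDef.
Variables (k : fieldType) (V W : lmodType k).

Definition tens_relb : rel (seq (V * W)) := fun s t => `[< tens_rel s t >].

Lemma tens_relb_refl : reflexive tens_relb.
Proof. by move=> s; apply/asboolP; exact: TensRefl. Qed.

Lemma tens_relb_sym : symmetric tens_relb.
Proof. by move=> s t; apply/asboolP/asboolP; exact: TensSym. Qed.

Lemma tens_relb_trans : transitive tens_relb.
Proof. by move=> t s u /asboolP st /asboolP tu; apply/asboolP; exact: TensTrans tu. Qed.

Canonical tens_equiv := EquivRel tens_relb
  tens_relb_refl tens_relb_sym tens_relb_trans.

Definition tensor : Type := {eq_quot tens_equiv}.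

HB.instance Definition _ : EqQuotient _ tens_equiv tensor :=
  EqQuotient.on tensor.
HB.instance Definition _ := Choice.on tensor.

Lemma tens_eqP (s t : seq (V * W)) :
  reflect (\pi_tensor s = \pi_tensor t) `[< tens_rel s t >].
Proof. exact: (@eqmodP _ tens_equiv). Qed.

Lemma pi_tens (s t : seq (V * W)) :
  tens_rel s t -> \pi_tensor s = \pi_tensor t.
Proof. by move=> st; apply/tens_eqP/asboolP. Qed.

Lemma tens_repr (s : seq (V * W)) : tens_rel (repr (\pi_tensor s)) s.
Proof. by apply/asboolP/tens_eqP; rewrite reprK. Qed.

Definition tens_scale_seq (a : k) (s : seq (V * W)) : seq (V * W) :=
  [seq (a *: p.1, p.2) | p <- s].

Lemma tens_scale_rel a s t :
  tens_rel s t -> tens_rel (tens_scale_seq a s) (tens_scale_seq a t).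
Proof.
elim=> {s t} [s|s t _ IH|s t u _ IH1 _ IH2|s s' t t' _ IH1 _ IH2|s t|w|v v' w|v w w'|b v w].
- by apply: TensRefl.
- exact: TensSym.
- exact: TensTrans IH2.
- by rewrite /tens_scale_seq !map_cat; exact: TensCat.
- by rewrite /tens_scale_seq !map_cat; exact: TensC.
- by rewrite /= scaler0; exact: Tens0.
- by rewrite /= scalerDr; exact: TensDl.
- exact: TensDr.
- by rewrite /= scalerA mulrC -scalerA; exact: TensZ.
Qed.

Definition tens_zero : tensor := \pi_tensor [::].
Definition tens_add (x y : tensor) : tensor :=
  locked (\pi_tensor (repr x ++ repr y)).
Definition tens_scale (a : k) (x : tensor) : tensor :=
  locked (\pi_tensor (tens_scale_seq a (repr x))).
Definition tens_opp (x : tensor) : tensor := tens_scale (-1) x.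

Lemma tens_add_pi s t :
  tens_add (\pi_tensor s) (\pi_tensor t) = \pi_tensor (s ++ t).
Proof.
by rewrite /tens_add -lock; apply: pi_tens; apply: TensCat; exact: tens_repr.
Qed.

Lemma tens_scale_pi a s :
  tens_scale a (\pi_tensor s) = \pi_tensor (tens_scale_seq a s).
Proof.
by rewrite /tens_scale -lock; apply: pi_tens; apply: tens_scale_rel; exact: tens_repr.
Qed.

Lemma tens_addA : associative tens_add.
Proof.
move=> x y z; rewrite -[x]reprK -[y]reprK -[z]reprK.
by rewrite !tens_add_pi catA.
Qed.

Lemma tens_addC : commutative tens_add.
Proof.
by move=> x y; rewrite -[x]reprK -[y]reprK !tens_add_pi; apply/pi_tens/TensC.
Qed.

Lemma tens_add0 : left_id tens_zero tens_add.
Proof. by move=> x; rewrite -[x]reprK /tens_zero tens_add_pi. Qed.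

Lemma tens_scale0 x : tens_scale 0 x = tens_zero.
Proof.
rewrite -[x]reprK tens_scale_pi; apply: pi_tens.
elim: (repr x) => [|p s IH] /=; first exact: TensRefl.
rewrite scale0r; exact: (TensCat (Tens0 V p.2) IH).
Qed.

Lemma tens_scaleDl x a b :
  tens_scale (a + b) x = tens_add (tens_scale a x) (tens_scale b x).
Proof.
rewrite -[x]reprK !tens_scale_pi tens_add_pi; apply: pi_tens.
elim: (repr x) => [|p s IH] /=; first exact: TensRefl.
rewrite scalerDl.
apply: TensTrans (TensCat (TensDl (a *: p.1) (b *: p.1) p.2) IH) _.
rewrite /= -cat1s -[X in tens_rel _ X]cat1s.
apply: TensCat; first exact: TensRefl.
rewrite -cat1s catA -[X in tens_rel _ (_ ++ X)]cat1s [X in tens_rel _ X]catA.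
by apply: TensCat; [exact: TensC | exact: TensRefl].
Qed.

Lemma tens_scale1 : left_id 1 tens_scale.
Proof.
move=> x; rewrite -[x]reprK tens_scale_pi; congr (\pi_tensor _).
rewrite -[RHS]map_id; apply: eq_map => -[v w] /=.
by rewrite scale1r.
Qed.

Lemma tens_addN : left_inverse tens_zero tens_opp tens_add.
Proof.
move=> x; rewrite -{2}[x]tens_scale1 -tens_scaleDl addNr; exact: tens_scale0.
Qed.

HB.instance Definition _ :=
  GRing.isZmodule.Build tensor tens_addA tens_addC tens_add0 tens_addN.

Lemma tens_scaleA a b x : tens_scale a (tens_scale b x) = tens_scale (a * b) x.
Proof.
rewrite -[x]reprK !tens_scale_pi; congr (\pi_tensor _).
rewrite /tens_scale_seq -map_comp; apply: eq_map => -[v w] /=.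
by rewrite scalerA.
Qed.

Lemma tens_scaleDr : right_distributive tens_scale +%R.
Proof.
move=> a x y; rewrite -[x]reprK -[y]reprK.
change (tens_scale a (tens_add (\pi_tensor (repr x)) (\pi_tensor (repr y))) =
  tens_add (tens_scale a (\pi_tensor (repr x)))
           (tens_scale a (\pi_tensor (repr y)))).
by rewrite !(tens_add_pi, tens_scale_pi) /tens_scale_seq map_cat.
Qed.

HB.instance Definition _ := GRing.Zmodule_isLmodule.Build k tensor
  tens_scaleA tens_scale1 tens_scaleDr tens_scaleDl.

Definition tens (v : V) (w : W) : tensor := \pi_tensor [:: (v, w)].

End TensorDef.

Notation "v '\ox' w" := (tens v w) (at level 40, left associativity) : ring_scope.

Definition bilin (k : fieldType) (V W U : lmodType k) (f : V -> W -> U) :=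
  (forall w, linear (f^~ w)) /\ (forall v, linear (f v)).

(* For a bilinear f this is the induced linear map on the tensor product,
   i.e. the sum of the f(x, y) over the terms x \ox y of t. *)
Definition tlift (k : fieldType) (V W U : lmodType k) (f : V -> W -> U)
  (t : tensor V W) : U := \sum_(p <- repr t) f p.1 p.2.

Definition tmap (k : fieldType) (V W V' W' : lmodType k)
  (f : V -> V') (g : W -> W') : tensor V W -> tensor V' W' :=
  tlift (fun v w => f v \ox g w).

Definition tassoc (k : fieldType) (U V W : lmodType k) :
  tensor (tensor U V) W -> tensor U (tensor V W) :=
  tlift (fun t w => tlift (fun u v => u \ox (v \ox w)) t).

Section TensorTheory.
Variables (k : fieldType).

Section One.
Variables (V W : lmodType k).
Implicit Types (v : V) (w : W) (t : tensor V W).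

Lemma tensD_pi (s t : seq (V * W)) :
  \pi_(tensor V W) (s ++ t) = \pi_(tensor V W) s + \pi_(tensor V W) t.
Proof. by rewrite -tens_add_pi. Qed.

Lemma tens_bilin : bilin (@tens k V W).
Proof.
split=> [w a v v'|v a w w'].
- transitivity (a *: v \ox w + v' \ox w).
    by rewrite /tens -tensD_pi; apply/pi_tens/TensDl.
  by congr (_ + _); rewrite /tens -[RHS]/(tens_scale _ _) tens_scale_pi.
- transitivity (v \ox (a *: w) + v \ox w').
    by rewrite /tens -tensD_pi; apply/pi_tens/TensDr.
  congr (_ + _); rewrite /tens -[RHS]/(tens_scale _ _) tens_scale_pi /=.
  by apply/pi_tens/TensSym/TensZ.
Qed.

Lemma tens_repr_sum t : t = \sum_(p <- repr t) p.1 \ox p.2.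
Proof.
rewrite -{1}[t]reprK; elim: (repr t) => [|[v w] s IH]; first by rewrite big_nil.
by rewrite big_cons -cat1s tensD_pi IH.
Qed.

Lemma tensor_ind (P : tensor V W -> Prop) :
  P 0 -> (forall v w, P (v \ox w)) -> (forall s t, P s -> P t -> P (s + t)) ->
  forall t, P t.
Proof.
move=> P0 Pt PD t; rewrite [t]tens_repr_sum.
by elim: (repr t) => [|p s IH]; rewrite ?big_nil ?big_cons //; apply: PD.
Qed.

Lemma tensor_ext (U : lmodType k) (f g : tensor V W -> U) :
  linear f -> linear g -> (forall v w, f (v \ox w) = g (v \ox w)) ->
  forall t, f t = g t.
Proof.
move=> lf lg fg; apply: tensor_ind => //; first by rewrite !linE0.
by move=> s t IHs IHt; rewrite !linED // IHs IHt.
Qed.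

Section Lift.
Variables (U : lmodType k) (f : V -> W -> U).
Hypothesis bf : bilin f.

Lemma tens_rel_sum (s t : seq (V * W)) : tens_rel s t ->
  \sum_(p <- s) f p.1 p.2 = \sum_(p <- t) f p.1 p.2.
Proof.
case: bf => fl fr.
elim=> {s t} [s|s t _ IH|s t u _ IH1 _ IH2|s s' t t' _ IH1 _ IH2|s t|w|v v' w|v w w'|b v w] //.
- by rewrite IH1.
- by rewrite !big_cat /= IH1 IH2.
- by rewrite !big_cat /= addrC.
- by rewrite big_seq1 big_nil (linE0 (fl w)).
- by rewrite !big_cons !big_nil !addr0 (linED (fl w)).
- by rewrite !big_cons !big_nil !addr0 (linED (fr v)).
- by rewrite !big_seq1 (linEZ (fl w)) (linEZ (fr v)).
Qed.

Lemma tlift_pi s : tlift f (\pi s) = \sum_(p <- s) f p.1 p.2.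
Proof. by apply: tens_rel_sum; exact: tens_repr.
Qed.

Lemma tliftE v w : tlift f (v \ox w) = f v w.
Proof. by rewrite tlift_pi big_seq1. Qed.

Lemma tlift_linear : linear (tlift f).
Proof.
move=> a x y; rewrite -[x]reprK -[y]reprK.
rewrite -[a *: _]/(tens_scale _ _) tens_scale_pi -tensD_pi !tlift_pi big_cat /=.
congr (_ + _); rewrite /tens_scale_seq big_map scaler_sumr.
by apply: eq_bigr => p _ /=; case: bf => fl _; rewrite (linEZ (fl p.2)).
Qed.

End Lift.

Lemma eq_tlift (U : lmodType k) (f g : V -> W -> U) :
  (forall v w, f v w = g v w) -> tlift f =1 tlift g.
Proof. by move=> fg t; apply: eq_bigr. Qed.

Lemma tlift_funlin (U : lmodType k) (a : k) (f g : V -> W -> U) t :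
  tlift (fun v w => a *: f v w + g v w) t = a *: tlift f t + tlift g t.
Proof. by rewrite /tlift big_split /= scaler_sumr. Qed.

Lemma lin_tlift (U U' : lmodType k) (h : U -> U') (f : V -> W -> U) t :
  linear h -> h (tlift f t) = tlift (fun v w => h (f v w)) t.
Proof. by move=> lh; rewrite /tlift (linE_sum lh). Qed.

End One.

Section Map.
Variables (V W V' W' : lmodType k) (f : V -> V') (g : W -> W').
Hypotheses (lf : linear f) (lg : linear g).

Lemma tmap_bilin : bilin (fun v w => f v \ox g w).
Proof.
have [tl tr] := tens_bilin V' W'.
by split=> [w|v] a x y; rewrite ?lf ?lg ?tl ?tr.
Qed.

Lemma tmapE v w : tmap f g (v \ox w) = f v \ox g w.
Proof. exact: (tliftE tmap_bilin). Qed.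

Lemma tmap_linear : linear (tmap f g).
Proof. exact: (tlift_linear tmap_bilin). Qed.

Lemma tlift_tmap (U : lmodType k) (h : V' -> W' -> U) t : bilin h ->
  tlift h (tmap f g t) = tlift (fun v w => h (f v) (g w)) t.
Proof.
move=> bh; rewrite /tmap lin_tlift; last exact: tlift_linear.
by apply: eq_tlift => v w; rewrite tliftE.
Qed.

End Map.

Lemma eq_tmap (V W V' W' : lmodType k) (f f' : V -> V') (g g' : W -> W') :
  f =1 f' -> g =1 g' -> tmap f g =1 tmap f' g'.
Proof. by move=> ff gg; apply: eq_tlift => v w; rewrite ff gg. Qed.

Lemma tmap_comp (V W V' W' V2 W2 : lmodType k) (f' : V' -> V2) (g' : W' -> W2)
  (f : V -> V') (g : W -> W') t :
  linear f' -> linear g' -> linear f -> linear g ->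
  tmap f' g' (tmap f g t) = tmap (f' \o f) (g' \o g) t.
Proof.
by move=> lf' lg' lf lg; rewrite [LHS]tlift_tmap //; exact: tmap_bilin.
Qed.

Lemma tassoc_bilin1 (U V W : lmodType k) (w : W) :
  bilin (fun (u : U) (v : V) => u \ox (v \ox w)).
Proof.
have [tl tr] := tens_bilin U (tensor V W); have [tl' tr'] := tens_bilin V W.
by split=> [v|u] a x y; rewrite /= ?tl ?tl' ?tr.
Qed.

Lemma tassoc_bilin (U V W : lmodType k) :
  bilin (fun (t : tensor U V) (w : W) => tlift (fun u v => u \ox (v \ox w)) t).
Proof.
split=> [w|t]; first exact: (tlift_linear (tassoc_bilin1 _ _ _)).
move=> a x y /=; rewrite -tlift_funlin; apply: eq_tlift => u v.
have [tl tr] := tens_bilin U (tensor V W); have [tl' tr'] := tens_bilin V W.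
by rewrite tr' tr.
Qed.

Lemma tassoc_linear (U V W : lmodType k) : linear (@tassoc k U V W).
Proof. exact: (tlift_linear (tassoc_bilin _ _ _)). Qed.

Lemma tassocE (U V W : lmodType k) (u : U) (v : V) (w : W) :
  tassoc ((u \ox v) \ox w) = u \ox (v \ox w).
Proof. by rewrite /tassoc (tliftE (tassoc_bilin _ _ _)) (tliftE (tassoc_bilin1 _ _ _)). Qed.

Lemma tassoc_tmap (U V W U' V' W' : lmodType k)
  (f : U -> U') (g : V -> V') (h : W -> W') t :
  linear f -> linear g -> linear h ->
  tassoc (tmap (tmap f g) h t) = tmap f (tmap g h) (tassoc t).
Proof.
move=> lf lg lh; move: t; apply: tensor_ext.
- exact: (lin_comp (@tassoc_linear _ _ _) (tmap_linear (tmap_linear lf lg) lh)).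
- exact: (lin_comp (tmap_linear lf (tmap_linear lg lh)) (@tassoc_linear _ _ _)).
move=> t w; have lfg := tmap_linear lf lg; have lgh := tmap_linear lg lh.
rewrite (tmapE lfg lh); move: t; apply: tensor_ext.
- apply: (lin_comp (@tassoc_linear _ _ _)) => a x y /=.
  by rewrite lfg (tens_bilin _ _).1.
- move=> a x y /=; rewrite (tens_bilin _ _).1 tassoc_linear.
  exact: tmap_linear.
move=> u v; rewrite (tmapE lf lg) !tassocE (tmapE lf lgh).
by rewrite (tmapE lg lh).
Qed.

End TensorTheory.

(* Action of A (x) B on V (x) W, for arbitrary bilinear "actions" of A on V
   and of B on W: (a \ox b) . (v \ox w) = (a . v) \ox (b . w). *)
Definition tact (k : fieldType) (A B V W V' W' : lmodType k)
  (f : A -> V -> V') (g : B -> W -> W')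
  (t : tensor A B) (x : tensor V W) : tensor V' W' :=
  tlift (fun a b => tmap (f a) (g b) x) t.

Section TAct.
Variables (k : fieldType) (A B V W V' W' : lmodType k).
Variables (f : A -> V -> V') (g : B -> W -> W').
Hypotheses (bf : bilin f) (bg : bilin g).

Lemma tact_bilin1 x : bilin (fun a b => tmap (f a) (g b) x).
Proof.
have [fl fr] := bf; have [gl gr] := bg; have [tl tr] := tens_bilin V' W'.
split=> [b|a] c y z; rewrite /tmap -tlift_funlin; apply: eq_tlift => v w.
- by rewrite fl tl.
- by rewrite gl tr.
Qed.

Lemma tact_bilin : bilin (tact f g).
Proof.
split=> [x|t] /=; first exact: (tlift_linear (tact_bilin1 x)).
move=> c x y; rewrite /tact -tlift_funlin; apply: eq_tlift => a b.
by rewrite tmap_linear //; [apply: bf.2 | apply: bg.2].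
Qed.

Lemma tactE a b v w : tact f g (a \ox b) (v \ox w) = f a v \ox g b w.
Proof.
rewrite /tact (tliftE (tact_bilin1 _)) tmapE //; [exact: bf.2 | exact: bg.2].
Qed.

End TAct.

Lemma mul_bilin (k : fieldType) (A : algType k) : bilin (@GRing.mul A).
Proof.
split=> [y|x] a u v; first by rewrite mulrDl scalerAl.
by rewrite mulrDr scalerAr.
Qed.

Section LinearForm.
Variables (k : fieldType) (V : lmodType k) (v : V).
Hypothesis v0 : v != 0.

Let P (N : set V) := (forall a x y, N x -> N y -> N (a *: x + y)) /\ ~ N v.

Let max_P : exists A, P A /\ forall B, A `<` B -> ~ P B.
Proof.
apply: Zorn_bigcup => F FP tF; split; last by case=> N FN; apply: (FP _ FN).2.
move=> a x y [N FN Nx] [N' FN' Ny].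
have [NN'|N'N] := tF _ _ FN FN'.
- by exists N' => //; apply: (FP _ FN').1 => //; exact: NN'.
- by exists N => //; apply: (FP _ FN).1 => //; exact: N'N.
Qed.

Lemma linear_form : exists f : V -> k^o, linear f /\ f v = 1.
Proof.
have [A [[AL Av] maxA]] := max_P.
have A0 : A 0.
  apply: contrapT => nA0; apply: (maxA (A `|` [set 0])).
    by split=> [x Ax|/(_ 0)]; [left | move/(_ (or_intror erefl))].
  split=> [a x y [Ax|->] [Ay|->]|[//|/= /eqP]]; last by rewrite (negPf v0).
  - by left; exact: AL.
  - left; rewrite addr0; have := AL (a - 1) _ _ Ax Ax.
    by rewrite scalerBl scale1r subrK.
  - by left; rewrite scaler0 add0r.
  - by right; rewrite scaler0 add0r.
have AZ a x : A x -> A (a *: x) by move=> Ax; have := AL a _ _ Ax A0; rewrite addr0.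
have AD x y : A x -> A y -> A (x + y).
  by move=> Ax Ay; have := AL 1 _ _ Ax Ay; rewrite scale1r.
have ex w : exists a : k, A (w - a *: v).
  have [Aw|nAw] := pselect (A w); first by exists 0; rewrite scale0r subr0.
  pose B := [set x | exists b : k, A (x - b *: w)].
  have BA : A `<` B.
    split=> [x Ax|/(_ w)]; first by exists 0; rewrite scale0r subr0.
    by move=> /(_ _)/nAw; apply; exists 1; rewrite scale1r subrr.
  have : ~ P B by exact: maxA.
  move=> /not_andP[[]|/contrapT [b Ab]].
    move=> a x y [b Ab] [c Ac]; exists (a * b + c).
    rewrite scalerDl opprD addrACA -scalerA -scalerBr; exact: AL.
  have b0 : b != 0 by apply/eqP => b0; move: Ab; rewrite b0 scale0r subr0.
  exists b^-1; rewrite -[w in A (w - _)]scale1r -(mulVf b0) -scalerA -scalerBr.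
  by rewrite -opprB scalerN -scaleNr; exact: AZ.
have un a b w : A (w - a *: v) -> A (w - b *: v) -> a = b.
  move=> Aa Ab; apply: contrapT => /eqP; rewrite -subr_eq0 => ab; apply: Av.
  have := AZ (a - b)^-1 _ (AL (-1) _ _ Aa Ab).
  rewrite scaleN1r opprB addrA subrK -scalerBl scalerA mulVf // scale1r //.
have [f fP] := choice ex.
exists f; split=> [a x y|]; last by apply: un (fP v) _; rewrite scale1r subrr.
apply: un (fP _) _; rewrite scalerDl opprD addrACA -scalerA -scalerBr.
exact: AL.
Qed.

End LinearForm.

Lemma bilin_mul (k : fieldType) (V W : lmodType k) (A : algType k)
  (f : V -> A) (g : W -> A) :
  linear f -> linear g -> bilin (fun v w => f v * g w).
Proof.
move=> lf lg; have [ml mr] := mul_bilin A.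
by split=> [w|v] a x y; rewrite ?lf ?lg ?ml ?mr.
Qed.

Section TensorAlgebra.
Variables (k : fieldType) (A B : algType k).
Implicit Types s t u : tensor A B.

Definition tens_mul : tensor A B -> tensor A B -> tensor A B :=
  tact (@GRing.mul A) (@GRing.mul B).

Let bmul : bilin tens_mul.
Proof. exact: tact_bilin (mul_bilin A) (mul_bilin B). Qed.

Lemma tens_mulE a b a' b' :
  tens_mul (a \ox b) (a' \ox b') = (a * a') \ox (b * b').
Proof. exact: tactE (mul_bilin A) (mul_bilin B) _ _ _ _. Qed.

Lemma tens_mulDl : left_distributive tens_mul +%R.
Proof. by move=> s t u; rewrite (linED (bmul.1 u)). Qed.

Lemma tens_mulDr : right_distributive tens_mul +%R.
Proof. by move=> s t u; rewrite (linED (bmul.2 s)). Qed.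

Lemma tens_mul0l t : tens_mul 0 t = 0.
Proof. exact: linE0 (bmul.1 t). Qed.

Lemma tens_mul0r t : tens_mul t 0 = 0.
Proof. exact: linE0 (bmul.2 t). Qed.

Lemma tens_mulA : associative tens_mul.
Proof.
move=> s t u; elim/tensor_ind: s => [|a b|s s' IH IH'].
- by rewrite !tens_mul0l.
- elim/tensor_ind: t => [|a' b'|t t' IH IH'].
  + by rewrite tens_mul0l !tens_mul0r tens_mul0l.
  + elim/tensor_ind: u => [|a'' b''|u u' IH IH'].
    * by rewrite !tens_mul0r.
    * by rewrite !tens_mulE !mulrA.
    * by rewrite !tens_mulDr IH IH'.
  + by rewrite tens_mulDl !tens_mulDr tens_mulDl IH IH'.
- by rewrite !tens_mulDl IH IH'.
Qed.

Lemma tens_mul1l : left_id (1 \ox 1) tens_mul.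
Proof.
elim/tensor_ind => [|a b|s t IH IH']; first exact: tens_mul0r.
- by rewrite tens_mulE !mul1r.
- by rewrite tens_mulDr IH IH'.
Qed.

Lemma tens_mul1r : right_id (1 \ox 1) tens_mul.
Proof.
elim/tensor_ind => [|a b|s t IH IH']; first exact: tens_mul0l.
- by rewrite tens_mulE !mulr1.
- by rewrite tens_mulDl IH IH'.
Qed.

Lemma tens_oner_neq0 : 1 \ox 1 != 0 :> tensor A B.
Proof.
have [f [lf f1]] := linear_form (oner_neq0 A).
have [g [lg g1]] := linear_form (oner_neq0 B).
have bh : bilin (fun x y => f x * g y : k^o).
  split=> [y|x] a u v; first by rewrite lf mulrDl scalerAl.
  by rewrite lg mulrDr scalerAr.
apply/eqP => /(congr1 (tlift (fun x y => f x * g y : k^o))).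
rewrite tliftE // f1 g1 mulr1 (linE0 (tlift_linear bh)).
by move/eqP; rewrite oner_eq0.
Qed.

HB.instance Definition _ := GRing.Zmodule_isNzRing.Build (tensor A B)
  tens_mulA tens_mul1l tens_mul1r tens_mulDl tens_mulDr tens_oner_neq0.

Lemma tens_scaleAl (a : k) s t : a *: (s * t) = (a *: s) * t.
Proof. by rewrite -[RHS]/(tens_mul _ _) (linEZ (bmul.1 t)). Qed.

Lemma tens_scaleAr (a : k) s t : a *: (s * t) = s * (a *: t).
Proof. by rewrite -[RHS]/(tens_mul _ _) (linEZ (bmul.2 s)). Qed.

HB.instance Definition _ :=
  GRing.Lmodule_isLalgebra.Build k (tensor A B) tens_scaleAl.
HB.instance Definition _ :=
  GRing.Lalgebra_isAlgebra.Build k (tensor A B) tens_scaleAr.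

Lemma tensM (a a' : A) (b b' : B) :
  (a \ox b) * (a' \ox b') = (a * a') \ox (b * b') :> tensor A B.
Proof. exact: tens_mulE. Qed.

Lemma tens11 : 1 \ox 1 = 1 :> tensor A B.
Proof. by []. Qed.

End TensorAlgebra.

Lemma tmap_alg_hom (k : fieldType) (A B A' B' : algType k)
  (f : A -> A') (g : B -> B') :
  is_alg_hom f -> is_alg_hom g -> is_alg_hom (tmap f g).
Proof.
move=> [lf f1 fM] [lg g1 gM]; have lt := tmap_linear lf lg.
split=> // [|s t]; first by rewrite -tens11 tmapE // f1 g1.
elim/tensor_ind: s => [|a b|s s' IH IH'].
- by rewrite mul0r !(linE0 lt) mul0r.
- elim/tensor_ind: t => [|a' b'|t t' IH IH'].
  + by rewrite mulr0 !(linE0 lt) mulr0.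
  + by rewrite tensM !tmapE // fM gM tensM.
  + by rewrite mulrDr !(linED lt) mulrDr IH IH'.
- by rewrite mulrDl !(linED lt) mulrDl IH IH'.
Qed.

(* Ideals are required to be proper because algType imposes 1 != 0 in the
   quotient algebra. *)
Record ideal2 (k : fieldType) (A : algType k) := Ideal2 {
  ideal2_set :> A -> Prop;
  ideal2_0 : ideal2_set 0;
  ideal2D : forall x y, ideal2_set x -> ideal2_set y -> ideal2_set (x + y);
  ideal2Ml : forall a x, ideal2_set x -> ideal2_set (a * x);
  ideal2Mr : forall a x, ideal2_set x -> ideal2_set (x * a);
  ideal2_proper : ~ ideal2_set 1
}.

Section QuotientAlgebra.
Variables (k : fieldType) (A : algType k) (I : ideal2 A).

Lemma ideal2Z (a : k) x : I x -> I (a *: x).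
Proof. by move=> Ix; rewrite -[x]mul1r scalerAl; exact: ideal2Ml. Qed.

Lemma ideal2N x : I x -> I (- x).
Proof. by move=> Ix; rewrite -scaleN1r; exact: ideal2Z. Qed.

Lemma ideal2B x y : I x -> I y -> I (x - y).
Proof. by move=> Ix Iy; apply: ideal2D => //; exact: ideal2N. Qed.

Definition ideal_relb : rel A := fun x y => `[< I (x - y) >].

Lemma ideal_relb_refl : reflexive ideal_relb.
Proof. by move=> x; apply/asboolP; rewrite subrr; exact: ideal2_0. Qed.

Lemma ideal_relb_sym : symmetric ideal_relb.
Proof. by move=> x y; apply/asboolP/asboolP => /ideal2N; rewrite opprB. Qed.

Lemma ideal_relb_trans : transitive ideal_relb.
Proof.
move=> y x z /asboolP xy /asboolP yz; apply/asboolP.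
by rewrite -[x](subrK y) -addrA; exact: ideal2D.
Qed.

Canonical ideal_equiv := EquivRel ideal_relb
  ideal_relb_refl ideal_relb_sym ideal_relb_trans.

Definition quot_alg : Type := {eq_quot ideal_equiv}.

HB.instance Definition _ : EqQuotient _ ideal_equiv quot_alg :=
  EqQuotient.on quot_alg.
HB.instance Definition _ := Choice.on quot_alg.

Definition qpi (x : A) : quot_alg := \pi_quot_alg x.

Lemma qpi_eq x y : qpi x = qpi y <-> I (x - y).
Proof.
have qP : reflect (qpi x = qpi y) `[< I (x - y) >].
  exact: (@eqmodP _ ideal_equiv).
by split=> [/qP/asboolP|xy] //; apply/qP/asboolP.
Qed.

Lemma qpiK (q : quot_alg) : qpi (repr q) = q.
Proof. exact: reprK. Qed.

Lemma qpi_repr x : I (repr (qpi x) - x).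
Proof. by apply/qpi_eq; rewrite qpiK. Qed.

Definition q_add (p q : quot_alg) := locked (qpi (repr p + repr q)).
Definition q_opp (p : quot_alg) := locked (qpi (- repr p)).
Definition q_mul (p q : quot_alg) := locked (qpi (repr p * repr q)).
Definition q_scale (a : k) (p : quot_alg) := locked (qpi (a *: repr p)).

Lemma q_addE x y : q_add (qpi x) (qpi y) = qpi (x + y).
Proof.
by rewrite /q_add -lock; apply/qpi_eq; rewrite opprD addrACA; apply: ideal2D; exact: qpi_repr.
Qed.

Lemma q_oppE x : q_opp (qpi x) = qpi (- x).
Proof.
by rewrite /q_opp -lock; apply/qpi_eq; rewrite -opprD; apply: ideal2N; exact: qpi_repr.
Qed.

Lemma q_mulE x y : q_mul (qpi x) (qpi y) = qpi (x * y).
Proof.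
rewrite /q_mul -lock; apply/qpi_eq.
set x' := repr (qpi x); set y' := repr (qpi y).
rewrite (_ : _ - _ = (x' - x) * y' + x * (y' - y)).
  by apply: ideal2D; [apply: ideal2Mr | apply: ideal2Ml]; exact: qpi_repr.
by rewrite mulrBl mulrBr addrA subrK.
Qed.

Lemma q_scaleE a x : q_scale a (qpi x) = qpi (a *: x).
Proof.
by rewrite /q_scale -lock; apply/qpi_eq; rewrite -scalerBr; apply: ideal2Z; exact: qpi_repr.
Qed.

Definition q_opE := (q_addE, q_oppE, q_mulE, q_scaleE).

Lemma q_addA : associative q_add.
Proof. by move=> x y z; rewrite -[x]qpiK -[y]qpiK -[z]qpiK !q_opE addrA. Qed.

Lemma q_addC : commutative q_add.
Proof. by move=> x y; rewrite -[x]qpiK -[y]qpiK !q_opE addrC. Qed.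

Lemma q_add0 : left_id (qpi 0) q_add.
Proof. by move=> x; rewrite -[x]qpiK !q_opE add0r. Qed.

Lemma q_addN : left_inverse (qpi 0) q_opp q_add.
Proof. by move=> x; rewrite -[x]qpiK !q_opE addNr. Qed.

HB.instance Definition _ :=
  GRing.isZmodule.Build quot_alg q_addA q_addC q_add0 q_addN.

Let qD x y : qpi x + qpi y = qpi (x + y). Proof. exact: q_addE. Qed.

Lemma q_mulA : associative q_mul.
Proof. by move=> x y z; rewrite -[x]qpiK -[y]qpiK -[z]qpiK !q_opE mulrA. Qed.

Lemma q_mul1l : left_id (qpi 1) q_mul.
Proof. by move=> x; rewrite -[x]qpiK !q_opE mul1r. Qed.

Lemma q_mul1r : right_id (qpi 1) q_mul.
Proof. by move=> x; rewrite -[x]qpiK !q_opE mulr1. Qed.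

Lemma q_mulDl : left_distributive q_mul +%R.
Proof.
by move=> x y z; rewrite -[x]qpiK -[y]qpiK -[z]qpiK !(qD, q_opE) mulrDl.
Qed.

Lemma q_mulDr : right_distributive q_mul +%R.
Proof.
by move=> x y z; rewrite -[x]qpiK -[y]qpiK -[z]qpiK !(qD, q_opE) mulrDr.
Qed.

Lemma q_oner_neq0 : qpi 1 != qpi 0.
Proof. by apply/eqP => /qpi_eq; rewrite subr0; exact: ideal2_proper. Qed.

HB.instance Definition _ := GRing.Zmodule_isNzRing.Build quot_alg
  q_mulA q_mul1l q_mul1r q_mulDl q_mulDr q_oner_neq0.

Lemma q_scaleA a b x : q_scale a (q_scale b x) = q_scale (a * b) x.
Proof. by rewrite -[x]qpiK !q_opE scalerA. Qed.

Lemma q_scale1 : left_id 1 q_scale.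
Proof. by move=> x; rewrite -[x]qpiK !q_opE scale1r. Qed.

Lemma q_scaleDr : right_distributive q_scale +%R.
Proof.
by move=> a x y; rewrite -[x]qpiK -[y]qpiK !(qD, q_opE) scalerDr.
Qed.

Lemma q_scaleDl x : {morph q_scale^~ x : a b / a + b}.
Proof. by move=> a b /=; rewrite -[x]qpiK !(qD, q_opE) scalerDl. Qed.

HB.instance Definition _ := GRing.Zmodule_isLmodule.Build k quot_alg
  q_scaleA q_scale1 q_scaleDr q_scaleDl.

Lemma q_scaleAl (a : k) (x y : quot_alg) : a *: (x * y) = (a *: x) * y.
Proof.
rewrite -[LHS]/(q_scale a (q_mul x y)) -[RHS]/(q_mul (q_scale a x) y).
by rewrite -[x]qpiK -[y]qpiK !q_opE scalerAl.
Qed.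

Lemma q_scaleAr (a : k) (x y : quot_alg) : a *: (x * y) = x * (a *: y).
Proof.
rewrite -[LHS]/(q_scale a (q_mul x y)) -[RHS]/(q_mul x (q_scale a y)).
by rewrite -[x]qpiK -[y]qpiK !q_opE scalerAr.
Qed.

HB.instance Definition _ :=
  GRing.Lmodule_isLalgebra.Build k quot_alg q_scaleAl.
HB.instance Definition _ :=
  GRing.Lalgebra_isAlgebra.Build k quot_alg q_scaleAr.

Lemma qpi_hom : is_alg_hom qpi.
Proof.
split=> //.
- move=> a x y; rewrite -[RHS]/(q_add (q_scale a (qpi x)) (qpi y)).
  by rewrite !q_opE.
- by move=> x y; rewrite -[RHS]/(q_mul (qpi x) (qpi y)) q_opE.
Qed.

Lemma qpi_eq0 x : qpi x = 0 <-> I x.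
Proof. by rewrite -[X in I X]subr0; exact: qpi_eq. Qed.

Lemma q_factor (U : lmodType k) (f : A -> U) x : linear f ->
  (forall x, I x -> f x = 0) -> f (repr (qpi x)) = f x.
Proof.
move=> lf f0; apply/eqP; rewrite -subr_eq0 -linEB //.
by apply/eqP/f0/qpi_repr.
Qed.

End QuotientAlgebra.

(* In Sweedler notation, tlift f (comul h) is the sum of f(h_1, h_2). *)
HB.mixin Record Algebra_isHopf (k : fieldType) H of GRing.Algebra k H := {
  comul : H -> tensor H H;
  counit : H -> k;
  antipode : H -> H;
  comul_linear : linear comul;
  comul_monoid : monoid_morphism comul;
  counit_linear : scalar counit;
  counit_monoid : monoid_morphism counit;
  antipode_linear : linear antipode;
  comulA : forall h, tassoc (tmap comul id (comul h)) = tmap id comul (comul h);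
  comul_counitl : forall h, tlift (fun x y => counit x *: y) (comul h) = h;
  comul_counitr : forall h, tlift (fun x y => counit y *: x) (comul h) = h;
  antipodel : forall h,
    tlift (fun x y => antipode x * y) (comul h) = counit h *: 1;
  antipoder : forall h,
    tlift (fun x y => x * antipode y) (comul h) = counit h *: 1
}.

#[short(type="hopfAlgType")]
HB.structure Definition HopfAlgebra (k : fieldType) :=
  {H of GRing.Algebra k H & Algebra_isHopf k H}.

Arguments comul {k s}.
Arguments counit {k s}.
Arguments antipode {k s}.

Section HopfMorphisms.
Variables (k : fieldType) (H : hopfAlgType k).
HB.instance Definition _ := GRing.isLinear.Build k H (tensor H H) _
  (@comul k H) comul_linear.
HB.instance Definition _ := GRing.isMonoidMorphism.Build H (tensor H H)
  (@comul k H) comul_monoid.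
HB.instance Definition _ := GRing.isLinear.Build k H k *%R
  (@counit k H) counit_linear.
HB.instance Definition _ := GRing.isMonoidMorphism.Build H k
  (@counit k H) counit_monoid.
HB.instance Definition _ := GRing.isLinear.Build k H H _
  (@antipode k H) antipode_linear.
End HopfMorphisms.

(* The underlying k-module of a module over a k-algebra. *)
Definition kmod (k : fieldType) (A : algType k) (V : lmodType A) : Type := V.

Section KMod.
Variables (k : fieldType) (A : algType k) (V : lmodType A).

HB.instance Definition _ := GRing.Zmodule.on (kmod V).

Definition kmod_scale (a : k) (v : kmod V) : kmod V := (a *: (1 : A)) *: (v : V).

Lemma kmod_scaleA a b v : kmod_scale a (kmod_scale b v) = kmod_scale (a * b) v.
Proof. by rewrite /kmod_scale scalerA -scalerAl mul1r scalerA. Qed.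

Lemma kmod_scale1 : left_id 1 kmod_scale.
Proof. by move=> v; rewrite /kmod_scale !scale1r. Qed.

Lemma kmod_scaleDr : right_distributive kmod_scale +%R.
Proof. by move=> a v w; rewrite /kmod_scale; exact: scalerDr. Qed.

Lemma kmod_scaleDl v : {morph kmod_scale^~ v : a b / a + b}.
Proof. by move=> a b; rewrite /kmod_scale !scalerDl. Qed.

HB.instance Definition _ := GRing.Zmodule_isLmodule.Build k (kmod V)
  kmod_scaleA kmod_scale1 kmod_scaleDr kmod_scaleDl.

Definition kact (x : A) (v : kmod V) : kmod V := x *: (v : V).

Lemma kact_bilin : bilin kact.
Proof.
split=> [v|x] a u w; rewrite /kact.
- by rewrite scalerDl -[in LHS](mul1r u) scalerAl -scalerA.
- rewrite [LHS]scalerDr; congr (_ + _).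
  rewrite -[LHS]/(x *: ((a *: (1 : A)) *: (u : V))).
  rewrite -[RHS]/((a *: (1 : A)) *: (x *: (u : V))).
  by rewrite !scalerA -scalerAr mulr1 -scalerAl mul1r.
Qed.

End KMod.

(* Given an algebra map d : B -> A1 (x) A2, an A1-module V and an A2-module W,
   V (x) W becomes a B-module: b . (v \ox w) = sum of (a1 v) \ox (a2 w) over
   the terms a1 \ox a2 of d b. *)
Definition tensor_mod (k : fieldType) (B A1 A2 : algType k)
  (d : {lrmorphism B -> tensor A1 A2}) (V : lmodType A1) (W : lmodType A2) : Type :=
  tensor (kmod V) (kmod W).

Section TensorMod.
Variables (k : fieldType) (B A1 A2 : algType k).
Variables (d : {lrmorphism B -> tensor A1 A2}) (V : lmodType A1) (W : lmodType A2).

HB.instance Definition _ := GRing.Zmodule.on (tensor_mod d V W).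

Let act : tensor A1 A2 -> tensor (kmod V) (kmod W) -> tensor (kmod V) (kmod W)
  := tact (@kact k A1 V) (@kact k A2 W).

Let bact : bilin act.
Proof. exact: tact_bilin (kact_bilin V) (kact_bilin W). Qed.

Let actE a b v w : act (a \ox b) (v \ox w) = kact a v \ox kact b w.
Proof. exact: tactE (kact_bilin V) (kact_bilin W) _ _ _ _. Qed.

Definition tensor_mod_scale (b : B) (x : tensor_mod d V W) : tensor_mod d V W :=
  tact (@kact k A1 V) (@kact k A2 W) (d b) x.

Let act1 x : act 1 x = x.
Proof.
elim/tensor_ind: x => [|v w|x y IHx IHy]; first exact: linE0 (bact.2 _).
- by rewrite -tens11 actE /kact !scale1r.
- by rewrite (linED (bact.2 _)) IHx IHy.
Qed.

Let actA s t x : act s (act t x) = act (s * t) x.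
Proof.
elim/tensor_ind: x => [|v w|x y IHx IHy].
- by rewrite !(linE0 (bact.2 _)).
- elim/tensor_ind: s => [|a b|s s' IH IH'].
  + by rewrite mul0r !(linE0 (bact.1 _)).
  + elim/tensor_ind: t => [|a' b'|t t' IH IH'].
    * by rewrite mulr0 !(linE0 (bact.1 _)) (linE0 (bact.2 _)).
    * by rewrite tensM !actE /kact !scalerA.
    * by rewrite mulrDr !(linED (bact.1 _)) (linED (bact.2 _)) IH IH'.
  + by rewrite mulrDl !(linED (bact.1 _)) IH IH'.
- by rewrite !(linED (bact.2 _)) IHx IHy.
Qed.

Lemma tensor_mod_scaleA a b x :
  tensor_mod_scale a (tensor_mod_scale b x) = tensor_mod_scale (a * b) x.
Proof. by rewrite /tensor_mod_scale rmorphM -/act actA. Qed.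

Lemma tensor_mod_scale1 : left_id 1 tensor_mod_scale.
Proof.
by move=> x; rewrite /tensor_mod_scale rmorph1 -/act act1.
Qed.

Lemma tensor_mod_scaleDr : right_distributive tensor_mod_scale +%R.
Proof. by move=> b x y; exact: (linED (bact.2 (d b))). Qed.

Lemma tensor_mod_scaleDl x : {morph tensor_mod_scale^~ x : a b / a + b}.
Proof.
move=> a b; rewrite /tensor_mod_scale raddfD.
exact: (linED (bact.1 x)).
Qed.

HB.instance Definition _ := GRing.Zmodule_isLmodule.Build B (tensor_mod d V W)
  tensor_mod_scaleA tensor_mod_scale1 tensor_mod_scaleDr tensor_mod_scaleDl.

End TensorMod.

Record submodule (R : pzRingType) (V : lmodType R) (N : set V) : Prop :=
  Submodule {
    submodule0 : N 0;
    submoduleD : forall x y, N x -> N y -> N (x + y);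
    submoduleZ : forall a x, N x -> N (a *: x)
  }.

Definition irreducible_module (R : pzRingType) (V : lmodType R) : Prop :=
  (exists v : V, v <> 0) /\
  forall N : set V, submodule N -> N = [set 0] \/ N = setT.

Definition completely_reducible (R : pzRingType) (V : lmodType R) : Prop :=
  forall N : set V, submodule N ->
  exists N' : set V, [/\ submodule N', N `&` N' = [set 0] &
    forall v, exists x y, [/\ N x, N' y & v = x + y]].

Definition fin_dim (k : fieldType) (A : algType k) (V : lmodType A) : Prop :=
  exists s : seq (kmod V), forall v : kmod V,
  exists c : 'I_(size s) -> k, v = \sum_(i < size s) c i *: s`_i.

Definition chevalley_property (k : fieldType) (H : hopfAlgType k) : Prop :=
  forall V W : lmodType H,
    irreducible_module V -> fin_dim V -> irreducible_module W -> fin_dim W ->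
    completely_reducible (tensor_mod (@comul k H) V W : lmodType H).

Definition subalgebra (k : fieldType) (A : algType k) (S : set A) : Prop :=
  [/\ S 1, forall a x y, S x -> S y -> S (a *: x + y)
    & forall x y, S x -> S y -> S (x * y)].

Definition affine (k : fieldType) (A : algType k) : Prop :=
  exists s : seq A, forall S : set A,
  subalgebra S -> (forall x, x \in s -> S x) -> S = setT.

Record centralHopfSubalg (k : fieldType) (H : hopfAlgType k) :=
  CentralHopfSubalg {
    chs_set :> H -> Prop;
    chs_subalgebra : subalgebra chs_set;
    chs_central : forall c h, chs_set c -> c * h = h * c;
    chs_comul : forall c, chs_set c -> exists s : seq (H * H),
      (forall p, p \in s -> chs_set p.1 /\ chs_set p.2) /\
      comul c = \sum_(p <- s) p.1 \ox p.2;
    chs_antipode : forall c, chs_set c -> chs_set (antipode c)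
  }.

Section Fibers.
Variables (k : fieldType) (H : hopfAlgType k) (C : centralHopfSubalg H).

Definition fin_gen_over : Prop :=
  exists s : seq H, forall h : H, exists c : 'I_(size s) -> H,
  (forall i, C (c i)) /\ h = \sum_(i < size s) c i * s`_i.

Definition ideal_in (I : set H) : Prop :=
  [/\ I `<=` C, I 0, forall x y, I x -> I y -> I (x + y)
    & forall c x, C c -> I x -> I (c * x)].

Record maxSpec := MaxSpec {
  max_set :> H -> Prop;
  max_ideal : ideal_in max_set;
  max_proper : ~ max_set 1;
  max_max : forall J, ideal_in J -> max_set `<=` J -> ~ J 1 -> J = max_set
}.

(* The ideal m H of H. *)
Definition extended_set (m : set H) : set H := [set x |
  exists s : seq (H * H), (forall p, p \in s -> m p.1) /\
  x = \sum_(p <- s) p.1 * p.2].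

Lemma extended_ideal0 m : extended_set m 0.
Proof. by exists [::]; rewrite big_nil. Qed.

Lemma extended_idealD m x y :
  extended_set m x -> extended_set m y -> extended_set m (x + y).
Proof.
move=> [s [ms ->]] [t [mt ->]]; exists (s ++ t); rewrite big_cat; split=> // p.
by rewrite mem_cat => /orP[/ms|/mt].
Qed.

Lemma extended_idealMr m a x : extended_set m x -> extended_set m (x * a).
Proof.
move=> [s [ms ->]]; exists [seq (p.1, p.2 * a) | p <- s]; split=> [_ /mapP[p /ms mp ->] //|].
by rewrite big_map mulr_suml; apply: eq_bigr => p _ /=; rewrite mulrA.
Qed.

Lemma extended_idealMl (m : maxSpec) a x :
  extended_set m x -> extended_set m (a * x).
Proof.
have [mC _ _ _] := max_ideal m.
move=> [s [ms ->]]; exists [seq (p.1, a * p.2) | p <- s]; split=> [_ /mapP[p /ms mp ->] //|].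
rewrite big_map mulr_sumr big_seq [RHS]big_seq; apply: eq_bigr => p /ms /mC Cp /=.
by rewrite !mulrA (chs_central a Cp).
Qed.

Let C0 : C 0.
Proof.
have [C1 CL _] := chs_subalgebra C.
by have := CL (-1) 1 1 C1 C1; rewrite scaleN1r addNr.
Qed.

Let CD x y : C x -> C y -> C (x + y).
Proof. by have [_ CL _] := chs_subalgebra C; move=> Cx Cy; have := CL 1 _ _ Cx Cy; rewrite scale1r. Qed.

Let CZ a x : C x -> C (a *: x).
Proof. by have [_ CL _] := chs_subalgebra C; move=> Cx; have := CL a _ _ Cx C0; rewrite addr0. Qed.

Section Nakayama.
Variable m : maxSpec.

Let mC : m `<=` C. Proof. by have [] := max_ideal m. Qed.
Let m0 : m 0. Proof. by have [] := max_ideal m. Qed.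
Let mD x y : m x -> m y -> m (x + y).
Proof. by have [_ _ + _] := max_ideal m; apply. Qed.
Let mM c x : C c -> m x -> m (c * x).
Proof. by have [_ _ _] := max_ideal m; apply. Qed.
Let CM x y : C x -> C y -> C (x * y).
Proof. by have [_ _ +] := chs_subalgebra C; apply. Qed.
Let C1 : C 1. Proof. by have [] := chs_subalgebra C. Qed.
Let CN x : C x -> C (- x).
Proof. by rewrite -scaleN1r; exact: CZ. Qed.
Let mN x : m x -> m (- x).
Proof. by rewrite -mulN1r; apply/mM/CN/C1. Qed.

Fixpoint mspan (s : seq H) (x : H) : Prop :=
  if s is a :: s' then exists2 c, m c & mspan s' (x - c * a) else x = 0.

Lemma mspan0 s : mspan s 0.
Proof. by elim: s => [|a s IH] //=; exists 0; rewrite // mul0r subr0. Qed.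

Lemma mspanD s x y : mspan s x -> mspan s y -> mspan s (x + y).
Proof.
elim: s x y => [|a s IH] x y /=; first by move=> -> ->; rewrite addr0.
move=> [c mc sx] [d md sy]; exists (c + d); first exact: mD.
by rewrite mulrDl opprD addrACA; exact: IH.
Qed.

Lemma mspanM s u x : C u -> mspan s x -> mspan s (u * x).
Proof.
move=> Cu; elim: s x => [|a s IH] x /=; first by move=> ->; rewrite mulr0.
move=> [c mc sx]; exists (u * c); first exact: mM.
by rewrite -mulrA -mulrBr; exact: IH.
Qed.

Lemma mspan_kill s u x : C u -> (forall b, b \in s -> u * b = 0) ->
  mspan s x -> u * x = 0.
Proof.
move=> Cu; elim: s x => [|a s IH] x us /=; first by move=> ->; rewrite mulr0.
move=> [c mc sx]; rewrite -[x](subrK (c * a)) mulrDr mulrA (chs_central c Cu).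
rewrite -mulrA (us a) ?mem_head // mulr0 addr0; apply: IH => // b bs.
by apply: us; rewrite inE bs orbT.
Qed.

Lemma unit_mod_mM u v : C u -> m (1 - u) -> m (1 - v) -> m (1 - u * v).
Proof.
move=> Cu mu mv; rewrite (_ : _ - _ = (1 - u) + u * (1 - v)).
  by apply: mD => //; exact: mM.
by rewrite mulrBr mulr1 addrA subrK.
Qed.

Lemma nakayama_seq s u : C u -> m (1 - u) ->
  (forall b, b \in s -> mspan s (u * b)) ->
  exists v, [/\ C v, m (1 - v) & forall b, b \in s -> v * b = 0].
Proof.
elim: s u => [|a s IH] u Cu mu us; first by exists u.
have [c mc /= sy] := us a (mem_head _ _); have Cc := mC mc.
pose v := u - c; have Cv : C v by apply: CD => //; exact: CN.
have mv : m (1 - v) by rewrite opprB addrCA addrC; exact: mD.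
have sva : mspan s (v * a) by rewrite mulrBl.
have [|||w [Cw mw ws]] := IH (v * u).
- exact: CM.
- exact: unit_mod_mM.
- move=> b bs; have [|d md /= sz] := us b; first by rewrite inE bs orbT.
  have Cd := mC md.
  rewrite -mulrA -[u * b](subrK (d * a)) mulrDr; apply: mspanD.
    exact: mspanM.
  by rewrite mulrA (chs_central d Cv) -mulrA; exact: mspanM.
exists (w * v); split=> [||b]; [exact: CM | exact: unit_mod_mM |].
rewrite inE => /orP[/eqP ->|bs]; first by rewrite -mulrA (mspan_kill Cw ws).
by rewrite (chs_central v Cw) -mulrA ws // mulr0.
Qed.

Lemma mspan_gen (s : seq H) (c : 'I_(size s) -> H) :
  (forall i, m (c i)) -> mspan s (\sum_(i < size s) c i * s`_i).
Proof.
elim: s c => [|a s IH] c mc /=; first by rewrite big_ord0.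
exists (c ord0) => //; rewrite big_ord_recl /= addrAC subrr add0r.
by apply: IH => i; exact: mc.
Qed.

Lemma extended_proper : fin_gen_over -> ~ extended_set m 1.
Proof.
move=> [s sP] m1.
have span x : mspan s x.
  have [t [tm ->]] : extended_set m x.
    by rewrite -[x]mul1r; exact: extended_idealMr.
  rewrite big_seq; apply: (big_ind (mspan s)); [exact: mspan0 | exact: mspanD |].
  move=> p /tm mp; have [c [Cc ->]] := sP p.2; rewrite mulr_sumr.
  under eq_bigr do rewrite mulrA; apply: mspan_gen => i.
  by rewrite (chs_central _ (mC mp)); exact: mM.
have m11 : m (1 - 1) by rewrite subrr.
have [v [Cv mv vs]] := nakayama_seq C1 m11 (fun b _ => span _).
have := mspan_kill Cv vs (span 1); rewrite mulr1 => v0.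
by move: mv; rewrite v0 subr0; exact: max_proper.
Qed.

End Nakayama.

(* Finite generation over C makes every m H proper (Nakayama); this is the only
   use of fg in the definitions below. *)
Variable fg : fin_gen_over.

Definition extended_ideal (m : maxSpec) : ideal2 H :=
  Ideal2 (extended_ideal0 m) (@extended_idealD m)
    (@extended_idealMl m) (@extended_idealMr m) (@extended_proper m fg).

Definition fiber (m : maxSpec) : Type := quot_alg (extended_ideal m).

HB.instance Definition _ (m : maxSpec) := GRing.Algebra.on (fiber m).

Definition fiber_pi (m : maxSpec) : H -> fiber m := qpi (extended_ideal m).

Lemma fiber_pi_hom m : is_alg_hom (fiber_pi m).
Proof. exact: qpi_hom. Qed.

Lemma fiber_pi0 (m : maxSpec) c : m c -> fiber_pi m c = 0.
Proof.
move=> mc; apply/qpi_eq0; exists [:: (c, 1)]; rewrite big_seq1 mulr1.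
by split=> // p; rewrite inE => /eqP ->.
Qed.

(* The kernel of the restriction of the counit to C. *)
Definition eps_set : set H := [set c | C c /\ counit c = 0].

Lemma eps_ideal : ideal_in eps_set.
Proof.
have [C1 CL CM] := chs_subalgebra C.
split=> [c [] //||x y [Cx x0] [Cy y0]|c x Cc [Cx x0]].
- by split; rewrite ?raddf0.
- by split; [exact: CD | rewrite raddfD /= x0 y0 addr0].
- by split; [exact: CM | rewrite rmorphM /= x0 mulr0].
Qed.

Lemma eps_proper : ~ eps_set 1.
Proof. by move=> [_]; rewrite rmorph1 => /eqP; rewrite oner_eq0. Qed.

Let eps_shift c : C c -> eps_set (c - counit c *: 1).
Proof.
have [C1 _ _] := chs_subalgebra C.
move=> Cc; split; last by rewrite raddfB /= linearZ /= rmorph1 mulr1 subrr.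
by rewrite -scaleNr; apply: CD => //; exact: CZ.
Qed.

Lemma eps_max J : ideal_in J -> eps_set `<=` J -> ~ J 1 -> J = eps_set.
Proof.
have [C1 CL CM] := chs_subalgebra C.
move=> [JC J0 JD JM] eJ J1; apply/seteqP; split=> // x Jx; split; first exact: JC.
have [//|nz] := eqVneq (counit x) 0; case: J1.
have CN1 : C (- 1) by rewrite -scaleN1r; exact: CZ.
have : J (counit x *: 1).
  rewrite -(subKr x (counit x *: 1)); apply: JD => //.
  by rewrite -mulN1r; apply: JM => //; apply/eJ/eps_shift/JC.
move=> /(JM ((counit x)^-1 *: 1) _ (CZ _ C1)).
by rewrite -scalerAl mul1r scalerA mulVf // scale1r.
Qed.

Definition eps_spec : maxSpec := MaxSpec eps_ideal eps_proper eps_max.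

Definition id_fiber : Type := fiber eps_spec.

HB.instance Definition _ := GRing.Algebra.on id_fiber.

Definition id_pi : H -> id_fiber := fiber_pi eps_spec.

Let pih : is_alg_hom id_pi. Proof. exact: fiber_pi_hom. Qed.

Lemma id_pi_C c : C c -> id_pi c = counit c *: 1.
Proof.
move=> Cc; have : id_pi (c - counit c *: 1) = 0 by apply/fiber_pi0/eps_shift.
rewrite (linEB (alg_hom_linear pih)) (linEZ (alg_hom_linear pih)) (alg_hom1 pih).
by move/eqP; rewrite subr_eq0 => /eqP.
Qed.

Lemma extended_ind (U : lmodType k) (f : H -> U) (m : set H) x :
  linear f -> (forall c h, m c -> f (c * h) = 0) -> extended_set m x -> f x = 0.
Proof.
move=> lf f0 [s [ms ->]]; rewrite (linE_sum lf) big_seq big1 // => p /ms.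
exact: f0.
Qed.

Section Coaction.
Variable m : maxSpec.

Let pmh : is_alg_hom (fiber_pi m). Proof. exact: fiber_pi_hom. Qed.

Definition coaction_lift (h : H) : tensor id_fiber (fiber m) :=
  tmap id_pi (fiber_pi m) (comul h).

Lemma coaction_lift_hom : is_alg_hom coaction_lift.
Proof.
have [lt t1 tM] := tmap_alg_hom pih pmh; have [lc c1 cM] := lrmorphism_hom (@comul k H : {lrmorphism H -> tensor H H}).
split=> [a x y||x y]; rewrite /coaction_lift.
- by rewrite lc lt.
- by rewrite c1 t1.
- by rewrite cM tM.
Qed.

Lemma coaction_lift_C c : C c -> coaction_lift c = 1 \ox fiber_pi m c.
Proof.
move=> /chs_comul[s [sC dc]].
have [tl tr] := tens_bilin id_fiber (fiber m).
rewrite -[in RHS](comul_counitl c) /coaction_lift dc.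
have bh : bilin (fun (x y : H) => counit x *: y : H).
  split=> [y|x] a u v.
  - by rewrite linearP /= scalerDl scalerA.
  - by rewrite scalerDr !scalerA mulrC.
rewrite (linE_sum (tmap_linear (alg_hom_linear pih) (alg_hom_linear pmh))).
rewrite (linE_sum (tlift_linear bh)) (linE_sum (alg_hom_linear pmh)) (linE_sum (tr 1)).
rewrite big_seq [RHS]big_seq; apply: eq_bigr => p /sC[Cp _].
rewrite (tmapE (alg_hom_linear pih) (alg_hom_linear pmh)) (tliftE bh) id_pi_C //.
by rewrite (linEZ (alg_hom_linear pmh)) (linEZ (tl _)) (linEZ (tr _)).
Qed.

Lemma coaction_lift0 x : extended_ideal m x -> coaction_lift x = 0.
Proof.
have [lc _ cM] := coaction_lift_hom; have [mC _ _ _] := max_ideal m.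
have [tl tr] := tens_bilin id_fiber (fiber m).
apply: extended_ind => // c h mc; rewrite cM coaction_lift_C; last exact: mC.
by rewrite (fiber_pi0 mc) (linE0 (tr 1)) mul0r.
Qed.

(* The algebra map H / m H -> (H / m_eps H) (x) (H / m H) induced by comul. *)
Definition coaction_fun (q : fiber m) : tensor id_fiber (fiber m) :=
  coaction_lift (repr (q : quot_alg (extended_ideal m))).

Lemma coaction_funE h : coaction_fun (fiber_pi m h) = coaction_lift h.
Proof.
apply: q_factor; [exact: alg_hom_linear coaction_lift_hom | exact: coaction_lift0].
Qed.

Lemma fiber_piP (q : fiber m) : exists h, q = fiber_pi m h.
Proof. by exists (repr (q : quot_alg (extended_ideal m))); rewrite /fiber_pi qpiK. Qed.

Lemma coaction_fun_hom : is_alg_hom coaction_fun.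
Proof.
have [lc c1 cM] := coaction_lift_hom; have [lp p1 pM] := pmh.
split=> [a x y||x y].
- have [h ->] := fiber_piP x; have [h' ->] := fiber_piP y.
  by rewrite -lp !coaction_funE lc.
- by rewrite -p1 coaction_funE.
- have [h ->] := fiber_piP x; have [h' ->] := fiber_piP y.
  by rewrite -pM !coaction_funE cM.
Qed.

HB.instance Definition _ := GRing.isLinear.Build k _ _ _ coaction_fun
  (alg_hom_linear coaction_fun_hom).
HB.instance Definition _ := GRing.isMonoidMorphism.Build _ _ coaction_fun
  (alg_hom1 coaction_fun_hom, alg_homM coaction_fun_hom).

Definition coaction : {lrmorphism fiber m -> tensor id_fiber (fiber m)} :=
  coaction_fun.

End Coaction.

Let p := id_pi.
Let lp : linear p. Proof. exact: alg_hom_linear pih. Qed.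
Let p1 : p 1 = 1. Proof. exact: alg_hom1 pih. Qed.
Let pM : {morph p : x y / x * y}. Proof. exact: alg_homM pih. Qed.
Let S : H -> H := antipode.
Let lS : linear S. Proof. exact: antipode_linear. Qed.
Let lpS : linear (p \o S). Proof. exact: lin_comp lp lS. Qed.
Let lD : linear (@comul k H). Proof. exact: comul_linear. Qed.

Let bmul (A : algType k) (f g : H -> A) : linear f -> linear g ->
  bilin (fun x y => f x * g y).
Proof. exact: bilin_mul. Qed.

Let bcounitl : bilin (fun x y : H => counit x *: y).
Proof.
split=> [y|x] a u v; first by rewrite linearP /= scalerDl scalerA.
by rewrite scalerDr !scalerA mulrC.
Qed.

Let bcounitr : bilin (fun x y : H => counit y *: x).
Proof.
split=> [y|x] a u v; last by rewrite linearP /= scalerDl scalerA.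
by rewrite scalerDr !scalerA mulrC.
Qed.

Section AntipodeDescends.
Variable c : H.
Hypothesis Cc : C c.

Let phi (h : H) : id_fiber := p (S (c * h)).

Let lphi : linear phi.
Proof. by move=> a x y; rewrite /phi mulrDr -scalerAr lS lp. Qed.

Let G : tensor H H -> id_fiber := tlift (fun x y => phi x * p y).

Let bG : bilin (fun x y => phi x * p y). Proof. exact: bmul. Qed.

Let phi_conv h : G (comul h) = (counit c * counit h) *: 1.
Proof.
have bF := bmul lpS lp.
rewrite -(rmorphM counit) /= -p1 -(linEZ lp) -antipodel (lin_tlift _ _ lp).
rewrite (_ : tlift _ _ = tlift (fun x y => (p \o S) x * p y) (comul (c * h)));
  last by apply: eq_tlift => x y; rewrite pM.
rewrite (rmorphM comul) /=.
have [s [sC dc]] := chs_comul Cc.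
have [ml mr] := mul_bilin (tensor H H).
move: (comul h); apply: tensor_ext; first exact: tlift_linear bG.
  move=> a x y; rewrite mr; exact: tlift_linear.
move=> x y; rewrite [LHS](tliftE bG) dc mulr_suml (linE_sum (tlift_linear bF)).
rewrite /phi -[in LHS](comul_counitr c) dc (linE_sum (tlift_linear bcounitr)).
rewrite mulr_suml (linE_sum lS) (linE_sum lp) mulr_suml.
rewrite big_seq [RHS]big_seq; apply: eq_bigr => q /sC[_ Cq].
rewrite (tliftE bcounitr) tensM (tliftE bF) /= pM (id_pi_C Cq : p q.2 = _).
rewrite -!scalerAl mul1r -scalerAr (linEZ lS) (linEZ lp).
by rewrite -scalerAl.
Qed.

Lemma id_pi_antipode h : p (S (c * h)) = counit c *: p (S h).
Proof.
have bN := bmul lp lpS.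
have lG : linear G by exact: tlift_linear.
have bL : bilin (fun u t => phi u * tlift (fun v w => p v * (p \o S) w) t).
  by apply: bilin_mul => //; exact: tlift_linear.
have bM : bilin (fun t w => G t * (p \o S) w) by exact: bilin_mul.
pose L := tlift (fun u t => phi u * tlift (fun v w => p v * (p \o S) w) t).
have LM t : L (tassoc t) = tlift (fun t w => G t * (p \o S) w) t.
  move: t; apply: tensor_ext.
  - exact: (lin_comp (tlift_linear bL) (@tassoc_linear _ _ _ _)).
  - exact: tlift_linear.
  move=> t w; rewrite (tliftE bM); move: t; apply: tensor_ext.
  - move=> a x y /=; rewrite (tens_bilin _ _).1 tassoc_linear.
    exact: tlift_linear.
  - exact: bM.1.
  move=> u v; rewrite tassocE /L (tliftE bL) (tliftE bN) /G (tliftE bG).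
  by rewrite mulrA.
have LE : L (tmap id comul (comul h)) = phi h.
  rewrite /L (tlift_tmap _ _ _ bL) -[in RHS](comul_counitr h).
  rewrite (lin_tlift _ _ lphi); apply: eq_tlift => x y.
  rewrite (linEZ lphi) -[RHS]mulr1 -scalerAl scalerAr; congr (_ * _).
  rewrite -p1 -(linEZ lp) -antipoder (lin_tlift _ _ lp).
  by apply: eq_tlift => a b; rewrite pM.
rewrite -[LHS]LE -comulA LM (tlift_tmap _ _ _ bM).
rewrite -[p (S h)]/((p \o S) h) -[in RHS](comul_counitl h).
rewrite (lin_tlift _ _ lpS) -[RHS]addr0.
rewrite (_ : 0 = tlift (fun _ _ : H => 0 : id_fiber) (comul h)); last first.
  by rewrite /tlift big1.
rewrite -tlift_funlin; apply: eq_tlift => a b.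
by rewrite phi_conv addr0 (linEZ lpS) scalerA -scalerAl mul1r.
Qed.

End AntipodeDescends.

Definition id_comul : id_fiber -> tensor id_fiber id_fiber :=
  @coaction_fun eps_spec.
Definition id_counit (q : id_fiber) : k :=
  counit (repr (q : quot_alg (extended_ideal eps_spec))).
Definition id_antipode (q : id_fiber) : id_fiber :=
  id_pi (antipode (repr (q : quot_alg (extended_ideal eps_spec)))).

Lemma id_piP (q : id_fiber) : exists h, q = id_pi h.
Proof. exact: fiber_piP. Qed.

Lemma id_comulE h : id_comul (id_pi h) = tmap id_pi id_pi (comul h).
Proof. exact: coaction_funE. Qed.

Lemma id_counitE h : id_counit (id_pi h) = counit h.
Proof.
pose f : H -> k^o := counit; apply: (@q_factor _ _ _ k^o f).
  by move=> a x y; rewrite /f linearP.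
move=> x; apply: extended_ind => [a u v|d u [_ d0]]; first by rewrite /f linearP.
by rewrite /f rmorphM /= d0 mul0r.
Qed.

Lemma id_antipodeE h : id_antipode (id_pi h) = id_pi (antipode h).
Proof.
apply: (q_factor (f := p \o S)) => // x; apply: extended_ind => // d u [Cd d0].
by rewrite /= id_pi_antipode // d0 scale0r.
Qed.

Let id_comul_hom : is_alg_hom id_comul.
Proof. exact: coaction_fun_hom. Qed.

Let id_comul_linear : linear id_comul.
Proof. exact: alg_hom_linear id_comul_hom. Qed.

Let id_comul_monoid : monoid_morphism id_comul.
Proof. by split; [exact: alg_hom1 id_comul_hom | exact: alg_homM id_comul_hom]. Qed.

Let id_counit_linear : scalar id_counit.
Proof.
move=> a x y; have [h ->] := id_piP x; have [h' ->] := id_piP y.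
by rewrite -lp !id_counitE linearP.
Qed.

Let id_counit_monoid : monoid_morphism id_counit.
Proof.
split=> [|x y]; first by rewrite -p1 id_counitE rmorph1.
have [h ->] := id_piP x; have [h' ->] := id_piP y.
by rewrite -pM !id_counitE rmorphM.
Qed.

Let id_antipode_linear : linear id_antipode.
Proof.
move=> a x y; have [h ->] := id_piP x; have [h' ->] := id_piP y.
by rewrite -lp !id_antipodeE -lp; congr p; exact: lS.
Qed.

Let id_comulA q :
  tassoc (tmap id_comul id (id_comul q)) = tmap id id_comul (id_comul q).
Proof.
have [h ->] := id_piP q; rewrite id_comulE.
have lpp := tmap_linear lp lp.
rewrite !tmap_comp //; try exact: lin_id.
rewrite (eq_tmap (f' := tmap p p \o comul) (g' := p \o id)) //; last first.
  exact: id_comulE.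
rewrite -[in LHS]tmap_comp //; try exact: lin_id.
rewrite tassoc_tmap // comulA tmap_comp //; try exact: lin_id.
by apply: eq_tmap => // x /=; rewrite id_comulE.
Qed.

Let bilin_idcl : bilin (fun x y : id_fiber => id_counit x *: y).
Proof.
split=> [y|x] a u v; first by rewrite id_counit_linear scalerDl scalerA.
by rewrite scalerDr !scalerA mulrC.
Qed.

Let bilin_idcr : bilin (fun x y : id_fiber => id_counit y *: x).
Proof.
split=> [y|x] a u v; last by rewrite id_counit_linear scalerDl scalerA.
by rewrite scalerDr !scalerA mulrC.
Qed.

Let id_comul_counitl q : tlift (fun x y => id_counit x *: y) (id_comul q) = q.
Proof.
have [h ->] := id_piP q; rewrite id_comulE tlift_tmap //.
rewrite -/p -[in RHS](comul_counitl h) (lin_tlift _ _ lp).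
by apply: eq_tlift => x y; rewrite id_counitE (linEZ lp).
Qed.

Let id_comul_counitr q : tlift (fun x y => id_counit y *: x) (id_comul q) = q.
Proof.
have [h ->] := id_piP q; rewrite id_comulE tlift_tmap //.
rewrite -/p -[in RHS](comul_counitr h) (lin_tlift _ _ lp).
by apply: eq_tlift => x y; rewrite id_counitE (linEZ lp).
Qed.

Let id_antipodel q :
  tlift (fun x y => id_antipode x * y) (id_comul q) = id_counit q *: 1.
Proof.
have [h ->] := id_piP q; rewrite id_comulE tlift_tmap //; last first.
  by apply: bilin_mul => //; exact: lin_id.
rewrite id_counitE -p1 -(linEZ lp) -antipodel (lin_tlift _ _ lp).
by apply: eq_tlift => x y; rewrite id_antipodeE pM.
Qed.

Let id_antipoder q :
  tlift (fun x y => x * id_antipode y) (id_comul q) = id_counit q *: 1.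
Proof.
have [h ->] := id_piP q; rewrite id_comulE tlift_tmap //; last first.
  by apply: bilin_mul => //; exact: lin_id.
rewrite id_counitE -p1 -(linEZ lp) -antipoder (lin_tlift _ _ lp).
by apply: eq_tlift => x y; rewrite id_antipodeE pM.
Qed.

HB.instance Definition _ := Algebra_isHopf.Build k id_fiber
  id_comul_linear id_comul_monoid id_counit_linear id_counit_monoid
  id_antipode_linear id_comulA id_comul_counitl id_comul_counitr
  id_antipodel id_antipoder.

(* V and W range over representatives of the isomorphism classes in Irr; all
   irreducible modules are allowed, without a dimension hypothesis. *)
Definition Chev : set maxSpec := [set m |
  forall (V : lmodType id_fiber) (W : lmodType (fiber m)),
  irreducible_module V -> irreducible_module W ->
  completely_reducible (tensor_mod (coaction m) V W : lmodType (fiber m))].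

End Fibers.

(* Main.v *)
Require Import Defs.
From HB Require Import structures.
From mathcomp Require Import all_boot all_order all_algebra.
From mathcomp Require Import boolp classical_sets.

Set Implicit Arguments.
Unset Strict Implicit.
Unset Printing Implicit Defensive.

Import GRing.Theory.

Local Open Scope classical_set_scope.
Local Open Scope ring_scope.

(** One implication is immediate: the coaction of the identity fiber on itself
    is its own coproduct, so the kernel of the counit lies in the Chevalley locus
    exactly when tensor products of irreducible modules of the identity fiber
    are completely reducible.

    For the converse write [A] for the identity fiber, [B] for the fiber at [m]
    and [Z] for the image of [C] in [B].  [Z] is a central field, [A] is
    finite-dimensional over [k], and [B] has finite length over [Z].  The
    argument works for every [A]-comodule algebra [B] of this kind
    ([cr_tensor_irreducible]).

    Among the cyclic completely reducible [A]-modules there is a largest one,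
    [R = A g], namely [A] modulo its radical ([exists_cover]).  Every irreducible
    [V] is a quotient of [R], so it is enough that [R (x) W] be completely
    reducible for each irreducible [B]-module [W].  Two properties of [R] are
    used.  First, the Chevalley property makes [R (x) R] completely reducible, so
    each vector [v] of [R] gives an [A]-linear map [a g |-> a (g (x) v)], and
    together these maps identify [dim R] copies of [R] with [R (x) R]
    ([cover_doubling]).  Second, the trivial module is a direct summand of [R]
    ([cover_integral]).

    For a maximal left ideal [a] of [B] and a [B]-module [X] of finite length,
    let [h_a(X)] be the length over [Z] of [Hom_B(B / a, R (x) X)].  This is
    subadditive on short exact sequences, and [h_a(R (x) X)] is at least
    [dim R] times [h_a(X)], whereas the length of [R (x) X] is exactly [dim R]
    times that of [X].  Let [r] be the maximal value of [h_a(X) / len X]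
    ([max_ratio]) and call [X] good for [a] when it attains [r].  Then
    submodules and quotients of good modules are good, [R (x) X] is good when
    [X] is, and [Hom_B(B / a, R (x) -)] is exact on the submodules and quotients
    of a good module.  A good [X] has a nonzero map from [B / a] to [R (x) X], so
    [B / a] is itself good for [a] ([good_ideal]).

    Now let [U = B / a] be a simple subquotient of [Y = R (x) W], where
    [W = B / a0].  Since [W] is good for [a0], so are [Y] and [U]; as [r > 0],
    there is a copy of [W] in [R (x) U].  Since [U] is good for [a], so is
    [R (x) U], hence [W], hence [Y].  Therefore [Hom_B(U, R (x) -)] is exact on
    [Y], and so is [Hom_B(U, -)] because [U] is a direct summand of [R (x) U].
    Every simple subquotient of [Y] thus lifts to a submodule, which is complete
    reducibility ([cr_tensR]).

    Subquotients are handled throughout as intervals [N `<=` N'] of submodules,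
    and homomorphisms out of [B / a] as elements killed by [a]. *)

(** * Lengths of intervals of stable subgroups *)

Lemma subset_eq T (A B : set T) : A `<=` B -> B `<=` A -> A = B.
Proof. by move=> AB BA; apply/seteqP. Qed.

Section LinearMaps.
Variables (R : pzRingType) (V W : lmodType R) (f : V -> W).
Hypothesis lf : linear f.

Lemma linear_0 : f 0 = 0.
Proof. by have := lf (-1) 0 0; rewrite scaler0 addr0 scaleN1r addNr. Qed.

Lemma linear_D x y : f (x + y) = f x + f y.
Proof. by have := lf 1 x y; rewrite !scale1r. Qed.

Lemma linear_Z a x : f (a *: x) = a *: f x.
Proof. by have := lf a x 0; rewrite !addr0 linear_0 addr0. Qed.

End LinearMaps.

Definition sadd (V : zmodType) (S P : set V) : set V :=
  [set v | exists x y, [/\ S x, P y & v = x + y]].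

(** Subgroups stable under the scalars [Z]; for [Z] the image of a field these
    are its subspaces, so that [len] below is a difference of dimensions. *)
Record zsub (R : pzRingType) (Z : set R) (V : lmodType R) (S : set V) : Prop :=
  ZSub {
    zsub0 : S 0;
    zsubB : forall x y, S x -> S y -> S (x - y);
    zsubZ : forall z x, Z z -> S x -> S (z *: x)
  }.

(** A strict chain with [n] steps from a set containing [P] up to [S].  Working
    in the interval from [P] to [S] stands for working in the quotient [S / P]. *)
Fixpoint chain (R : pzRingType) (Z : set R) (V : lmodType R) (P S : set V)
    (n : nat) : Prop :=
  if n is n'.+1 then exists S', [/\ zsub Z S', S' `<` S & chain Z P S' n']
  else P `<=` S.

Definition fin_len (R : pzRingType) (Z : set R) (V : lmodType R) (P S : set V) :=
  exists N, forall n, chain Z P S n -> (n <= N)%N.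

Definition zlinear (R : pzRingType) (Z : set R) (V W : lmodType R) (f : V -> W) :=
  (forall x y, f (x - y) = f x - f y) /\ (forall z x, Z z -> f (z *: x) = z *: f x).

Lemma linear_zlinear (R : pzRingType) (Z : set R) (V W : lmodType R) (f : V -> W) :
  linear f -> zlinear Z f.
Proof.
move=> lf; split=> [x y|z x _]; last exact: linear_Z.
by rewrite [x - y]addrC -scaleN1r lf scaleN1r addrC.
Qed.

Section Length.
Variables (R : pzRingType) (Z : set R).

Section OneModule.
Variable V : lmodType R.
Implicit Types P Q S : set V.

Lemma zsubD S x y : zsub Z S -> S x -> S y -> S (x + y).
Proof.
move=> [S0 SB _] Sx Sy; have SNy : S (- y) by rewrite -sub0r; exact: SB.
by rewrite -[y]opprK; exact: SB.
Qed.

Lemma zsubI S P : zsub Z S -> zsub Z P -> zsub Z (S `&` P).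
Proof.
move=> [S0 SB SZ] [P0 PB PZ]; split; first by split.
- by move=> x y [Sx Px] [Sy Py]; split; [exact: SB | exact: PB].
- by move=> z x Zz [Sx Px]; split; [exact: SZ | exact: PZ].
Qed.

Lemma zsub_sadd S P : zsub Z S -> zsub Z P -> zsub Z (sadd S P).
Proof.
move=> [S0 SB SZ] [P0 PB PZ]; split.
- by exists 0, 0; rewrite addr0.
- move=> _ _ [x [y [Sx Py ->]]] [x' [y' [Sx' Py' ->]]]; exists (x - x'), (y - y').
  by split; [exact: SB | exact: PB | rewrite opprD addrACA].
- move=> z _ Zz [x [y [Sx Py ->]]]; exists (z *: x), (z *: y).
  by split; [exact: SZ | exact: PZ | rewrite scalerDr].
Qed.

Lemma submodule_zsub S : submodule S -> zsub Z S.
Proof.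
move=> [S0 SD SZ]; split=> // [x y Sx Sy|z x _ Sx]; last exact: SZ.
by apply: SD => //; rewrite -scaleN1r; exact: SZ.
Qed.

Lemma sub_saddl S P : zsub Z P -> S `<=` sadd S P.
Proof. by move=> zP x Sx; exists x, 0; split=> //; [exact: zsub0 zP | rewrite addr0]. Qed.

Lemma sub_saddr S P : zsub Z S -> P `<=` sadd S P.
Proof. by move=> zS x Px; exists 0, x; split=> //; [exact: zsub0 zS | rewrite add0r]. Qed.

Lemma sadd_sub S P Q : zsub Z Q -> S `<=` Q -> P `<=` Q -> sadd S P `<=` Q.
Proof. by move=> zQ SQ PQ _ [x [y [/SQ Qx /PQ Qy ->]]]; exact: zsubD. Qed.

Lemma chain_sub P S n : chain Z P S n -> P `<=` S.
Proof.
elim: n S => [|n IH] S //= [S' [_ [S'S _] /IH PS']].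
exact: subset_trans S'S.
Qed.

Lemma proper_exP P S : P `<` S <-> P `<=` S /\ exists2 x, S x & ~ P x.
Proof.
split=> [[PS nSP]|[PS [x Sx nPx]]]; split=> //; last by move=> /(_ x Sx).
by apply: contrapT => nex; apply: nSP => x Sx; apply: contrapT => nPx; apply: nex; exists x.
Qed.

Lemma chain_mono P S S' n : S `<=` S' -> chain Z P S n -> chain Z P S' n.
Proof.
case: n => [|n] SS' /=; first by move=> PS; exact: subset_trans SS'.
move=> [T [zT [TS nST] c]]; exists T; split=> //; split; first exact: subset_trans SS'.
by move=> S'T; apply: nST; exact: subset_trans S'T.
Qed.

Lemma chain_cat P Q S m n : zsub Z Q ->
  chain Z P Q m -> chain Z Q S n -> chain Z P S (m + n).
Proof.
move=> zQ cm; elim: n S => [|n IH] S; first by rewrite addn0 => QS; exact: chain_mono cm.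
by rewrite addnS => -[S' [zS' S'S c]]; exists S'; split=> //; exact: IH.
Qed.

(** By modularity each strict step of a chain survives in [S `&` Q] or in
    [S + Q]; this is what makes length additive. *)
Lemma chain_split P Q S n : zsub Z Q -> zsub Z S -> P `<=` Q -> chain Z P S n ->
  exists a b, [/\ (n <= a + b)%N, chain Z P (S `&` Q) a & chain Z Q (sadd S Q) b].
Proof.
move=> zQ zS PQ; elim: n S zS => [|n IH] S zS /=.
  move=> PS; exists 0, 0; split=> //=; first by move=> x Px; split; [exact: PS | exact: PQ].
  exact: sub_saddr.
move=> [S' [zS' [S'S nSS'] c]]; have [a [b [nab ca cb]]] := IH _ zS' c.
have sI : S' `&` Q `<=` S `&` Q by exact: setSI.
have sD : sadd S' Q `<=` sadd S Q.
  apply: sadd_sub; [exact: zsub_sadd | | exact: sub_saddr].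
  exact: (subset_trans S'S (sub_saddl zQ)).
have [SQ|nSQ] := pselect (S `&` Q `<=` S' `&` Q).
  exists a, b.+1; split; [by rewrite addnS | exact: chain_mono ca |].
  exists (sadd S' Q); split; [exact: zsub_sadd | split=> // sub | by []].
  apply: nSS' => x Sx; have [y [q [S'y Qq xE]]] := sub x (sub_saddl zQ Sx).
  rewrite xE; apply: (zsubD zS') => //; have [|//] := SQ q.
  by split=> //; rewrite -(addKr y q) -xE addrC; apply: (zsubB zS) => //; exact: S'S.
exists a.+1, b; split; [by rewrite addSn | | exact: chain_mono cb].
by exists (S' `&` Q); split=> //; exact: zsubI.
Qed.

Definition is_len P S n := chain Z P S n /\ forall m, chain Z P S m -> (m <= n)%N.

Definition len P S : nat := xget 0%N [set n | is_len P S n].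

Lemma lenP P S : P `<=` S -> fin_len Z P S -> is_len P S (len P S).
Proof.
move=> PS [N fN]; rewrite /len; case: xgetP => [n -> //|noP]; exfalso.
have ex : exists n, `[< chain Z P S n >] by exists 0%N; apply/asboolP.
have bd n : `[< chain Z P S n >] -> (n <= N)%N by move=> /asboolP/fN.
case: (ex_maxnP ex bd) => n /asboolP cn mn; apply: (noP n); split=> // m cm.
by apply: mn; apply/asboolP.
Qed.

Lemma chain_len P S : P `<=` S -> fin_len Z P S -> chain Z P S (len P S).
Proof. by move=> PS f; have [] := lenP PS f. Qed.

Lemma len_max P S n : fin_len Z P S -> chain Z P S n -> (n <= len P S)%N.
Proof. by move=> f c; have [_] := lenP (chain_sub c) f; apply. Qed.

Lemma fin_lenl P Q S : zsub Z Q -> Q `<=` S -> fin_len Z P S -> fin_len Z P Q.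
Proof. by move=> zQ QS [N f]; exists N => n c; apply: f; exact: chain_mono c. Qed.

Lemma fin_lenr P Q S : zsub Z Q -> P `<=` Q -> fin_len Z P S -> fin_len Z Q S.
Proof.
by move=> zQ PQ [N f]; exists N => n c; apply: f; rewrite -[n]add0n; exact: chain_cat c.
Qed.

Lemma len_add P Q S : zsub Z Q -> zsub Z S -> P `<=` Q -> Q `<=` S ->
  fin_len Z P S -> len P S = (len P Q + len Q S)%N.
Proof.
move=> zQ zS PQ QS f; have fl := fin_lenl zQ QS f; have fr := fin_lenr zQ PQ f.
have PS := subset_trans PQ QS; apply/eqP; rewrite eqn_leq; apply/andP; split.
  have [a [b [nab ca cb]]] := chain_split zQ zS PQ (chain_len PS f).
  apply: leq_trans nab _; apply: leq_add; apply: len_max => //.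
    by apply: chain_mono ca => x [].
  by apply: chain_mono cb; exact: sadd_sub.
by apply: len_max => //; apply: chain_cat (chain_len PQ fl) (chain_len QS fr).
Qed.

Lemma fin_len_add P Q S : zsub Z Q -> zsub Z S -> P `<=` Q -> Q `<=` S ->
  fin_len Z P Q -> fin_len Z Q S -> fin_len Z P S.
Proof.
move=> zQ zS PQ QS [M fM] [N fN]; exists (M + N)%N => n c.
have [a [b [nab ca cb]]] := chain_split zQ zS PQ c.
apply: leq_trans nab _; apply: leq_add.
  by apply: fM; apply: chain_mono ca => x [].
by apply: fN; apply: chain_mono cb; exact: sadd_sub.
Qed.

Lemma chain_eq P n : ~ chain Z P P n.+1.
Proof. by move=> [S [_ [_ nPS] /chain_sub]]. Qed.

Lemma fin_len_refl P : fin_len Z P P.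
Proof. exists 0%N; case=> [|n] // c; by case: (chain_eq c). Qed.

Lemma len_refl P : len P P = 0%N.
Proof.
have := chain_len (@subset_refl _ P) (fin_len_refl P).
by case: (len P P) => // n /chain_eq [].
Qed.

Lemma len_gt0 P S : zsub Z P -> P `<` S -> fin_len Z P S -> (0 < len P S)%N.
Proof.
move=> zP PS f; apply: (len_max f) => //; exists P; split=> //; exact: subset_refl.
Qed.

Lemma len_eq0 P S : zsub Z P -> P `<=` S -> fin_len Z P S -> len P S = 0%N -> S `<=` P.
Proof.
move=> zP PS f l0; apply: contrapT => nSP.
by have := len_gt0 zP (conj PS nSP) f; rewrite l0.
Qed.

Lemma len_eq P Q S : zsub Z Q -> zsub Z S -> P `<=` Q -> Q `<=` S ->
  fin_len Z P S -> (len P S <= len P Q)%N -> S `<=` Q.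
Proof.
move=> zQ zS PQ QS f; rewrite (len_add zQ zS PQ QS f) -[leqRHS]addn0 leq_add2l leqn0.
by move=> /eqP; apply: len_eq0 => //; exact: fin_lenr f.
Qed.

End OneModule.
End Length.

Section Transport.
Variables (R : pzRingType) (Z : set R) (V W : lmodType R) (f : V -> W).
Hypothesis lf : zlinear Z f.

Lemma zlinear0 : f 0 = 0.
Proof. by have := lf.1 0 0; rewrite !subrr. Qed.

Lemma zsub_preimage N : zsub Z N -> zsub Z (f @^-1` N).
Proof.
move=> [N0 NB NZ]; split; rewrite /preimage /=; first by rewrite zlinear0.
- by move=> x y; rewrite lf.1; exact: NB.
- by move=> z x Zz; rewrite lf.2 //; exact: NZ.
Qed.

Lemma zsub_image S : zsub Z S -> zsub Z (f @` S).
Proof.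
move=> [S0 SB SZ]; split.
- by exists 0 => //; exact: zlinear0.
- by move=> _ _ [x Sx <-] [y Sy <-]; exists (x - y); [exact: SB | exact: lf.1].
- by move=> z _ Zz [x Sx <-]; exists (z *: x); [exact: SZ | exact: lf.2].
Qed.

(** The image of [S] in [W / N] is [S] modulo the preimage of [N]: chains can be
    pushed forward here and pulled back in [chain_pull]. *)
Lemma chain_push (N : set W) (S : set V) n : zsub Z N -> zsub Z S ->
  chain Z (S `&` f @^-1` N) S n -> chain Z N (sadd (f @` S) N) n.
Proof.
move=> zN zS; set P := S `&` _.
(* The chain shrinks its top during the induction while [P] stays fixed. *)
have: S `<=` S by exact: subset_refl.
have: zsub Z S by [].
move: {1 2 4 5}S; elim: n => [|n IH] S1 zS1 S1S /=.
  by move=> _; apply: sub_saddr; exact: zsub_image.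
move=> [S' [zS' [S'S1 nS1S'] c]]; have zfN S2 : zsub Z S2 -> zsub Z (sadd (f @` S2) N).
  by move=> zS2; apply: zsub_sadd => //; exact: zsub_image.
exists (sadd (f @` S') N); split; [exact: zfN | split | ].
- apply: sadd_sub; [exact: zfN | | by apply: sub_saddr; exact: zsub_image].
  move=> _ [x S'x <-]; apply: (sub_saddl zN); exists x => //; exact: S'S1.
- move=> sub; apply: nS1S' => x S1x.
  have [|_ [v [[x' S'x' <-] Nv fx]]] := sub (f x).
    by apply: (sub_saddl zN); exists x.
  rewrite -[x](subrK x'); apply: (zsubD zS') => //; apply: (chain_sub c); split.
    by apply: (zsubB zS); [exact: S1S | apply/S1S/S'S1].
  by rewrite /preimage /= lf.1 fx addrAC subrr add0r.
- by apply: IH => //; exact: subset_trans S1S.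
Qed.

Lemma chain_pull (N T : set W) (S : set V) n : zsub Z N -> zsub Z S -> zsub Z T ->
  T `<=` sadd (f @` S) N ->
  chain Z N T n -> chain Z (S `&` f @^-1` N) (S `&` f @^-1` T) n.
Proof.
move=> zN zS; elim: n T => [|n IH] T zT TS /=.
  by move=> NT x [Sx Nx]; split=> //; exact: NT.
move=> [T' [zT' /proper_exP [T'T [y Ty nT'y]] c]].
exists (S `&` f @^-1` T'); split.
- by apply: zsubI => //; exact: zsub_preimage.
- apply/proper_exP; split; first by move=> x [Sx T'x]; split=> //; exact: T'T.
  have [_ [v [[x Sx <-] Nv yE]]] := TS y Ty; have T'v := chain_sub c Nv.
  have Tf : T (f x).
    by rewrite -(addrK v (f x)) -yE; apply: (zsubB zT) => //; exact: T'T.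
  exists x => // -[_ T'x]; apply: nT'y; rewrite yE; exact: zsubD zT' T'x T'v.
- by apply: IH => //; exact: subset_trans T'T TS.
Qed.

Lemma fin_len_pull (N T : set W) (S : set V) : zsub Z N -> zsub Z S ->
  sadd (f @` S) N `<=` T -> fin_len Z N T -> fin_len Z (S `&` f @^-1` N) S.
Proof.
move=> zN zS ST [m fm]; exists m => n c; apply: fm.
by apply: (chain_mono ST); exact: chain_push.
Qed.

Lemma len_push_le (N T : set W) (S : set V) : zsub Z N -> zsub Z S ->
  sadd (f @` S) N `<=` T -> fin_len Z N T ->
  (len Z (S `&` f @^-1` N) S <= len Z N T)%N.
Proof.
move=> zN zS ST fT; apply: (len_max fT); apply: (chain_mono ST).
apply: chain_push => //; apply: chain_len; last exact: (fin_len_pull zN zS ST fT).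
by move=> x [].
Qed.

Lemma fin_len_push (N : set W) (S : set V) : zsub Z N -> zsub Z S ->
  fin_len Z (S `&` f @^-1` N) S -> fin_len Z N (sadd (f @` S) N).
Proof.
move=> zN zS [m fm]; exists m => n c; apply: fm.
have zT : zsub Z (sadd (f @` S) N) by apply: zsub_sadd => //; exact: zsub_image.
by apply: chain_mono (chain_pull zN zS zT (@subset_refl _ _) c) => x [].
Qed.

Lemma len_push (N : set W) (S : set V) : zsub Z N -> zsub Z S ->
  fin_len Z N (sadd (f @` S) N) ->
  len Z (S `&` f @^-1` N) S = len Z N (sadd (f @` S) N).
Proof.
move=> zN zS fT; apply/eqP; rewrite eqn_leq len_push_le //=.
have zT : zsub Z (sadd (f @` S) N) by apply: zsub_sadd => //; exact: zsub_image.
have NT : N `<=` sadd (f @` S) N by apply: sub_saddr; exact: zsub_image.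
apply: len_max; first exact: (fin_len_pull zN zS (@subset_refl _ _) fT).
by apply: chain_mono (chain_pull zN zS zT (@subset_refl _ _) (chain_len NT fT)) => x [].
Qed.

End Transport.

Definition subfield_like (R : pzRingType) (Z : set R) : Prop :=
  [/\ Z 1, forall x y, Z x -> Z y -> Z (x - y), forall x y, Z x -> Z y -> Z (x * y)
    & forall z, Z z -> z = 0 \/ exists2 z', Z z' & z' * z = 1].

Section Span.
Variables (R : pzRingType) (Z : set R) (V : lmodType R).
Hypothesis fZ : subfield_like Z.

Fixpoint zspan (s : seq V) : set V :=
  if s is a :: s' then [set x | exists2 z, Z z & zspan s' (x - z *: a)] else [set 0].

Let Z0 : Z 0. Proof. by case: fZ => Z1 ZB _ _; rewrite -(subrr 1); exact: ZB. Qed.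

Lemma zspan_zsub s : zsub Z (zspan s).
Proof.
case: fZ => Z1 ZB ZM _; elim: s => [|a s [S0 SB SZ]] /=.
  by split=> [//|x y -> ->|z x _ ->]; rewrite ?subr0 ?scaler0.
split=> [|x y [z Zz Sx] [z' Zz' Sy]|z x Zz [z' Zz' Sx]].
- by exists 0 => //; rewrite scale0r subr0.
- by exists (z - z'); [exact: ZB | rewrite scalerBl opprD addrACA -opprD; exact: SB].
- by exists (z * z'); [exact: ZM | rewrite -scalerA -scalerBr; exact: SZ].
Qed.

Lemma zspan_head a s : zspan (a :: s) a.
Proof.
case: fZ => Z1 _ _ _; exists 1 => //; rewrite scale1r subrr.
exact: zsub0 (zspan_zsub s).
Qed.

Lemma zspan_behead a s : zspan s `<=` zspan (a :: s).
Proof. by move=> x Sx; exists 0 => //; rewrite scale0r subr0. Qed.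

Lemma zspan_mem s x : x \in s -> zspan s x.
Proof.
elim: s => // a s IH; rewrite inE => /orP[/eqP ->|/IH]; first exact: zspan_head.
exact: zspan_behead.
Qed.

(** Nonzero scalars are invertible, so the line added by each generator
    contributes at most one step to a chain. *)
Lemma fin_len_zspan s : fin_len Z [set 0] (zspan s).
Proof.
elim: s => [|a s IH]; first exact: fin_len_refl.
have zs := zspan_zsub s; have zas := zspan_zsub (a :: s).
have s0 : [set 0] `<=` zspan s by move=> _ ->; exact: zsub0 zs.
apply: (fin_len_add zs zas s0 (@zspan_behead a s) IH).
exists 1%N => -[|[|n]] // [S1 [zS1 [S1S nSS1] [S2 [zS2 /proper_exP [S2S1 [x S1x nS2x]] c]]]].
case: nSS1 => y [z Zz sy]; have := S1S x S1x; case=> z' Zz' sx.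
have SS2 := chain_sub c; have S1s t : zspan s t -> S1 t by move=> /SS2/S2S1.
have S1a : S1 a.
  have S1z : S1 (z' *: a).
    by rewrite -[z' *: a](subKr x); apply: (zsubB zS1) => //; exact: S1s.
  case: fZ => _ _ _ /(_ z' Zz')[z0|[u Zu uz]].
    by case: nS2x; apply: SS2; move: sx; rewrite z0 scale0r subr0.
  by rewrite -[a]scale1r -uz -scalerA; exact: (zsubZ zS1).
rewrite -[y](subrK (z *: a)); apply: (zsubD zS1); first exact: S1s.
exact: (zsubZ zS1).
Qed.

End Span.

Lemma fin_len_regular (B : pzRingType) (Z : set B) m (gen : 'I_m -> B) :
  subfield_like Z ->
  (forall b, exists c : 'I_m -> B, (forall i, Z (c i)) /\ b = \sum_i c i * gen i) ->
  fin_len Z [set 0] [set: B^o].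
Proof.
move=> fZ genP; pose s : seq B^o := [seq gen i | i <- enum 'I_m].
have zs := zspan_zsub fZ s.
suff -> : [set: B^o] = zspan Z s by exact: fin_len_zspan.
apply: subset_eq => // b _; have [c [Zc ->]] := genP b.
apply: (big_ind (zspan Z s)) => [|x y|i _]; [exact: (zsub0 zs) | exact: (zsubD zs) |].
by apply: (zsubZ zs (Zc i)); apply: (zspan_mem fZ); apply: map_f; rewrite mem_enum.
Qed.

(** * Complete reducibility *)

Section CompletelyReducible.
Variable R : pzRingType.
Implicit Types V W : lmodType R.

Definition cyclic V (x : V) : set V := [set v | exists a : R, v = a *: x].

Lemma submodule_cyclic V (x : V) : submodule (cyclic x).
Proof.
split=> [|_ _ [a ->] [b ->]|a _ [b ->]]; first by exists 0; rewrite scale0r.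
- by exists (a + b); rewrite scalerDl.
- by exists (a * b); rewrite scalerA.
Qed.

Lemma cyclic_id V (x : V) : cyclic x x.
Proof. by exists 1; rewrite scale1r. Qed.

Lemma submodule_sadd V (M N : set V) : submodule M -> submodule N ->
  submodule (sadd M N).
Proof.
move=> [M0 MD MZ] [N0 ND NZ]; split.
- by exists 0, 0; rewrite addr0.
- move=> _ _ [x [y [Mx Ny ->]]] [x' [y' [Mx' Ny' ->]]]; exists (x + x'), (y + y').
  by split; [exact: MD | exact: ND | rewrite addrACA].
- move=> a _ [x [y [Mx Ny ->]]]; exists (a *: x), (a *: y).
  by split; [exact: MZ | exact: NZ | rewrite scalerDr].
Qed.

Lemma submoduleI V (M N : set V) : submodule M -> submodule N -> submodule (M `&` N).
Proof.
move=> [M0 MD MZ] [N0 ND NZ]; split=> [//|x y [Mx Nx] [My Ny]|a x [Mx Nx]].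
- by split; [exact: MD | exact: ND].
- by split; [exact: MZ | exact: NZ].
Qed.

Lemma submoduleB V (M : set V) x y : submodule M -> M x -> M y -> M (x - y).
Proof. by move=> [M0 MD MZ] Mx My; apply: MD => //; rewrite -scaleN1r; exact: MZ. Qed.

Lemma submodule_preimage V W (f : V -> W) (N : set W) :
  linear f -> submodule N -> submodule (f @^-1` N).
Proof.
move=> lf [N0 ND NZ]; split; rewrite /preimage /=; first by rewrite linear_0.
- by move=> x y; rewrite (linear_D lf); exact: ND.
- by move=> a x; rewrite (linear_Z lf); exact: NZ.
Qed.

Definition avoids V (M : set V) (y : V) := ~ M y /\ forall b : R, M (b *: y) -> b *: y = 0.

(** A submodule maximal among those meeting [N] trivially is a complement:
    otherwise an element avoiding their sum would enlarge it. *)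
Lemma cr_of_avoids V :
  (forall M : set V, submodule M -> M <> setT -> exists y, avoids M y) ->
  completely_reducible V.
Proof.
move=> avV N sN; have [N0 ND NZ] := sN.
(* [P] does not ask for [0], so that the union of an empty chain satisfies it. *)
pose P (A : set V) := (forall a x y, A x -> A y -> A (a *: x + y)) /\
  (forall x, N x -> A x -> x = 0).
have [A [[AL NA] maxA]] : exists A, P A /\ forall B, A `<` B -> ~ P B.
  apply: Zorn_bigcup => F FP tF; split=> [a x y [B FB Bx] [B' FB' By]|x Nx [B FB Bx]].
    have [BB'|B'B] := tF _ _ FB FB'.
      by exists B' => //; apply: (FP _ FB').1 => //; exact: BB'.
    by exists B => //; apply: (FP _ FB).1 => //; exact: B'B.
  exact: (FP _ FB).2 Bx.
have A0 : A 0.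
  apply: contrapT => nA0; have A_0 x : ~ A x.
    by move=> Ax; apply: nA0; have := AL (-1) _ _ Ax Ax; rewrite scaleN1r addNr.
  apply: (maxA [set 0]); first by split=> [x /A_0//|/(_ 0 erefl)].
  by split=> [a x y -> ->|x _ //]; rewrite scaler0 addr0.
have AZ a x : A x -> A (a *: x) by move=> Ax; have := AL a _ _ Ax A0; rewrite addr0.
have AD x y : A x -> A y -> A (x + y) by move=> Ax Ay; have := AL 1 _ _ Ax Ay; rewrite scale1r.
have sA : submodule A by split.
exists A; split=> //; first by apply/seteqP; split=> [x [Nx Ax]|_ ->]; [exact: NA | split].
suff T : sadd N A = setT by move=> v; have : sadd N A v by rewrite T.
apply: contrapT => /(avV _ (submodule_sadd sN sA)) [y [nMy yM]].
apply: (maxA (sadd A (cyclic y))).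
  split=> [x Ax|sub]; first by exists x, 0; split=> //; [exists 0; rewrite scale0r | rewrite addr0].
  apply: nMy; exists 0, y; split; rewrite ?add0r //.
  by apply: sub; exists 0, y; split; rewrite ?add0r //; exact: cyclic_id.
have [_ sD sZ] := submodule_sadd sA (submodule_cyclic y).
split=> [a x x' sx sx'|u Nu [x [_ [Ax [b ->] uE]]]]; first by apply: sD => //; exact: sZ.
have by0 : b *: y = 0.
  apply: yM; exists u, (- x); split=> //.
    by rewrite -scaleN1r; exact: AZ.
  by rewrite uE addrAC subrr add0r.
by apply: NA Nu _; rewrite uE by0 addr0.
Qed.

Lemma cr_avoids V (M : set V) x : completely_reducible V -> submodule M -> ~ M x ->
  exists y, avoids M y.
Proof.
move=> crV sM nMx; have [N [sN MN /(_ x) [u [y [Mu Ny xE]]]]] := crV M sM.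
exists y; split=> [My|b Mby]; first by apply: nMx; rewrite xE; exact: (submoduleD sM).
by have : (M `&` N) (b *: y); [split=> //; exact: (submoduleZ sN) | rewrite MN].
Qed.

(** A module covered by images of completely reducible modules is completely
    reducible; quotients, products and tensor products are treated this way. *)
Lemma cr_of_images V :
  (forall M : set V, submodule M -> M <> setT ->
     exists (X : lmodType R) (f : X -> V) x,
       [/\ completely_reducible X, linear f & ~ M (f x)]) ->
  completely_reducible V.
Proof.
move=> imV; apply: cr_of_avoids => M sM /(imV M sM) [X [f [x [crX lf nMfx]]]].
have [y [nMy yM]] := cr_avoids (x := x) crX (submodule_preimage lf sM) nMfx.
exists (f y); split=> // b Mby; rewrite -(linear_Z lf) yM ?linear_0 //.
by rewrite /preimage /= (linear_Z lf).
Qed.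

Lemma cr_surj V W (f : V -> W) : linear f -> (forall w, exists v, w = f v) ->
  completely_reducible V -> completely_reducible W.
Proof.
move=> lf sf crV; apply: cr_of_images => M sM nM.
have [w nMw] : exists w, ~ M w.
  by apply: contrapT => /forallNP MT; apply: nM; apply/seteqP; split=> // w _; exact: contrapT.
by have [v wE] := sf w; exists V, f, v; rewrite -wE.
Qed.

Lemma cr_irreducible V : irreducible_module V -> completely_reducible V.
Proof.
move=> [_ irr] N /irr[->|->]; [exists setT | exists [set 0]]; split.
- by split.
- by rewrite setIT.
- by move=> v; exists 0, v; rewrite add0r.
- by split=> [//|x y -> ->|a x ->]; rewrite ?addr0 ?scaler0.
- by rewrite setTI.
- by move=> v; exists v, 0; rewrite addr0.
Qed.

Lemma irreducible_cyclic W (w : W) :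
  irreducible_module W -> w <> 0 -> forall x, cyclic w x.
Proof.
move=> [_ irr] w0 x; have [E|->//] := irr _ (submodule_cyclic w).
by case: w0; have := cyclic_id w; rewrite E.
Qed.

Lemma cr_prod V W : completely_reducible V -> completely_reducible W ->
  completely_reducible (V * W)%type.
Proof.
move=> crV crW; apply: cr_of_images => M sM nM.
have [[v nMv]|MV] := pselect (exists v, ~ M (v, 0)).
  exists V, (fun v => (v, 0) : (V * W)%type), v; split=> //.
  by move=> a x y; congr (_, _); rewrite /= scaler0 addr0.
have [[w nMw]|MW] := pselect (exists w, ~ M (0, w)).
  exists W, (fun w => (0, w) : (V * W)%type), w; split=> //.
  by move=> a x y; congr (_, _); rewrite /= scaler0 addr0.
case: nM; apply/seteqP; split=> // -[v w] _.
have -> : (v, w) = (v, 0) + (0, w) :> (V * W)%type by congr (_, _); rewrite /= ?addr0 ?add0r.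
by apply: (submoduleD sM); apply: contrapT => nM; [apply: MV; exists v | apply: MW; exists w].
Qed.

End CompletelyReducible.

Section SubmoduleType.
Variables (R : pzRingType) (V : lmodType R) (N : set V).
Hypothesis sN : submodule N.

(** The proof that [N] is a submodule is an argument, so that the instances
    below can find it. *)
Definition submodule_pred (_ : submodule N) : {pred V} := fun x => `[< N x >].

Lemma submodule_pred_closed : GRing.submod_closed (submodule_pred sN).
Proof.
split; first by apply/asboolP; exact: submodule0 sN.
move=> a x y /asboolP Nx /asboolP Ny; apply/asboolP.
by apply: (submoduleD sN) => //; exact: (submoduleZ sN).
Qed.

HB.instance Definition _ := GRing.isSubmodClosed.Build R V (submodule_pred sN)
  submodule_pred_closed.

Definition submodule_type : Type := {x : V | x \in submodule_pred sN}.
HB.instance Definition _ := SubChoice.on submodule_type.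
HB.instance Definition _ := [SubChoice_isSubLmodule of submodule_type by <:].

End SubmoduleType.

Section SubmoduleFacts.
Variables (R : pzRingType) (V : lmodType R) (N : set V) (sN : submodule N).

Lemma val_subZ a (x : submodule_type sN) : val (a *: x) = a *: val x.
Proof. by []. Qed.

Lemma valN (x : submodule_type sN) : N (val x).
Proof. exact/asboolP/(valP x). Qed.

Definition mk_sub (x : V) (Nx : N x) : submodule_type sN := Sub x (asboolT Nx).

Lemma cr_submodule : completely_reducible V -> completely_reducible (submodule_type sN).
Proof.
move=> crV; apply: cr_of_avoids => M sM nM.
pose M' : set V := val @` M.
have sM' : submodule M'.
  split; first by exists 0 => //; exact: (submodule0 sM).
  - by move=> _ _ [x Mx <-] [y My <-]; exists (x + y) => //; exact: (submoduleD sM).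
  - by move=> a _ [x Mx <-]; exists (a *: x) => //; exact: (submoduleZ sM).
have [x nMx] : exists x, ~ M x.
  by apply: contrapT => /forallNP MT; apply: nM; apply: subset_eq => // x _; exact: contrapT.
have [P [sP MP /(_ (val x)) [m [y [[m' Mm' <-] Py xE]]]]] := crV M' sM'.
have yE : y = val (x - m') by rewrite -[RHS]/(val x - val m') xE addrC addKr.
exists (x - m'); split=> [My|b Mb].
  by apply: nMx; rewrite -(subrK m' x); exact: (submoduleD sM).
apply: val_inj; suff : (M' `&` P) (b *: y) by rewrite MP yE.
by split; [exists (b *: (x - m')); rewrite // yE | exact: (submoduleZ sP)].
Qed.
End SubmoduleFacts.

(** * Tensor products with a finite-dimensional factor *)

Section KModFacts.
Variables (k : fieldType) (A : algType k).
Implicit Types V W : lmodType A.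

Lemma kmodZ V (c : k) (v : kmod V) : c *: v = (c *: (1 : A)) *: (v : V).
Proof. by []. Qed.

Lemma linear_kmod V W (f : V -> W) : linear f -> linear (f : kmod V -> kmod W).
Proof. by move=> lf a x y; rewrite [a *: x]kmodZ lf. Qed.

Lemma kmodZA V (c : k) (a : A) (v : V) :
  (c *: a) *: v = c *: ((a *: v : V) : kmod V) :> kmod V.
Proof. by rewrite kmodZ scalerA -scalerAl mul1r. Qed.

Lemma kmodAZ V (c : k) (a : A) (v : kmod V) :
  a *: (c *: v : V) = c *: ((a *: (v : V) : V) : kmod V) :> kmod V.
Proof. by rewrite !kmodZ !scalerA -scalerAl mul1r -scalerAr mulr1. Qed.

Lemma submoduleK V (N : set V) (c : k) (v : kmod V) : submodule N -> N v -> N (c *: v).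
Proof. by move=> sN Nv; exact: (submoduleZ sN). Qed.
End KModFacts.

Record dual_basis (k : fieldType) (V : lmodType k) (n : nat)
    (e : 'I_n -> V) (c : 'I_n -> V -> k) : Prop := DualBasis {
  dual_linear : forall i, linear (c i : V -> k^o);
  dual_span : forall v, v = \sum_i c i v *: e i;
  dual_eq : forall i j, c i (e j) = (i == j)%:R
}.

(** A generating family of minimal size is a basis. *)
Lemma exists_dual_basis (k : fieldType) (V : lmodType k) :
  (exists n (e : 'I_n -> V), forall v, exists c : 'I_n -> k, v = \sum_i c i *: e i) ->
  exists n (e : 'I_n -> V) (c : 'I_n -> V -> k), dual_basis e c.
Proof.
pose P n := exists e : 'I_n -> V, forall v, exists c : 'I_n -> k, v = \sum_i c i *: e i.
move=> exV; have exP : exists n, `[< P n >] by case: exV => n eP; exists n; exact/asboolP.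
case: (ex_minnP exP) => n /asboolP [e eP] minn.
have indep (b : 'I_n -> k) : \sum_i b i *: e i = 0 -> forall i, b i = 0.
  move=> b0 j; apply: contrapT => /eqP bj.
  case: n j e eP minn b b0 bj => [[]//|n] j e eP minn b b0 bj.
  (* The [j]-th vector is a combination of the others and can be dropped. *)
  suff /minn : `[< P n >] by rewrite ltnn.
  apply/asboolP; exists (e \o lift j) => v; have [c ->] := eP v.
  exists (fun i => c (lift j i) - c j / b j * b (lift j i)).
  rewrite (bigD1_ord j) //=; under [RHS]eq_bigr do rewrite scalerBl -scalerA.
  rewrite sumrB -scaler_sumr addrC; congr (_ + _).
  move: b0; rewrite (bigD1_ord j) //= => /eqP; rewrite addrC addr_eq0 => /eqP ->.
  by rewrite scalerN opprK scalerA divfK.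
have /choice [c cP] := eP; have uniq b b' : \sum_i b i *: e i = \sum_i b' i *: e i :> V -> b = b'.
  move=> bb'; apply/funext => i; apply/eqP; rewrite -subr_eq0; apply/eqP.
  apply: (indep (fun i => b i - b' i)); under eq_bigr do rewrite scalerBl.
  by rewrite sumrB bb' subrr.
exists n, e, (fun i v => c v i); split=> [i x u v|v|i j]; last 2 first.
- exact: cP.
- suff -> : c (e j) = fun i => (i == j)%:R by [].
  apply: uniq; rewrite -cP (bigD1 j) //= eqxx scale1r big1 ?addr0 // => l /negPf ->.
  by rewrite scale0r.
suff -> : c (x *: u + v) = fun i => x * c u i + c v i by [].
apply: uniq; rewrite -cP; under eq_bigr do rewrite scalerDl -scalerA.
by rewrite big_split /= -scaler_sumr -!cP.
Qed.

Section Coordinates.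
Variables (k : fieldType) (V Y : lmodType k) (n : nat) (e : 'I_n -> V) (c : 'I_n -> V -> k).
Hypothesis ec : dual_basis e c.

Definition coord (i : 'I_n) : tensor V Y -> Y := tlift (fun v y => c i v *: y).

Let bcoord i : bilin (fun v (y : Y) => c i v *: y).
Proof.
split=> [y|v] a x x'; first by rewrite (dual_linear ec) scalerDl scalerA.
by rewrite scalerDr !scalerA mulrC.
Qed.

Lemma coord_linear i : linear (coord i).
Proof. exact: tlift_linear. Qed.

Lemma coordE i v y : coord i (v \ox y) = c i v *: y.
Proof. exact: tliftE. Qed.

Lemma coord_sum t : t = \sum_i e i \ox coord i t.
Proof.
have [tl tr] := tens_bilin V Y.
elim/tensor_ind: t => [|v y|s t IHs IHt].
- by rewrite big1 // => i _; rewrite (linE0 (coord_linear i)) (linE0 (tr _)).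
- rewrite [in LHS](dual_span ec v) (linE_sum (tl y)); apply: eq_bigr => i _.
  by rewrite coordE (linEZ (tr _)) (linEZ (tl _)).
- rewrite {1}IHs {1}IHt -big_split; apply: eq_bigr => i _ /=.
  by rewrite (linED (coord_linear i)) (linED (tr _)).
Qed.

Lemma coord_basis i j y : coord i (e j \ox y) = if i == j then y else 0.
Proof. by rewrite coordE (dual_eq ec); case: eqP; rewrite ?scale1r ?scale0r. Qed.

End Coordinates.

Section TensorModMap.
Variables (k : fieldType) (B A1 A2 : algType k) (d : {lrmorphism B -> tensor A1 A2}).
Variables (V V' : lmodType A1) (W W' : lmodType A2) (f : V -> V') (g : W -> W').
Hypotheses (lf : linear f) (lg : linear g).

Definition tensor_mod_map : tensor_mod d V W -> tensor_mod d V' W' :=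
  tmap (f : kmod V -> kmod V') (g : kmod W -> kmod W').

Lemma tensor_mod_mapE (v : kmod V) (w : kmod W) :
  tensor_mod_map (v \ox w : tensor (kmod V) (kmod W)) =
  ((f v : kmod V') \ox (g w : kmod W') : tensor (kmod V') (kmod W')).
Proof. by rewrite /tensor_mod_map tmapE //; exact: linear_kmod. Qed.

Lemma tensor_mod_map_klinear :
  linear (tensor_mod_map : tensor (kmod V) (kmod W) -> tensor (kmod V') (kmod W')).
Proof. by apply: tmap_linear; exact: linear_kmod. Qed.

Lemma tensor_mod_map_linear : linear tensor_mod_map.
Proof.
have fZ := linear_Z lf; have gZ := linear_Z lg.
have D s t : tensor_mod_map (s + t) = tensor_mod_map s + tensor_mod_map t.
  exact: (linED tensor_mod_map_klinear s t).
have act0 (X : lmodType A1) (Y : lmodType A2) (b : B) (x : kmod X) (y : kmod Y) :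
    b *: (x \ox y : tensor_mod d X Y) =
    tlift (fun a a' => kact a x \ox kact a' y) (d b) :> tensor (kmod X) (kmod Y).
  by apply: eq_tlift => a a'; rewrite tmapE //; [exact: (kact_bilin X).2 | exact: (kact_bilin Y).2].
move=> b s t; rewrite D; congr (_ + _).
elim/(@tensor_ind k (kmod V) (kmod W)): s => [|v w|s s' IH IH'].
- rewrite [b *: 0]scaler0; have -> : tensor_mod_map 0 = 0 by exact: (linE0 tensor_mod_map_klinear).
  by rewrite scaler0.
- rewrite tensor_mod_mapE !act0 [LHS](lin_tlift _ _ tensor_mod_map_klinear).
  by apply: eq_tlift => a a'; rewrite [LHS]tensor_mod_mapE /kact fZ gZ.
- by rewrite [b *: _]scalerDr !D IH IH' scalerDr.
Qed.
End TensorModMap.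

(** * The functor [R (x) -] on modules over a comodule algebra *)

Section Comodule.
Variables (k : fieldType) (A B : algType k) (d : {lrmorphism B -> tensor A B}).
Variables (R : lmodType A) (n : nat) (e : 'I_n -> kmod R) (c : 'I_n -> kmod R -> k).
Hypothesis ec : dual_basis e c.

Section OneModule.
Variable Y : lmodType B.

Definition tensR : lmodType B := tensor_mod d R Y.

Definition pureR (r : R) (y : Y) : tensR := tens (r : kmod R) (y : kmod Y).

Definition coordR (i : 'I_n) (t : tensR) : Y := coord (Y := kmod Y) c i t.

Lemma pureR_scale b r y :
  b *: pureR r y = tlift (fun a b' => pureR (a *: r) (b' *: y)) (d b) :> tensor (kmod R) (kmod Y).
Proof.
apply: eq_tlift => a b'; rewrite tmapE //; [exact: (kact_bilin R).2 | exact: (kact_bilin Y).2].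
Qed.

Lemma pureR_addr r y y' : pureR r (y + y') = pureR r y + pureR r y'.
Proof. by have [_ tr] := tens_bilin (kmod R) (kmod Y); exact: (linED (tr r)). Qed.

Lemma pureR_ind (P : tensR -> Prop) :
  P 0 -> (forall r y, P (pureR r y)) -> (forall s t, P s -> P t -> P (s + t)) -> forall t, P t.
Proof. by move=> P0 Pp PD t; exact: (@tensor_ind k (kmod R) (kmod Y) P). Qed.

Lemma coordR_add i s t : coordR i (s + t) = coordR i s + coordR i t.
Proof. exact: (linED (coord_linear (Y := kmod Y) ec i) s t). Qed.

Lemma coordR_sub i s t : coordR i (s - t) = coordR i s - coordR i t.
Proof. by have := (linear_zlinear setT (coord_linear (Y := kmod Y) ec i)).1 s t. Qed.

Lemma coordR0 i : coordR i 0 = 0.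
Proof. exact: (linE0 (coord_linear (Y := kmod Y) ec i)). Qed.

Lemma coordR_pure i r y : coordR i (pureR r y) = (c i r *: (1 : B)) *: y.
Proof. exact: (coordE (Y := kmod Y) ec). Qed.

Lemma coordR_basis i j y : coordR i (pureR (e j) y) = if i == j then y else 0.
Proof. exact: (coord_basis (Y := kmod Y) ec). Qed.

Lemma coordR_sum t : t = \sum_i pureR (e i) (coordR i t).
Proof. exact: (coord_sum (Y := kmod Y) ec t). Qed.

(** The subspace [R (x) N] of [R (x) Y], described by coordinates so that
    membership can be tested and quotients stay exact. *)
Definition tensR_set (N : set Y) : set tensR := [set t | forall i, N (coordR i t)].

Lemma tensR_set_mono (N N' : set Y) : N `<=` N' -> tensR_set N `<=` tensR_set N'.
Proof. by move=> NN' t Nt i; exact: NN'. Qed.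

Lemma tensR_set_pure (N : set Y) r y : submodule N -> N y -> tensR_set N (pureR r y).
Proof. by move=> sN Ny i; rewrite coordR_pure; exact: (submoduleZ sN). Qed.

Lemma submodule_sum (V : lmodType B) (N : set V) I (s : seq I) (F : I -> V) :
  submodule N -> (forall i, N (F i)) -> N (\sum_(i <- s) F i).
Proof. by move=> [N0 ND _] NF; apply: big_ind. Qed.

Lemma submodule_tensR_set (N : set Y) : submodule N -> submodule (tensR_set N).
Proof.
move=> sN; have D s t : tensR_set N s -> tensR_set N t -> tensR_set N (s + t).
  by move=> Ns Nt i; rewrite coordR_add; exact: (submoduleD sN).
have T0 : tensR_set N 0 by move=> i; rewrite coordR0; exact: (submodule0 sN).
split=> // b t Nt; rewrite (coordR_sum t) scaler_sumr.
apply: (big_ind (tensR_set N)) => // i _; rewrite pureR_scale /tlift.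
apply: (big_ind (tensR_set N)) => // p _; apply: tensR_set_pure => //.
exact: (submoduleZ sN).
Qed.

End OneModule.

Variable Z : set B.
Hypothesis dZ : forall z, Z z -> d z = 1 \ox z.
Hypothesis Zc : forall z b, Z z -> z * b = b * z.

Lemma pureR_scalar (Y : lmodType B) z r (y : Y) : Z z -> z *: pureR r y = pureR r (z *: y).
Proof.
move=> /dZ dz; rewrite -[LHS]/(tact (@kact k A R) (@kact k B Y) (d z) _) dz.
by rewrite (tactE (kact_bilin R) (kact_bilin Y)) /kact scale1r.
Qed.

Lemma coordR_zlinear (Y : lmodType B) i : zlinear Z (coordR i : tensR Y -> Y).
Proof.
split=> [x y|z t Zz]; first exact: coordR_sub.
elim/pureR_ind: t => [|r y|s t IHs IHt].
- by rewrite scaler0 !coordR0 scaler0.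
- by rewrite pureR_scalar // !coordR_pure !scalerA (Zc _ Zz).
- by rewrite scalerDr !coordR_add IHs IHt scalerDr.
Qed.

Lemma pureR_zlinear (Y : lmodType B) r : zlinear Z (pureR r : Y -> tensR Y).
Proof.
split=> [x y|z t Zz]; last by rewrite pureR_scalar.
have -> : x - y = (-1 : B) *: y + x by rewrite scaleN1r addrC.
have [tl tr] := tens_bilin (kmod R) (kmod Y).
rewrite pureR_addr addrC; congr (_ + _).
by have := linEB (tr r) 0 y; rewrite (linE0 (tr r)) !sub0r scaleN1r.
Qed.

Lemma zsub_tensR_set (Y : lmodType B) (N : set Y) : zsub Z N -> zsub Z (tensR_set N).
Proof.
move=> [N0 NB NZ]; split=> [i|x y Nx Ny i|z x Zz Nx i].
- by rewrite coordR0.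
- by rewrite coordR_sub; exact: NB.
- by rewrite (coordR_zlinear Y i).2 //; exact: NZ.
Qed.

Section LengthOfTensor.
Variables (Y : lmodType B) (P S : set Y).
Hypotheses (zP : zsub Z P) (zS : zsub Z S) (PS : P `<=` S) (fPS : fin_len Z P S).

Let T (j : nat) : set (tensR Y) :=
  [set t | forall i : 'I_n, if (i < j)%N then S (coordR i t) else P (coordR i t)].

Let zT j : zsub Z (T j).
Proof.
split=> [i|x y Nx Ny i|z x Zz Nx i].
- by rewrite coordR0; case: ifP => _; [exact: (zsub0 zS) | exact: (zsub0 zP)].
- rewrite coordR_sub; move: (Nx i) (Ny i); case: ifP => _; first exact: (zsubB zS).
  exact: (zsubB zP).
- rewrite (coordR_zlinear Y i).2 //; move: (Nx i).
  by case: ifP => _ ?; [exact: (zsubZ zS) | exact: (zsubZ zP)].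
Qed.

Let Tstep (j : 'I_n) :
  fin_len Z (T j) (T j.+1) /\ len Z (T j) (T j.+1) = len Z P S.
Proof.
pose f (y : Y) : tensR Y := pureR (e j) y.
have lf : zlinear Z f by exact: pureR_zlinear.
have fP : S `&` f @^-1` T j = P.
  apply: subset_eq => [y [Sy]|y Py].
    by move=> /(_ j); rewrite ltnn coordR_basis eqxx.
  split; first exact: PS.
  move=> i; rewrite coordR_basis; case: eqP => [->|_]; first by rewrite ltnn.
  by case: ifP => _; [exact: (zsub0 zS) | exact: (zsub0 zP)].
have fT : sadd (f @` S) (T j) = T j.+1.
  apply: subset_eq => [_ [_ [t [[y Sy <-] Tt ->]]] i|t Tt].
    rewrite coordR_add coordR_basis ltnS; have := Tt i.
    case: (i =P j) => [->|]; first by rewrite ltnn leqnn => /PS; exact: (zsubD zS).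
    move=> /eqP nij; rewrite add0r [(i <= j)%N]leq_eqVlt.
    by rewrite (negPf (nij : i != j :> nat)).
  have fj : f (coordR j t) = pureR (e j) (coordR j t) by [].
  exists (f (coordR j t)), (t - f (coordR j t)); split; last by rewrite addrC subrK.
    by exists (coordR j t) => //; have := Tt j; rewrite ltnSn.
  move=> i; rewrite coordR_sub coordR_basis; have := Tt i.
  case: (i =P j) => [->|]; first by rewrite ltnn subrr => _; exact: (zsub0 zP).
  move=> /eqP nij; rewrite subr0 ltnS [(i <= j)%N]leq_eqVlt.
  by rewrite (negPf (nij : i != j :> nat)).
have fin : fin_len Z (T j) (sadd (f @` S) (T j)).
  by apply: (fin_len_push lf (zT j) zS); rewrite fP.
by rewrite -fT; split=> //; rewrite -(len_push lf (zT j) zS fin) fP.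
Qed.

Let T_mono i j : (i <= j)%N -> T i `<=` T j.
Proof.
move=> ij t Tt l; have := Tt l; case: ifP => [li|_ Pl]; first by rewrite (leq_trans li ij).
by case: ifP => _ //; exact: PS.
Qed.

Let Tlen j : (j <= n)%N ->
  fin_len Z (T 0) (T j) /\ len Z (T 0) (T j) = (j * len Z P S)%N.
Proof.
elim: j => [|j IH] jn; first by rewrite len_refl; split=> //; exact: fin_len_refl.
have [f1 l1] := IH (ltnW jn); have [f2 l2] := Tstep (Ordinal jn).
have T0j := T_mono (leq0n j); have Tjj := T_mono (leqnSn j).
have f := fin_len_add (zT j) (zT j.+1) T0j Tjj f1 f2.
by split=> //; rewrite (len_add (zT j) (zT j.+1)) // l1 l2 mulSn addnC.
Qed.

(** [R (x) Y] is [n] copies of [Y] over [Z], added one coordinate at a time. *)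
Lemma len_tensR_set : fin_len Z (tensR_set P) (tensR_set S) /\
  len Z (tensR_set P) (tensR_set S) = (n * len Z P S)%N.
Proof.
have T0 : T 0 = tensR_set P by apply: subset_eq => t Tt i; exact: Tt.
have Tn : T n = tensR_set S.
  by apply: subset_eq => t Tt i; have := Tt i; rewrite ltn_ord.
by rewrite -T0 -Tn; exact: Tlen.
Qed.
End LengthOfTensor.

Section Map.
Variables (Y Y' : lmodType B) (f : Y -> Y').
Hypothesis lf : linear f.

Definition tensR_map : tensR Y -> tensR Y' := tensor_mod_map (id : R -> R) f.

Lemma tensR_map_pure r y : tensR_map (pureR r y) = pureR r (f y).
Proof. exact: tensor_mod_mapE. Qed.

Lemma tensR_map_linear : linear tensR_map.
Proof. exact: tensor_mod_map_linear. Qed.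

Lemma coordR_map i t : coordR i (tensR_map t) = f (coordR i t).
Proof.
elim/pureR_ind: t => [|r y|s t IHs IHt].
- by rewrite (linear_0 tensR_map_linear) !coordR0 (linear_0 lf).
- by rewrite tensR_map_pure !coordR_pure (linear_Z lf).
- by rewrite (linear_D tensR_map_linear) !coordR_add IHs IHt (linear_D lf).
Qed.

End Map.

Section Torsion.
Variable a : set B.

(** Modulo [R (x) N] these are the elements of [R (x) (N' / N)] killed by [a]:
    for a left ideal [a], the homomorphisms from [B / a] to that module. *)
Definition torsion (Y : lmodType B) (N N' : set Y) : set (tensR Y) :=
  [set t | tensR_set N' t /\ forall b, a b -> tensR_set N (b *: t)].

(** The invariant [h_a] of the subquotient [N' / N]. *)
Definition hom_len (Y : lmodType B) (N N' : set Y) : nat :=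
  len Z (tensR_set N) (torsion N N').

Lemma zsub_torsion (Y : lmodType B) (N N' : set Y) :
  submodule N -> zsub Z N' -> zsub Z (torsion N N').
Proof.
move=> sN zN'; have sT := submodule_tensR_set sN; have zT' := zsub_tensR_set zN'.
split=> [|x y [N'x ax] [N'y ay]|z x Zz [N'x ax]].
- by split=> [|b _]; [exact: (zsub0 zT') | rewrite scaler0; exact: (submodule0 sT)].
- split=> [|b ab]; first exact: (zsubB zT').
  by rewrite scalerBr; exact: (submoduleB sT (ax b ab) (ay b ab)).
- split=> [|b ab]; first exact: (zsubZ zT').
  by rewrite scalerA -(Zc _ Zz) -scalerA; apply: (submoduleZ sT); exact: ax.
Qed.

Lemma torsion_ge (Y : lmodType B) (N N' : set Y) : submodule N -> N `<=` N' ->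
  tensR_set N `<=` torsion N N'.
Proof.
move=> sN NN' t Nt; split; first exact: tensR_set_mono Nt.
by move=> b _; exact: (submoduleZ (submodule_tensR_set sN)).
Qed.

Lemma torsion_le (Y : lmodType B) (N N' : set Y) : torsion N N' `<=` tensR_set N'.
Proof. by move=> t []. Qed.

Record subquotient (Y : lmodType B) (N N' : set Y) : Prop := Subquotient {
  subqN : submodule N;
  subqN' : submodule N';
  subq_sub : N `<=` N';
  subq_fin : fin_len Z N N'
}.

Lemma subq_lower (Y : lmodType B) (N0 N1 N2 : set Y) : submodule N1 ->
  N0 `<=` N1 -> N1 `<=` N2 -> subquotient N0 N2 -> subquotient N0 N1.
Proof.
move=> s1 N01 N12 [s0 s2 _ f]; split=> //.
exact: (fin_lenl (submodule_zsub Z s1) N12 f).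
Qed.

Lemma subq_upper (Y : lmodType B) (N0 N1 N2 : set Y) : submodule N1 ->
  N0 `<=` N1 -> N1 `<=` N2 -> subquotient N0 N2 -> subquotient N1 N2.
Proof.
move=> s1 N01 N12 [s0 s2 _ f]; split=> //.
exact: (fin_lenr (submodule_zsub Z s1) N01 f).
Qed.

Lemma subq_len (Y : lmodType B) (N0 N1 N2 : set Y) : submodule N1 ->
  N0 `<=` N1 -> N1 `<=` N2 -> subquotient N0 N2 ->
  len Z N0 N2 = (len Z N0 N1 + len Z N1 N2)%N.
Proof. by move=> s1 N01 N12 [s0 s2 _ f]; apply: len_add => //; exact: submodule_zsub. Qed.

Section Exactness.
Variable Y : lmodType B.

Lemma subq_tensR_set (N N' : set Y) : subquotient N N' ->
  subquotient (tensR_set N) (tensR_set N') /\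
  len Z (tensR_set N) (tensR_set N') = (n * len Z N N')%N.
Proof.
move=> [s s' NN' f]; have zN := submodule_zsub Z s; have zN' := submodule_zsub Z s'.
have [fT lT] := len_tensR_set zN zN' NN' f; split=> //; split=> //.
- exact: submodule_tensR_set.
- exact: submodule_tensR_set.
- exact: tensR_set_mono.
Qed.

Lemma torsion_fin (N N' : set Y) : subquotient N N' -> fin_len Z (tensR_set N) (torsion N N').
Proof.
move=> q; have [q' _] := subq_tensR_set q; apply: (fin_lenl _ _ (subq_fin q')).
  by apply: zsub_torsion; [exact: subqN q | apply: submodule_zsub; exact: subqN' q].
exact: torsion_le.
Qed.

Lemma hom_len_le (N N' : set Y) : subquotient N N' -> (hom_len N N' <= n * len Z N N')%N.
Proof.
move=> q; have [q' <-] := subq_tensR_set q.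
apply: (len_max (subq_fin q')); apply: chain_mono (@torsion_le _ _ _) _.
by apply: chain_len (torsion_fin q); apply: torsion_ge; [exact: subqN q | exact: subq_sub q].
Qed.

Variables N0 N1 N2 : set Y.
Hypotheses (s1 : submodule N1) (N01 : N0 `<=` N1) (N12 : N1 `<=` N2).
Hypothesis q02 : subquotient N0 N2.

Let q01 := subq_lower s1 N01 N12 q02.
Let q12 := subq_upper s1 N01 N12 q02.
Let s0 := subqN q02.
Let zT02 : zsub Z (torsion N0 N2).
Proof. by apply: zsub_torsion s0 _; apply: submodule_zsub; exact: subqN' q02. Qed.
Let zN1 : zsub Z (tensR_set N1).
Proof. by apply: zsub_tensR_set; exact: submodule_zsub. Qed.
Let lid (Y' : lmodType B) : zlinear Z (id : Y' -> Y'). Proof. by []. Qed.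

Let T01E : torsion N0 N2 `&` (id : tensR Y -> tensR Y) @^-1` tensR_set N1 = torsion N0 N1.
Proof.
apply: subset_eq => [t [[_ at0] t1]|t [t1 at0]]; first by split.
by split=> //; split=> //; exact: tensR_set_mono t1.
Qed.

Let T12_ge : sadd (id @` torsion N0 N2) (tensR_set N1) `<=` torsion N1 N2.
Proof.
have z12 : zsub Z (torsion N1 N2).
  by apply: zsub_torsion => //; apply: submodule_zsub; exact: subqN' q02.
apply: (sadd_sub z12) => [_ [t [t2 at0] <-]|]; last exact: torsion_ge.
by split=> // b /at0; exact: tensR_set_mono.
Qed.

Let T01_len : hom_len N0 N2 = (hom_len N0 N1 + len Z (torsion N0 N1) (torsion N0 N2))%N.
Proof.
apply: len_add => //; last exact: torsion_fin.
- by apply: zsub_torsion s0 _; exact: submodule_zsub.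
- exact: torsion_ge.
- by move=> t [t1 at0]; split=> //; exact: tensR_set_mono t1.
Qed.

(** Left exactness of [Hom_B(B / a, R (x) -)]. *)
Lemma hom_len_sub : (hom_len N0 N2 <= hom_len N0 N1 + hom_len N1 N2)%N.
Proof.
rewrite T01_len leq_add2l -T01E; apply: len_push_le => //; exact: torsion_fin.
Qed.

(** When lengths add up, homomorphisms to [N2 / N1] lift to [N2 / N0]. *)
Lemma hom_len_exact : (hom_len N0 N1 + hom_len N1 N2 <= hom_len N0 N2)%N ->
  torsion N1 N2 `<=` sadd (torsion N0 N2) (tensR_set N1).
Proof.
rewrite T01_len leq_add2l -{1}T01E => le12.
have fS := torsion_fin q12; rewrite -[X in sadd X _]image_id.
have zS : zsub Z (sadd (id @` torsion N0 N2) (tensR_set N1)).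
  by apply: zsub_sadd => //; exact: zsub_image.
apply: (len_eq (Z := Z) (P := tensR_set N1)) => //.
- by apply: zsub_torsion s1 _; apply: submodule_zsub; exact: subqN' q02.
- by apply: sub_saddr; exact: zsub_image.
- apply: leq_trans le12 _; apply: len_push_le => //.
  exact: (fin_lenl zS T12_ge fS).
Qed.
End Exactness.

(** Length and [hom_len] depend on a subquotient only up to isomorphism: the
    image of [S] modulo [N] has the invariants of [S] modulo the preimage. *)
Section TransportHom.
Variables (Y Y' : lmodType B) (f : Y -> Y') (N : set Y') (S : set Y).
Hypotheses (lf : linear f) (sN : submodule N) (sS : submodule S).

Let N1 := S `&` f @^-1` N.
Let N2 := sadd (f @` S) N.

Let zf : zlinear Z f. Proof. exact: linear_zlinear. Qed.
Let zN : zsub Z N. Proof. exact: submodule_zsub. Qed.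
Let zS : zsub Z S. Proof. exact: submodule_zsub. Qed.
Let sN1 : submodule N1. Proof. by apply: submoduleI => //; exact: submodule_preimage. Qed.
Let sN2 : submodule N2.
Proof.
apply: submodule_sadd => //; split.
- by exists 0; [exact: (submodule0 sS) | exact: linear_0].
- move=> _ _ [x Sx <-] [y Sy <-]; exists (x + y); first exact: (submoduleD sS).
  exact: linear_D.
- by move=> b _ [x Sx <-]; exists (b *: x); [exact: (submoduleZ sS) | exact: linear_Z].
Qed.

Lemma subq_push : subquotient N1 S -> subquotient N N2.
Proof.
move=> [_ _ _ fin]; split=> //; first exact: (sub_saddr (zsub_image zf zS)).
exact: fin_len_push.
Qed.

Lemma subq_pull : subquotient N N2 -> subquotient N1 S.
Proof.
move=> [_ _ _ fin]; split=> //; first by move=> x [].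
exact: (fin_len_pull zf zN zS (@subset_refl _ _) fin).
Qed.

Lemma len_transport : subquotient N N2 -> len Z N1 S = len Z N N2.
Proof. by move=> [_ _ _ fin]; exact: len_push. Qed.

Lemma hom_len_transport : subquotient N N2 -> hom_len N1 S = hom_len N N2.
Proof.
move=> q; have q1 := subq_pull q; pose F := tensR_map f.
have lF : zlinear Z (F : tensR Y -> tensR Y') by apply: linear_zlinear; exact: tensR_map_linear.
have E1 : torsion N1 S `&` F @^-1` tensR_set N = tensR_set N1.
  apply: subset_eq => [t [[St _] Nt] i|t N1t].
    by split; [exact: St | have := Nt i; rewrite (coordR_map lf)].
  split; first by apply: torsion_ge => // x [].
  by move=> i; rewrite (coordR_map lf); have [] := N1t i.
have zT : zsub Z (torsion N1 S) by exact: zsub_torsion.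
have zNN := zsub_tensR_set zN; have sNN := submodule_tensR_set sN.
have E2 : sadd (F @` torsion N1 S) (tensR_set N) = torsion N N2.
  have zT2 : zsub Z (torsion N N2) by apply: zsub_torsion => //; exact: submodule_zsub.
  apply: subset_eq.
    apply: (sadd_sub zT2) => [_ [t [St at1] <-]|]; last first.
      by apply: torsion_ge => //; exact: (sub_saddr (zsub_image zf zS)).
    split=> [i|b ab i].
      rewrite (coordR_map lf); apply: (sub_saddl zN); exists (coordR i t) => //; exact: St.
    by rewrite -(linear_Z (tensR_map_linear lf)) (coordR_map lf); have [] := at1 b ab i.
  move=> t [N2t at2].
  (* [t] is lifted coordinate by coordinate. *)
  have /choice [s sP] : forall i, exists s, S s /\ N (coordR i t - f s).
    move=> i; have [_ [v [[s Ss <-] Nv ->]]] := N2t i; exists s; split=> //.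
    by rewrite addrAC subrr add0r.
  pose u : tensR Y := \sum_i pureR (e i) (s i).
  have cu i : coordR i u = s i.
    rewrite /u (big_morph _ (coordR_add i) (coordR0 Y i)) (bigD1 i) //= coordR_basis eqxx big1 ?addr0 // => j.
    by rewrite eq_sym coordR_basis => /negPf ->.
  have Nd : tensR_set N (t - F u) by move=> i; rewrite coordR_sub (coordR_map lf) cu; exact: (sP i).2.
  exists (F u), (t - F u); split=> //; last by rewrite addrC subrK.
  exists u => //; split=> [i|b ab i]; first by rewrite cu; exact: (sP i).1.
  have Sbu : tensR_set S (b *: u).
    by apply: (submoduleZ (submodule_tensR_set sS)) => j; rewrite cu; exact: (sP j).1.
  split; first exact: Sbu.
  rewrite /preimage /= -(coordR_map lf) (linear_Z (tensR_map_linear lf)) -[tensR_map f u](subKr t).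
  move: i; change (tensR_set N (b *: (t - (t - F u)))).
  by rewrite scalerBr; apply: (submoduleB sNN); [exact: at2 | exact: (submoduleZ sNN)].
rewrite /hom_len -E1 -E2; apply: len_push => //; rewrite E2; exact: torsion_fin.
Qed.
End TransportHom.
End Torsion.

(** * Comparing [R (x) (R (x) Y)] with copies of [R (x) Y] *)

Section Doubling.
Variable Delta : A -> tensor A A.
Hypothesis d_assoc : forall b, tassoc (tmap Delta id (d b)) = tmap id d (d b).

Local Notation T := (tensor (kmod R) (kmod R)).

Definition diag_act (x : A) : T -> T := tact (@kact k A R) (@kact k A R) (Delta x).

Section Operators.
Variable Y : lmodType B.

Local Notation RY := (tensor (kmod R) (kmod Y)).
Local Notation RRY := (tensor (kmod R) (kmod (tensR Y))).

(** The two [k]-structures on [R (x) Y], as a [B]-module and as a tensor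
    product, agree although they are not convertible. *)
Lemma kmod_tensRZ (x : k) (t : kmod (tensR Y)) : x *: t = x *: (t : RY) :> RY.
Proof.
rewrite kmodZ -[LHS]/(tact (@kact k A R) (@kact k B Y) (d (x *: 1)) (t : RY)).
rewrite linearZ (linEZ ((tact_bilin (kact_bilin R) (kact_bilin Y)).1 _)).
by congr (_ *: _); exact: (scale1r (t : tensR Y)).
Qed.

Lemma coordRK j x (t : tensR Y) : coordR j ((x *: (1 : B)) *: t) = x *: (coordR j t : kmod Y) :> kmod Y.
Proof.
transitivity (coordR j (x *: (t : RY) : RY)); first by congr (coordR j _); exact: (kmod_tensRZ x t).
exact: (linEZ (coord_linear (Y := kmod Y) ec j)).
Qed.

Lemma pureR_bilin : bilin (fun (r : kmod R) (y : kmod Y) => pureR r y : RY).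
Proof. exact: tens_bilin. Qed.

Lemma pureR_bilinK : bilin (fun (r : kmod R) (y : kmod Y) => (pureR r y : tensR Y) : kmod (tensR Y)).
Proof.
have [pl pr] := pureR_bilin; split=> [y|r] x u v.
  by rewrite (pl y) -[in RHS]/(kmod (tensR Y)); congr (_ + _); rewrite -kmod_tensRZ.
by rewrite (pr r); congr (_ + _); rewrite -kmod_tensRZ.
Qed.

Lemma pureR2_bilin : bilin (fun (t : kmod R) (s : kmod (tensR Y)) => pureR t s : RRY).
Proof. exact: tens_bilin. Qed.

(** The associativity map [(R (x) R) (x) Y -> R (x) (R (x) Y)] with its
    arguments kept apart. *)
Definition reassoc (t : T) (y : Y) : tensR (tensR Y) :=
  tlift (fun u w : kmod R => pureR u (pureR w y) : RRY) t.

Let breassoc1 (y : kmod Y) : bilin (fun u w : kmod R => pureR u (pureR w y) : RRY).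
Proof.
have [pl pr] := pureR_bilinK; have [ql qr] := pureR2_bilin.
split=> [w|u] x v v'; first exact: ql.
by rewrite pl qr.
Qed.

Lemma reassoc_bilin : bilin (fun (t : T) (y : kmod Y) => reassoc t y : RRY).
Proof.
have [pl pr] := pureR_bilinK; have [ql qr] := pureR2_bilin.
split=> [y|t]; first exact: (tlift_linear (breassoc1 y)).
move=> x y y'; rewrite /reassoc -tlift_funlin; apply: eq_tlift => u w.
by rewrite pr qr.
Qed.

Lemma reassocE u w y : reassoc (u \ox w) y = pureR u (pureR w y).
Proof. exact: (tliftE (breassoc1 y)). Qed.

(** Associativity is [B]-linear: this is coassociativity of the coaction. *)
Lemma reassoc_act t b y :
  tlift (fun x b' => reassoc (diag_act x t) (b' *: y) : RRY) (d b) = b *: reassoc t y.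
Proof.
have [pl pr] := pureR_bilinK; have [ql qr] := pureR2_bilin.
have [tl tr] := reassoc_bilin.
have [al ar] := tact_bilin (kact_bilin R) (kact_bilin R).
elim/tensor_ind: t => [|u w|s t IHs IHt].
- have -> : reassoc 0 y = 0 by exact: (linE0 (tl y)).
  rewrite scaler0 /tlift big1 // => p _.
  rewrite (_ : diag_act _ 0 = 0); last exact: (linE0 (ar _)).
  exact: (linE0 (tl _)).
- pose m (x : A) (b' : B) : kmod (tensR Y) := pureR (x *: w) (b' *: y).
  have bm : bilin m.
    split=> [b'|x]; first exact: (lin_comp (pl (b' *: y)) ((kact_bilin R).1 w)).
    exact: (lin_comp (pr (x *: (w : R))) ((kact_bilin Y).1 y)).
  pose l (x : A) (t : tensor A B) : RRY := pureR (x *: u) (tlift m t).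
  have bl : bilin l.
    split=> [t|x]; first exact: (lin_comp (ql (tlift m t)) ((kact_bilin R).1 u)).
    exact: (lin_comp (qr (x *: (u : R))) (tlift_linear bm)).
  rewrite reassocE pureR_scale.
  have -> : tlift (fun x b' => pureR (x *: u) (b' *: pureR w y) : RRY) (d b) =
            tlift l (tmap id d (d b)).
    rewrite (tlift_tmap _ _ _ bl).
    by apply: eq_tlift => x b'; rewrite /l pureR_scale.
  rewrite -d_assoc.
  pose f (t : tensor A A) (b' : B) : RRY :=
    tlift (fun x x' => pureR (x *: u) (m x' b') : RRY) t.
  have lf b' : bilin (fun x x' => pureR (x *: u) (m x' b') : RRY).
    split=> [x'|x]; first exact: (lin_comp (ql (m x' b')) ((kact_bilin R).1 u)).
    exact: (lin_comp (qr (x *: (u : R))) (bm.1 b')).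
  have bf : bilin f.
    split=> [b'|t]; first exact: (tlift_linear (lf b')).
    move=> z v v'; rewrite /f -tlift_funlin; apply: eq_tlift => x x'.
    by rewrite bm.2 qr.
  (* [l] and [f] encode one trilinear map, bracketed in the two ways. *)
  have LM t : tlift l (tassoc t) = tlift f t.
    move: t; apply: tensor_ext; [|exact: tlift_linear|].
      exact: (lin_comp (tlift_linear bl) (@tassoc_linear _ _ _ _)).
    move=> t b'; rewrite (tliftE bf); move: t; apply: tensor_ext.
    + move=> z v v'; rewrite (tens_bilin _ _).1 tassoc_linear.
      exact: tlift_linear.
    + exact: bf.1.
    move=> x x'; rewrite tassocE (tliftE bl) /l (tliftE bm).
    by symmetry; exact: (tliftE (lf b')).
  rewrite LM (tlift_tmap _ _ _ bf).
  apply: eq_tlift => x b'; rewrite /f /diag_act /tact.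
  rewrite (lin_tlift _ _ (tl (b' *: y))); apply: eq_tlift => x1 x2.
  rewrite tmapE ?reassocE //; [exact: (kact_bilin R).2|exact: (kact_bilin R).2].
- have -> : reassoc (s + t) y = reassoc s y + reassoc t y by exact: (linED (tl y)).
  rewrite scalerDr -IHs -IHt.
  have tlD : forall (f g : A -> B -> RRY) z,
    tlift f z + tlift g z = tlift (fun x b' => f x b' + g x b') z.
    by move=> f g z; rewrite /tlift big_split.
  rewrite [RHS]tlD; apply: eq_tlift => x b'.
  rewrite (_ : diag_act x (s + t) = diag_act x s + diag_act x t); last exact: (linED (ar _)).
  exact: (linED (tl _)).
Qed.

Section Extend.
Variable G : T -> T.
Hypothesis lG : linear G.

(** The operator that [G] induces on [R (x) (R (x) Y)] by acting on the two
    factors [R]; using a basis avoids a reassociation map in the other direction. *)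
Definition extop (s : tensR (tensR Y)) : tensR (tensR Y) :=
  \sum_i \sum_j reassoc (G (e i \ox e j)) (coordR j (coordR i s)).

Lemma extop_add s t : extop (s + t) = extop s + extop t.
Proof.
rewrite /extop -big_split; apply: eq_bigr => i _; rewrite -big_split.
apply: eq_bigr => j _; rewrite !coordR_add.
exact: (linED (reassoc_bilin.2 _)).
Qed.

Lemma extop0 : extop 0 = 0.
Proof. by apply: (addrI (extop 0)); rewrite -extop_add !addr0. Qed.

Lemma extop_pure (v r : kmod R) y : extop (pureR v (pureR r y)) = reassoc (G (v \ox r)) y.
Proof.
have [tl tr] := reassoc_bilin; have [bl br] := tens_bilin (kmod R) (kmod R).
have lGt : linear (fun t => reassoc (G t) y : RRY) by exact: (lin_comp (tl y) lG).
rewrite [X in G (X \ox _)](dual_span ec v) (linE_sum (bl _)) (linE_sum lGt).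
apply: eq_bigr => i _; rewrite [X in G (_ \ox X)](dual_span ec r) (linE_sum (br _)) (linE_sum lGt).
apply: eq_bigr => j _.
rewrite (linEZ (br _)) (linEZ (bl _)) scalerA (linEZ lGt) -(linEZ (tr _)).
congr (reassoc _ _); rewrite coordR_pure.
rewrite coordRK coordR_pure -[_ *: y]/(c j r *: (y : kmod Y)).
by rewrite scalerA mulrC.
Qed.

Lemma extop_reassoc t y : extop (reassoc t y) = reassoc (G t) y.
Proof.
have [tl tr] := reassoc_bilin.
elim/tensor_ind: t => [|v r|s t IHs IHt]; first last.
- rewrite (linED lG); have triD s' t' : reassoc (s' + t') y = reassoc s' y + reassoc t' y.
    exact: (linED (tl y)).
  by rewrite !triD extop_add IHs IHt.
- by rewrite reassocE extop_pure.
have tri0 : reassoc 0 y = 0 by exact: (linE0 (tl y)).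
by rewrite (linE0 lG) tri0 extop0.
Qed.

Lemma extop_tensR_set (N : set Y) s : submodule N ->
  tensR_set (tensR_set N) s -> tensR_set (tensR_set N) (extop s).
Proof.
move=> sN Ns; have sT := submodule_tensR_set (submodule_tensR_set sN).
apply: submodule_sum => // i; apply: submodule_sum => // j.
have : N (coordR j (coordR i s)) by exact: Ns.
move: (coordR j _) => y Ny; elim/tensor_ind: (G _) => [|v r|t t' IH IH'].
- rewrite (_ : reassoc 0 y = 0); first exact: (submodule0 sT).
  exact: (linE0 (reassoc_bilin.1 y)).
- by rewrite reassocE; apply: (tensR_set_pure _ (submodule_tensR_set sN)); exact: tensR_set_pure.
- rewrite (_ : reassoc _ y = reassoc t y + reassoc t' y); first exact: (submoduleD sT).
  exact: (linED (reassoc_bilin.1 y)).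
Qed.

End Extend.

Lemma pureR2_ind (P : tensR (tensR Y) -> Prop) :
  P 0 -> (forall v r y, P (pureR v (pureR r y))) ->
  (forall s t, P s -> P t -> P (s + t)) -> forall s, P s.
Proof.
move=> P0 Pp PD; elim/pureR_ind => // v t; elim/pureR_ind: t => [|//|s t IHs IHt].
  by rewrite (_ : pureR v 0 = 0) //; exact: (linE0 (pureR2_bilin.2 v)).
by rewrite pureR_addr; exact: PD.
Qed.

Lemma extop_cancel G G' : linear G -> linear G' -> cancel G G' -> cancel (extop G) (extop G').
Proof.
move=> lG lG' GK; elim/pureR2_ind => [|v r y|s t IHs IHt].
- by rewrite !extop0.
- by rewrite extop_pure // extop_reassoc // GK reassocE.
- by rewrite !extop_add // IHs IHt.
Qed.

Lemma extop_zlinear G : linear G -> zlinear Z (extop G).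
Proof.
move=> lG; have eD := extop_add G; have e0 := extop0 G; split=> [x y|z s Zz].
  by apply: (addIr (extop G y)); rewrite -eD !subrK.
elim/pureR2_ind: s => [|v r y|s t IHs IHt].
- by rewrite e0 !scaler0 e0.
- rewrite !pureR_scalar // !extop_pure //.
  elim/tensor_ind: (G _) => [|u w|t t' IH IH'].
  + rewrite (_ : reassoc 0 (z *: y) = 0); last exact: (linE0 (reassoc_bilin.1 (z *: y))).
    by rewrite (_ : reassoc 0 y = 0) ?scaler0 //; exact: (linE0 (reassoc_bilin.1 y)).
  + by rewrite !reassocE !pureR_scalar.
  + rewrite (_ : reassoc (t + t') (z *: y) = reassoc t (z *: y) + reassoc t' (z *: y)); last first.
      exact: (linED (reassoc_bilin.1 (z *: y))).
    rewrite (_ : reassoc (t + t') y = reassoc t y + reassoc t' y); last exact: (linED (reassoc_bilin.1 y)).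
    by rewrite scalerDr IH IH'.
- by rewrite scalerDr !eD IHs IHt scalerDr.
Qed.

(** When [r |-> G (v (x) r)] is [A]-linear from [R] to [R (x) R], the operator is
    [B]-linear on each copy [v (x) (R (x) Y)] of [R (x) Y]. *)
Lemma extop_equivariant (G : T -> T) (v : kmod R) : linear G ->
  (forall x (r : R), G (v \ox ((x *: r : R) : kmod R)) = diag_act x (G (v \ox (r : kmod R)))) ->
  forall b s, extop G (pureR v (b *: s)) = b *: extop G (pureR v s).
Proof.
move=> lG GA b; have [tl tr] := reassoc_bilin.
have eD := extop_add G; have e0 := extop0 G; have lpv := pureR2_bilin.2 v.
have pv0 : pureR v (0 : tensR Y) = 0 by exact: (linE0 lpv).
elim/pureR_ind => [|r y|s t IHs IHt].
- by rewrite scaler0 pv0 e0 scaler0.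
- rewrite extop_pure // -reassoc_act pureR_scale.
  have D s t : extop G (pureR v (s + t)) = extop G (pureR v s) + extop G (pureR v t).
    by rewrite pureR_addr eD.
  rewrite /tlift (big_morph (fun t : tensR Y => extop G (pureR v t)) D (_ : _ = 0)); last first.
    by rewrite pv0 e0.
  apply: eq_bigr => p _; move: p.1 p.2 => x b'.
  by rewrite extop_pure // GA.
- by rewrite scalerDr !pureR_addr !eD IHs IHt scalerDr.
Qed.

End Operators.

Section HomLenTensor.
Variables (Phi Theta : T -> T).
Hypotheses (lPhi : linear Phi) (lTheta : linear Theta).
Hypothesis PhiK : cancel Phi Theta.
Hypothesis Phi_act : forall (v : kmod R) x (r : R),
  Phi (v \ox ((x *: r : R) : kmod R)) = diag_act x (Phi (v \ox (r : kmod R))).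

(** [Phi] carries [n] copies of [R (x) N'] isomorphically and [B]-linearly onto
    [R (x) (R (x) N')], so [n] independent copies of the homomorphisms from
    [B / a] to [R (x) (N' / N)] are found there. *)
Lemma hom_len_tensR a (Y : lmodType B) (N N' : set Y) : subquotient N N' ->
  (n * hom_len a N N' <= hom_len a (tensR_set N) (tensR_set N'))%N.
Proof.
move=> q; have [q' _] := subq_tensR_set q; have [s s' NN' _] := q.
have zT : zsub Z (torsion a N N') by apply: zsub_torsion => //; exact: submodule_zsub.
have sN := submodule_tensR_set s; have sNN := submodule_tensR_set sN.
have zNN : zsub Z (tensR_set (tensR_set N)) by exact: submodule_zsub.
have zT' : zsub Z (torsion a (tensR_set N) (tensR_set N')).
  by apply: zsub_torsion => //; apply: submodule_zsub; exact: submodule_tensR_set.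
have [fT lT] := len_tensR_set (submodule_zsub Z sN) zT (torsion_ge a s NN') (torsion_fin a q).
pose f : tensR (tensR Y) -> tensR (tensR Y) := extop Phi (Y := Y).
have lf : zlinear Z f by exact: extop_zlinear.
have fE : tensR_set (torsion a N N') `&` f @^-1` tensR_set (tensR_set N) = tensR_set (tensR_set N).
  apply: subset_eq => [t [_ Nft]|t Nt].
    by rewrite -(extop_cancel lPhi lTheta PhiK t); exact: extop_tensR_set.
  split; first by apply: tensR_set_mono Nt; exact: torsion_ge.
  exact: extop_tensR_set.
rewrite -lT -fE; apply: len_push_le => //; [exact: zsub_tensR_set | | exact: torsion_fin].
apply: (sadd_sub zT') => [_ [t Tt <-]|]; last first.
  by apply: torsion_ge => //; exact: tensR_set_mono.
rewrite (coordR_sum t) /f (big_morph (extop Phi (Y := Y)) (@extop_add Y Phi) (extop0 Y Phi)).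
apply: (big_ind (torsion a (tensR_set N) (tensR_set N'))) => [|x y|i _].
- exact: (zsub0 zT').
- exact: (zsubD zT').
have [Ni ai] := Tt i; split=> [|b /ai ab].
  by apply: extop_tensR_set => //; exact: (tensR_set_pure _ (submodule_tensR_set s')  Ni).
rewrite -(extop_equivariant lPhi (Phi_act (e i))); apply: extop_tensR_set => //.
exact: (tensR_set_pure _ sN ab).
Qed.

(** * The maximal ratio of [hom_len] to length *)

(** [t0] and [eR] make the trivial module a direct summand of [R], and so make
    [Y] a direct summand of [R (x) Y]. *)
Section Counit.
Variables (eps : A -> k) (t0 : R) (eR : kmod R -> k).
Hypothesis d_counit : forall b, tlift (fun x b' => eps x *: b') (d b) = b.
Hypothesis t0_act : forall x : A, x *: t0 = (eps x *: (1 : A)) *: t0.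
Hypothesis leR : linear (eR : kmod R -> k^o).
Hypothesis eR_act : forall (x : A) (r : R), eR (x *: r) = eps x * eR r.
Hypothesis eR_t0 : eR t0 = 1.

Lemma pureR_t0_act (Y : lmodType B) b (y : Y) : b *: pureR t0 y = pureR t0 (b *: y).
Proof.
have [pl pr] := pureR_bilin Y; rewrite -[in RHS](d_counit b) pureR_scale.
have l : linear (fun b : B => pureR t0 (b *: y) : tensor (kmod R) (kmod Y)).
  exact: (lin_comp (pr t0) ((kact_bilin Y).1 y)).
rewrite [RHS](lin_tlift _ _ l); apply: eq_tlift => x b'.
rewrite t0_act -[_ *: t0]/(eps x *: (t0 : kmod R)) (linEZ (pl _)).
by rewrite (linEZ l).
Qed.

Definition epsR (Y : lmodType B) (t : tensR Y) : Y :=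
  tlift (fun (r : kmod R) (y : kmod Y) => eR r *: y) t.

Let bepsR (Y : lmodType B) : bilin (fun (r : kmod R) (y : kmod Y) => eR r *: y).
Proof.
split=> [b|x] z u v; first by rewrite leR scalerDl scalerA.
by rewrite scalerDr !scalerA mulrC.
Qed.

Lemma epsR_pure (Y : lmodType B) r (y : Y) : epsR (pureR r y) = eR r *: (y : kmod Y).
Proof. exact: (tliftE (bepsR Y)). Qed.

Lemma epsR_linear (Y : lmodType B) : linear (@epsR Y : tensor (kmod R) (kmod Y) -> kmod Y).
Proof. exact: (tlift_linear (bepsR Y)). Qed.

Lemma epsRD (Y : lmodType B) (s t : tensR Y) : epsR (s + t) = epsR s + epsR t.
Proof. exact: (linED (@epsR_linear Y) s t). Qed.

Lemma epsR0 (Y : lmodType B) : epsR (0 : tensR Y) = 0.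
Proof. exact: (linE0 (@epsR_linear Y)). Qed.

Lemma epsR_act (Y : lmodType B) b (t : tensR Y) : epsR (b *: t) = b *: epsR t.
Proof.
elim/pureR_ind: t => [|r y|s t IHs IHt].
- by rewrite scaler0 epsR0 scaler0.
- rewrite pureR_scale [LHS](lin_tlift _ _ (@epsR_linear Y)) epsR_pure kmodAZ.
  have l : linear (fun b : B => eR r *: ((b *: y : Y) : kmod Y)).
    by move=> z u v; rewrite [_ *: y](kact_bilin Y).1 scalerDr !scalerA mulrC.
  rewrite -[in RHS](d_counit b) [RHS](lin_tlift _ _ l).
  apply: (@eq_tlift _ _ _ (kmod Y)) => x b'.
  rewrite [LHS]epsR_pure eR_act mulrC -scalerA; congr (_ *: _).
  by rewrite kmodZA.
- by rewrite scalerDr !epsRD IHs IHt scalerDr.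
Qed.

Lemma epsR_tensR_set (Y : lmodType B) (N : set Y) t : submodule N -> tensR_set N t -> N (epsR t).
Proof.
move=> sN Nt; rewrite (coordR_sum t) (big_morph _ (@epsRD Y) (epsR0 Y)).
by apply: submodule_sum => // i; rewrite epsR_pure; exact: submoduleK.
Qed.

Lemma epsR_t0 (Y : lmodType B) (y : Y) : epsR (pureR t0 y) = y.
Proof. by rewrite epsR_pure eR_t0 [LHS]scale1r. Qed.

(** Maximality of a left ideal, in the form that makes [B / a] simple. *)
Record max_left (a : set B) : Prop := MaxLeft {
  max_left_sub : submodule (a : set B^o);
  max_left1 : ~ a 1;
  max_left_inv : forall b, ~ a b -> exists b', a (b' * b - 1)
}.

Lemma max_left_eq (a a' : set B) : max_left a -> submodule (a' : set B^o) ->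
  ~ a' 1 -> a `<=` a' -> a' = a.
Proof.
move=> [sa a1 inv] sa' a'1 aa'; apply: subset_eq => // b a'b.
apply: contrapT => /inv [b' /aa' h]; apply: a'1.
have := submoduleB sa' (submoduleZ sa' b' a'b) h; rewrite [_ *: _]/(b' * b).
by rewrite opprB addrC subrK.
Qed.

Hypothesis finB : fin_len Z [set 0] [set: B^o].

Let sub0 (Y : lmodType B) : submodule [set (0 : Y)].
Proof. by split=> [//|x y -> ->|a x ->]; rewrite ?addr0 ?scaler0. Qed.
Let subT (Y : lmodType B) : submodule [set: Y].
Proof. by split. Qed.

Let D := len Z [set 0] [set: B^o].

Lemma subq_ideal (a : set B) : submodule (a : set B^o) ->
  subquotient (a : set B^o) [set: B^o].
Proof.
move=> sa; split=> //; apply: (fin_lenr (submodule_zsub Z sa) _ finB).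
by move=> _ ->; exact: (submodule0 sa).
Qed.

Lemma len_ideal (a : set B) : submodule (a : set B^o) ->
  (len Z (a : set B^o) [set: B^o] <= D)%N.
Proof.
move=> sa; have q0 : subquotient [set (0 : B^o)] setT by split.
have a0 : [set (0 : B^o)] `<=` a by move=> _ ->; exact: (submodule0 sa).
by rewrite /D (subq_len sa a0 (@subsetT _ a) q0) leq_addl.
Qed.

Section Cyclic.
Variables (Y : lmodType B) (N : set Y) (u : Y).
Hypothesis sN : submodule N.
Let f : B^o -> Y := fun b => b *: u.
Let lf : linear f. Proof. by move=> x y z; rewrite /f scalerDl scalerA. Qed.

(** The left ideal [a] for which [B / a] is the submodule of [Y / N] generated
    by [u]. *)
Definition annihilator : set B := [set b | N (b *: u)].

Lemma submodule_annihilator : submodule (annihilator : set B^o).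
Proof. exact: submodule_preimage lf sN. Qed.

Lemma imageT_act : sadd (f @` [set: B^o]) N = sadd (cyclic u) N.
Proof.
apply: subset_eq => _ [x [y [Bx Ny ->]]].
  by case: Bx => b _ <-; exists (b *: u), y; split=> //; exists b.
by case: Bx => b ->; exists (b *: u), y; split=> //; exists b.
Qed.

Lemma subq_cyclic : subquotient N (sadd (cyclic u) N).
Proof.
rewrite -imageT_act; apply: subq_push lf sN (subT _) _; rewrite setTI.
exact: (subq_ideal submodule_annihilator).
Qed.

Lemma len_cyclic : len Z N (sadd (cyclic u) N) = len Z (annihilator : set B^o) [set: B^o].
Proof.
have := subq_cyclic; rewrite -imageT_act => q.
by rewrite -(len_transport lf sN (subT _) q) setTI.
Qed.

Lemma hom_len_cyclic a :
  hom_len a N (sadd (cyclic u) N) = hom_len a (annihilator : set B^o) [set: B^o].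
Proof.
have := subq_cyclic; rewrite -imageT_act => q.
by rewrite -(hom_len_transport a lf sN (subT _) q) setTI.
Qed.
End Cyclic.

Section Ratio.
Variable a : set B.

Definition ratio_bound (p q : nat) := forall (Y : lmodType B) (N N' : set Y),
  subquotient N N' -> (q * hom_len a N N' <= p * len Z N N')%N.

(** The opposite inequality follows from [ratio_bound]. *)
Definition good (p q : nat) (Y : lmodType B) (N N' : set Y) :=
  subquotient N N' /\ (p * len Z N N' <= q * hom_len a N N')%N.

Lemma hom_len_gt0 (Y : lmodType B) (N N' : set Y) : subquotient N N' ->
  (0 < hom_len a N N')%N -> exists t, torsion a N N' t /\ ~ tensR_set N t.
Proof.
move=> [s _ NN' _] h; apply: contrapT => nex; move: h; rewrite /hom_len.
rewrite (_ : torsion a N N' = tensR_set N) ?len_refl //; apply: subset_eq; last exact: torsion_ge.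
by move=> t Tt; apply: contrapT => nt; apply: nex; exists t.
Qed.

Lemma ratio_cross (h l p q F u v : nat) : (0 < F)%N -> (u * l)%N = F -> (v * q)%N = F ->
  (h * u <= p * v)%N -> (q * h <= p * l)%N.
Proof.
move=> F0 uE vE le; rewrite -(leq_pmul2r F0) -{1}uE -vE.
have -> : (q * h * (u * l) = h * u * (q * l))%N by rewrite mulnACA [(q * u)%N]mulnC mulnACA [(u * h)%N]mulnC.
have -> : (p * l * (v * q) = p * v * (q * l))%N by rewrite mulnACA [(l * q)%N]mulnC.
by rewrite leq_mul2r le orbT.
Qed.

(** The class of [t0 (x) 1] is a nonzero homomorphism from [B / a] to
    [R (x) (B / a)]. *)
Lemma hom_len_ideal : max_left a -> (0 < hom_len a (a : set B^o) setT)%N.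
Proof.
move=> [sa a1 _]; have q := subq_ideal sa.
apply: (len_gt0 _ _ (torsion_fin a q)); first exact/submodule_zsub/submodule_tensR_set.
apply/proper_exP; split; first exact: torsion_ge.
exists (pureR t0 (1 : B^o)).
  split=> // b ab; rewrite pureR_t0_act; apply: tensR_set_pure => //.
  by rewrite [_ *: _]mulr1.
by move=> /(epsR_tensR_set sa); rewrite epsR_t0.
Qed.

(** Subquotients of length at most [D], the length of [B], have finitely many
    ratios, so one of them attains the maximum; a longer one is not cyclic and
    inherits the bound from the two ends of a proper interval. *)
Lemma max_ratio : max_left a -> exists p q : nat, [/\ (0 < p)%N, (0 < q)%N, ratio_bound p q
  & exists (Y : lmodType B) (N N' : set Y), good p q N N' /\ hom_len a N N' = p].
Proof.
move=> ma; pose P (m : nat) := exists (Y : lmodType B) (N N' : set Y),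
  [/\ subquotient N N', (0 < len Z N N' <= D)%N & m = (hom_len a N N' * (D`! %/ len Z N N'))%N].
(* Multiplying the ratio by [D`!] makes it an integer. *)
have exP : exists m, `[< P m >].
  exists (hom_len a [set (0%R : B^o)] setT * (D`! %/ D))%N; apply/asboolP.
  exists B^o, [set 0], setT; split=> //.
  rewrite leqnn andbT; apply: len_gt0 finB; first exact: submodule_zsub.
  by apply/proper_exP; split=> //; exists 1 => //= /eqP; rewrite oner_eq0.
have dv l : (0 < l <= D)%N -> (D`! %/ l * l = D`!)%N by move=> lD; apply/divnK/dvdn_fact.
have bdP m : `[< P m >] -> (m <= n * D`!)%N.
  move=> /asboolP[Y [N [N' [q lD ->]]]].
  rewrite -[X in (_ <= n * X)%N](dv _ lD) mulnA mulnAC leq_mul2r.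
  by rewrite (hom_len_le a q) orbT.
case: (ex_maxnP exP bdP) => m /asboolP[Y [N [N' [qN lD mE]]]] maxm.
pose p := hom_len a N N'; pose q := len Z N N'.
have q0 : (0 < q)%N by case/andP: lD.
have small (X : lmodType B) (M M' : set X) : subquotient M M' ->
    (0 < len Z M M' <= D)%N -> (q * hom_len a M M' <= p * len Z M M')%N.
  move=> qM lM; set l := len Z M M'; set h := hom_len a M M'.
  have : (h * (D`! %/ l) <= p * (D`! %/ q))%N.
    by rewrite -mE; apply: maxm; apply/asboolP; exists X, M, M'.
  by apply: (@ratio_cross _ _ _ _ D`!); rewrite ?dv ?fact_gt0.
have bnd : ratio_bound p q.
  move=> X M M' qM; have [l lE] : exists l, (len Z M M' <= l)%N by exists (len Z M M').
  elim: l M M' qM lE => [|l IH] M M' qM lM.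
    move: (hom_len_le a qM); move: lM; rewrite leqn0 => /eqP ->.
    by rewrite muln0 leqn0 => /eqP ->; rewrite !muln0.
  have [l0|l0] := posnP (len Z M M').
    by move: (hom_len_le a qM); rewrite l0 muln0 leqn0 => /eqP ->; rewrite !muln0.
  have [lD'|ltD] := leqP (len Z M M') D; first by apply: small; rewrite ?l0.
  have [sM sM' MM' fM] := qM; have zM := submodule_zsub Z sM.
  have [u M'u nMu] : exists2 u, M' u & ~ M u.
    apply: contrapT => nex; move: l0; rewrite (_ : M' = M) ?len_refl //.
    apply: subset_eq => // u M'u; apply: contrapT => nMu; apply: nex; by exists u.
  pose M1 := sadd (cyclic u) M; have sM1 : submodule M1.
    by apply: submodule_sadd => //; exact: submodule_cyclic.
  have MM1 : M `<=` M1 by apply: (sub_saddr (submodule_zsub Z (submodule_cyclic u))).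
  have M1u : M1 u by apply: (sub_saddl zM); exact: cyclic_id.
  have M1M' : M1 `<=` M'.
    apply: (sadd_sub (submodule_zsub Z sM')) => // _ [b ->]; exact: (submoduleZ sM').
  have le1 : (len Z M M1 <= D)%N.
    by rewrite len_cyclic //; apply: len_ideal; exact: submodule_annihilator.
  have lE := subq_len sM1 MM1 M1M' qM.
  have q1 := subq_lower sM1 MM1 M1M' qM; have q2 := subq_upper sM1 MM1 M1M' qM.
  have gt1 : (0 < len Z M M1)%N.
    by apply: (len_gt0 zM) (subq_fin q1); split=> // /(_ u M1u).
  have h1 : (q * hom_len a M M1 <= p * len Z M M1)%N by apply: small; rewrite // gt1.
  have h2 : (q * hom_len a M1 M' <= p * len Z M1 M')%N.
    by apply: IH => //; rewrite -ltnS; apply: leq_trans lM; rewrite lE -[X in (X < _)%N]add0n ltn_add2r.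
  rewrite lE mulnDr; apply: leq_trans (leq_add h1 h2).
  by rewrite -mulnDr leq_mul2l hom_len_sub ?orbT.
have p0 : (0 < p)%N.
  have := bnd _ _ _ (subq_ideal (max_left_sub ma)); rewrite lt0n; apply: contraTneq => ->.
  rewrite mul0n -ltnNge muln_gt0 q0 /=; exact: hom_len_ideal.
exists p, q; split=> //; exists Y, N, N'; split=> //; split=> //.
by rewrite /p /q mulnC.
Qed.

Section Good.
Variables p q : nat.
Hypothesis bnd : ratio_bound p q.

(** A proper defect at one end could not be compensated at the other, where the
    bound holds as well. *)
Lemma good_between (Y : lmodType B) (N0 N1 N2 : set Y) : submodule N1 ->
  N0 `<=` N1 -> N1 `<=` N2 -> good p q N0 N2 -> good p q N0 N1 /\ good p q N1 N2.
Proof.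
move=> s1 N01 N12 [q02 g].
have q01 := subq_lower s1 N01 N12 q02; have q12 := subq_upper s1 N01 N12 q02.
move: g; rewrite (subq_len s1 N01 N12 q02) mulnDr => g.
have := leq_trans g (leq_mul (leqnn q) (hom_len_sub a s1 N01 N12 q02)); rewrite mulnDr => h.
have b1 := bnd q01; have b2 := bnd q12.
split; split=> //.
  by rewrite -(leq_add2r (p * len Z N1 N2)); apply: leq_trans h _; rewrite leq_add2l.
by rewrite -(leq_add2l (p * len Z N0 N1)); apply: leq_trans h _; rewrite leq_add2r.
Qed.

Lemma good_exact (Y : lmodType B) (N0 N1 N2 : set Y) : (0 < q)%N -> submodule N1 ->
  N0 `<=` N1 -> N1 `<=` N2 -> good p q N0 N2 ->
  torsion a N1 N2 `<=` sadd (torsion a N0 N2) (tensR_set N1).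
Proof.
move=> q0 s1 N01 N12 [q02 g]; apply: hom_len_exact => //.
have q01 := subq_lower s1 N01 N12 q02; have q12 := subq_upper s1 N01 N12 q02.
rewrite -(leq_pmul2l q0); apply: leq_trans g.
by rewrite (subq_len s1 N01 N12 q02) !mulnDr leq_add ?bnd.
Qed.

Lemma good_tensR (Y : lmodType B) (N N' : set Y) : good p q N N' ->
  good p q (tensR_set N) (tensR_set N').
Proof.
move=> [qN g]; have [qT lT] := subq_tensR_set qN; split=> //; rewrite lT mulnCA.
apply: leq_trans (leq_mul (leqnn q) (hom_len_tensR a qN)).
by rewrite [leqRHS]mulnCA leq_mul2l g orbT.
Qed.

Lemma good_cyclic (Y : lmodType B) (N : set Y) u : submodule N ->
  good p q N (sadd (cyclic u) N) <-> good p q (annihilator N u : set B^o) [set: B^o].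
Proof.
move=> sN; split=> -[_ g]; split; rewrite ?(len_cyclic, hom_len_cyclic) // in g *.
- exact: (subq_ideal (submodule_annihilator u sN)).
- exact: subq_cyclic.
Qed.

(** A nonzero homomorphism from [B / a'] to a good module is injective, so its
    image is a good copy of [B / a']. *)
Lemma good_embed (Y : lmodType B) (N N' : set Y) (a' : set B) t : max_left a' ->
  good p q N N' -> N' t -> ~ N t -> (forall b, a' b -> N (b *: t)) ->
  good p q (a' : set B^o) [set: B^o].
Proof.
move=> ma' g N't nNt a't; have [[sN sN' NN' _] _] := g.
have <- : annihilator N t = a'.
  apply: (max_left_eq ma') => //; first exact: submodule_annihilator.
  by rewrite /annihilator /= scale1r.
apply/(good_cyclic t sN).
have sM : submodule (sadd (cyclic t) N) by apply: submodule_sadd => //; exact: submodule_cyclic.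
have NM : N `<=` sadd (cyclic t) N by exact: (sub_saddr (submodule_zsub Z (submodule_cyclic t))).
have MN' : sadd (cyclic t) N `<=` N'.
  by apply: (sadd_sub (submodule_zsub Z sN')) => // _ [b ->]; exact: (submoduleZ sN').
by have [] := good_between sM NM MN' g.
Qed.

End Good.

(** Tensoring with [R] a module that attains the maximal, hence positive, ratio
    gives a good module with a copy of [B / a] inside. *)
Lemma good_ideal : max_left a -> exists p q : nat,
  [/\ (0 < p)%N, (0 < q)%N, ratio_bound p q & good p q (a : set B^o) [set: B^o]].
Proof.
move=> ma; have [p [q [p0 q0 bnd [Y [N [N' [g hE]]]]]]] := max_ratio ma.
exists p, q; split=> //; have [qN _] := g.
have [|t [[t' at0] nt]] := hom_len_gt0 qN; first by rewrite hE.
exact: (good_embed bnd ma (good_tensR g) t' nt at0).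
Qed.

End Ratio.

(** Above every proper submodule [M] a simple subquotient is chosen and lifted to
    a submodule meeting [M] trivially. *)
Lemma cr_tensR (W : lmodType B) (w : W) : (forall x, cyclic w x) ->
  max_left (annihilator [set 0] w) -> completely_reducible (tensR W).
Proof.
move=> Ww; set a0 := annihilator _ _ => ma0.
have WT : sadd (cyclic w) [set 0] = [set: W].
  by apply: subset_eq => // x _; exists x, 0; rewrite addr0.
have tT : tensR_set [set: W] = setT by apply: subset_eq.
have t0E : tensR_set [set (0 : W)] = [set 0].
  apply: subset_eq => [t t0'|_ ->]; last by move=> i; rewrite coordR0.
  rewrite /= (coordR_sum t) big1 // => i _; rewrite (t0' i).
  exact: (linE0 ((pureR_bilin W).2 (e i))).
have qY : subquotient [set (0 : tensR W)] setT.
  have := subq_cyclic w (sub0 W); rewrite WT => q.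
  by have [] := subq_tensR_set q; rewrite t0E tT.
have goodY (a : set B) p q : good a p q (a0 : set B^o) setT ->
    ratio_bound a p q -> good a p q [set (0 : tensR W)] setT.
  move=> g bnd; rewrite -t0E -tT; apply: good_tensR => //.
  by rewrite -WT; apply/(good_cyclic _ _ _ w (sub0 W)).
apply: cr_of_avoids => M sM nM; have zM := submodule_zsub Z sM.
have M0 : [set 0] `<=` M by move=> _ ->; exact: (submodule0 sM).
pose M' u := sadd (cyclic u) M.
have sM' u : submodule (M' u) by apply: submodule_sadd => //; exact: submodule_cyclic.
have MM' u : M `<=` M' u by exact: (sub_saddr (submodule_zsub Z (submodule_cyclic u))).
have M'u u : M' u u by apply: (sub_saddl zM); exact: cyclic_id.
have qM u : subquotient M (M' u).
  apply: (subq_upper sM M0 (@MM' u)).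
  apply: (subq_lower (sM' u) _ (@subsetT _ _) qY).
  exact: subset_trans (MM' u).
(* A vector generating the shortest possible submodule modulo [M]: then
   [M' u0 / M] is simple. *)
have [u0 [nMu0 minu0]] : exists u0, ~ M u0 /\
    forall u, ~ M u -> (len Z M (M' u0) <= len Z M (M' u))%N.
  pose P l := exists u, ~ M u /\ len Z M (M' u) = l.
  have exP : exists l, `[< P l >].
    have [u nMu] : exists u, ~ M u.
      apply: contrapT => /forallNP MT; apply: nM; apply: subset_eq => // u _.
      exact: contrapT.
    by exists (len Z M (M' u)); apply/asboolP; exists u.
  case: (ex_minnP exP) => l /asboolP [u [nMu <-]] minl; exists u; split=> // v nMv.
  by apply: minl; apply/asboolP; exists v.
pose a := annihilator M u0; have sa : submodule (a : set B^o) by exact: submodule_annihilator.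
have ma : max_left a.
  split=> // [|b nab]; first by rewrite /a /annihilator /= scale1r.
  have sub : M' (b *: u0) `<=` M' u0.
    apply: (sadd_sub (submodule_zsub Z (sM' u0))) => // _ [b' ->].
    by apply: (submoduleZ (sM' u0)); exact: (submoduleZ (sM' u0)).
  have eqM : M' u0 `<=` M' (b *: u0).
    apply: (len_eq (Z := Z) (P := M)) => //; try exact: submodule_zsub.
      exact: subq_fin (qM u0).
    exact: minu0.
  have [_ [m [[b' ->] Mm uE]]] := eqM _ (M'u u0).
  exists b'; rewrite /a /annihilator /= scalerBl scale1r [X in _ - X]uE scalerA opprD addrA subrr sub0r.
  by rewrite -scaleN1r; exact: (submoduleZ sM).
have gM a' p q : ratio_bound a' p q -> good a' p q [set (0 : tensR W)] setT ->
    good a' p q [set (0 : tensR W)] (M' u0) /\ good a' p q M (M' u0).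
  move=> bnd g; have M'0 : [set 0] `<=` M' u0 by exact: subset_trans (MM' u0).
  have [g1 _] := good_between bnd (sM' u0) M'0 (@subsetT _ _) g.
  by split=> //; have [] := good_between bnd sM M0 (@MM' u0) g1.
(* [W = B / a0] is good for [a0], hence so is [M' u0 / M], and [t] generates a
   copy of [W] in [R (x) (M' u0 / M)]. *)
have [p0 [q0 [p0_gt0 q0_gt0 bnd0 g0]]] := good_ideal ma0.
have [_ [_ gM0]] := gM _ _ _ bnd0 (goodY _ _ _ g0 bnd0).
have lM_gt0 : (0 < len Z M (M' u0))%N.
  by apply: (len_gt0 zM) (subq_fin (qM u0)); split=> // /(_ u0 (M'u u0)).
have [|t [[tM' ta0] ntM]] := hom_len_gt0 (a := a0) (qM u0).
  have : (0 < q0 * hom_len a0 M (M' u0))%N by apply: leq_trans gM0; rewrite muln_gt0 p0_gt0.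
  by rewrite muln_gt0 => /andP[].
have [p [q [p_gt0 q_gt0 bnd g]]] := good_ideal ma.
(* Goodness for [a] passes from [B / a = M' u0 / M] to [R (x) (M' u0 / M)], to
   the copy of [W] in it, and to [R (x) W]. *)
have gMa : good a p q M (M' u0) by apply/(good_cyclic _ _ _ u0 sM).
have ga0 := good_embed bnd ma0 (good_tensR gMa) tM' ntM ta0.
have [gM' _] := gM _ _ _ bnd (goodY _ _ _ ga0 bnd).
(* Exactness corrects [t0 (x) u0] by an element of [R (x) M] to one killed by
   [a]; applying [epsR] brings it back to [R (x) W]. *)
have Tu0 : torsion a M (M' u0) (pureR t0 u0).
  split; first exact: (tensR_set_pure _ (sM' u0)).
  by move=> b ab; rewrite pureR_t0_act; exact: tensR_set_pure.
have [s [r [[_ sa0] Mr tE]]] := good_exact bnd q_gt0 sM M0 (@MM' u0) gM' Tu0.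
have yE : epsR s = u0 - epsR r by rewrite -(epsR_t0 u0) tE epsRD addrK.
have Mer : M (epsR r) by exact: epsR_tensR_set.
exists (epsR s); split.
  by rewrite yE => My; apply: nMu0; rewrite -(subrK (epsR r) u0); exact: (submoduleD sM).
move=> b; rewrite yE scalerBr => Mb.
have ab : a b.
  rewrite /a /annihilator /= -(subrK (b *: epsR r) (b *: u0)); apply: (submoduleD sM) => //.
  exact: (submoduleZ sM).
rewrite -scalerBr -yE -epsR_act; apply: (epsR_tensR_set (sub0 _)).
exact: sa0.
Qed.

End Counit.
End HomLenTensor.
End Doubling.
End Comodule.

(** * The semisimple cover of a Hopf algebra with the Chevalley property *)

Section SimpleElements.
Variables (k : fieldType) (A : algType k).
Variables (m : nat) (gen : 'I_m -> A).
Hypothesis genP : forall a, exists c : 'I_m -> k, a = \sum_i c i *: gen i.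

Definition const_scalars : set A := [set a | exists x : k, a = x *: 1].

Lemma subfield_const_scalars : subfield_like const_scalars.
Proof.
split=> [|_ _ [x ->] [y ->]|_ _ [x ->] [y ->]|_ [x ->]].
- by exists 1; rewrite scale1r.
- by exists (x - y); rewrite scalerBl.
- by exists (x * y); rewrite -scalerAl mul1r scalerA.
have [->|x0] := eqVneq x 0; first by left; rewrite scale0r.
by right; exists (x^-1 *: 1); [exists x^-1 | rewrite -scalerAl mul1r scalerA mulVf // scale1r].
Qed.

Lemma fin_lenA : fin_len const_scalars [set 0] [set: A^o].
Proof.
apply: (fin_len_regular subfield_const_scalars (gen := gen)) => a; have [c ->] := genP a.
exists (fun i => c i *: 1); split=> [i|]; first by exists (c i).
by apply: eq_bigr => i _; rewrite mulr_algl.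
Qed.

Lemma act_zlinear (V : lmodType A) (x : V) : zlinear const_scalars (fun a : A^o => a *: x).
Proof. by apply: linear_zlinear => a b c; rewrite scalerDl scalerA. Qed.

Lemma fin_len_cyclic (V : lmodType A) (x : V) : fin_len const_scalars [set 0] (cyclic x).
Proof.
have z0 : zsub const_scalars [set (0 : V)].
  by split=> [//|u v -> ->|z u _ ->]; rewrite ?subr0 ?scaler0.
have zT : zsub const_scalars [set: A^o] by split.
have -> : cyclic x = sadd ((fun a : A^o => a *: x) @` setT) [set 0].
  apply: subset_eq => [_ [a ->]|_ [_ [_ [[a _ <-] -> ->]]]]; last by exists a; rewrite addr0.
  by exists (a *: x), 0; rewrite addr0; split=> //; exists a.
apply: (fin_len_push (act_zlinear x) z0 zT).
apply: (fin_lenr _ _ fin_lenA).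
  by apply: zsubI => //; exact: zsub_preimage (act_zlinear x) _ z0.
by move=> _ ->; split=> //=; rewrite /preimage /= scale0r.
Qed.

(** Nonzero elements generating a simple submodule. *)
Definition simple_elt (V : lmodType A) (x : V) :=
  x <> 0 /\ forall a, a *: x <> 0 -> exists b, b *: (a *: x) = x.

(** A nonzero element of [N] generating a submodule of least length. *)
Lemma simple_in (V : lmodType A) (N : set V) x : submodule N -> N x -> x <> 0 ->
  exists2 y, N y & simple_elt y.
Proof.
move=> sN Nx x0; pose P l := exists y, [/\ N y, y <> 0 & len const_scalars [set 0] (cyclic y) = l].
have exP : exists l, `[< P l >] by exists (len const_scalars [set 0] (cyclic x)); apply/asboolP; exists x.
case: (ex_minnP exP) => l /asboolP [y [Ny y0 lE]] minl; exists y => //; split=> // a ay0.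
have le : (len const_scalars [set 0%R] (cyclic y) <= len const_scalars [set 0%R] (cyclic (a *: y)%R))%N.
  by rewrite lE; apply: minl; apply/asboolP; exists (a *: y); split=> //; exact: (submoduleZ sN).
have sub : cyclic (a *: y) `<=` cyclic y by move=> _ [b ->]; exists (b * a); rewrite scalerA.
have c0 : [set 0] `<=` cyclic (a *: y) by move=> _ ->; exists 0; rewrite scale0r.
have zcyc u := submodule_zsub const_scalars (submodule_cyclic (u : V)).
have [b yE] := len_eq (zcyc _) (zcyc _)
  c0 sub (fin_len_cyclic y) le (cyclic_id y).
by exists b.
Qed.

Lemma irreducible_simple_elt (V : lmodType A) (x : V) : simple_elt x ->
  irreducible_module (submodule_type (submodule_cyclic x)).
Proof.
move=> [x0 sx]; split.
  by exists (mk_sub (submodule_cyclic x) (cyclic_id x)) => /(congr1 val).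
move=> N sN; have [[y [Ny y0]]|nex] := pselect (exists y, N y /\ y <> 0); [right|left].
  apply: subset_eq => // z _; have [a yE] := valN y; have [c zE] := valN z.
  have [|b bE] := sx a; first by rewrite -yE => vy0; apply: y0; exact: val_inj.
  have -> : z = (c * b) *: y.
    by apply: val_inj; rewrite zE val_subZ yE -scalerA bE.
  exact: (submoduleZ sN).
apply: subset_eq => [y Ny|_ ->]; last exact: (submodule0 sN).
by apply: contrapT => y0; apply: nex; exists y.
Qed.

Lemma fin_dim_cyclic (V : lmodType A) (x : V) : (forall v, cyclic x v) -> fin_dim V.
Proof.
move=> cV; pose s : m.-tuple (kmod V) := [tuple (gen i *: x : kmod V) | i < m].
exists s => v; have [a ->] := cV v; have [c ->] := genP a.
exists (fun i => c (cast_ord (size_tuple s) i)).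
rewrite scaler_suml (reindex (cast_ord (size_tuple s))) /=; last first.
  by apply: onW_bij; exists (cast_ord (esym (size_tuple s))) => i; [exact: cast_ordK | exact: cast_ordKV].
apply: eq_bigr => i _; rewrite kmodZA; congr (_ *: _).
exact: (etrans (esym (tnth_mktuple _ _)) (tnth_nth 0 s (cast_ord (size_tuple s) i))).
Qed.

Lemma cyclic_submodule_type (V : lmodType A) (x : V) (v : submodule_type (submodule_cyclic x)) :
  cyclic (mk_sub (submodule_cyclic x) (cyclic_id x)) v.
Proof.
have [a vE] := valN v; exists a; apply: val_inj; rewrite vE.
by rewrite val_subZ.
Qed.

Definition soc (V : lmodType A) : set V :=
  [set v | exists2 s : seq V, (forall x, x \in s -> simple_elt x) & v = \sum_(x <- s) x].

Lemma submodule_soc (V : lmodType A) : submodule (@soc V).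
Proof.
split; first by exists [::]; rewrite ?big_nil.
  move=> _ _ [s sP ->] [t tP ->]; exists (s ++ t); last by rewrite big_cat.
  by move=> x; rewrite mem_cat => /orP[/sP|/tP].
move=> a _ [s sP ->]; exists [seq a *: x | x <- s & a *: x != 0].
  move=> _ /mapP[x + ->]; rewrite mem_filter => /andP[/eqP ax0 /sP [x0 sx]].
  split=> // b bax0; have [|c cE] := sx (b * a); first by rewrite -scalerA.
  by exists (a * c); rewrite -scalerA [b *: _]scalerA cE.
rewrite big_map big_filter scaler_sumr [RHS]big_mkcond; apply: eq_bigr => x _.
by case: eqP.
Qed.

(** A complement of the socle would contain a simple element. *)
Lemma soc_cr (V : lmodType A) (v : V) : completely_reducible V -> soc v.
Proof.
move=> crV; apply: contrapT => nsv; have sS := @submodule_soc V.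
have [N [sN SN /(_ v) [x [y [Sx Ny vE]]]]] := crV _ sS.
have y0 : y <> 0 by move=> y0; apply: nsv; rewrite vE y0 addr0.
have [z Nz sz] := simple_in sN Ny y0; have [z0 _] := sz; apply: z0.
suff : (@soc V `&` N) z by rewrite SN.
by split=> //; exists [:: z]; rewrite ?big_seq1 // => u; rewrite inE => /eqP ->.
Qed.
End SimpleElements.

(** The field with [A] acting through the counit. *)
Definition trivial_mod (k : fieldType) (A : hopfAlgType k) : Type := k.

Section TrivialModule.
Variables (k : fieldType) (A : hopfAlgType k).
Local Notation triv := (trivial_mod A).

HB.instance Definition _ := GRing.Zmodule.on triv.

Definition trivial_scale (a : A) (x : triv) : triv := counit a * (x : k).

Lemma trivial_scaleA a b x : trivial_scale a (trivial_scale b x) = trivial_scale (a * b) x.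
Proof. by rewrite /trivial_scale rmorphM /= mulrA. Qed.

Lemma trivial_scale1 : left_id 1 trivial_scale.
Proof. by move=> x; rewrite /trivial_scale rmorph1 mul1r. Qed.

Lemma trivial_scaleDr : right_distributive trivial_scale +%R.
Proof. by move=> a x y; exact: mulrDr. Qed.

Lemma trivial_scaleDl x : {morph trivial_scale^~ x : a b / a + b}.
Proof. by move=> a b; rewrite /trivial_scale raddfD; exact: mulrDl. Qed.

HB.instance Definition _ := GRing.Zmodule_isLmodule.Build A triv
  trivial_scaleA trivial_scale1 trivial_scaleDr trivial_scaleDl.

Lemma trivial_mod_scaleE (a : A) (x : triv) : a *: x = counit a * (x : k) :> k.
Proof. by []. Qed.

Lemma trivial_mod_irreducible : irreducible_module triv.
Proof.
split; first by exists (1 : k) => /eqP; rewrite oner_eq0.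
move=> N sN; have [[y [Ny y0]]|nex] := pselect (exists y, N y /\ y <> 0); [right|left].
  apply: subset_eq => // z _; have -> : z = ((z / y : k) *: (1 : A)) *: y.
    rewrite [RHS]trivial_mod_scaleE linearZ /= rmorph1 mulr1 divfK //.
    exact/eqP.
  exact: (submoduleZ sN).
apply: subset_eq => [y Ny|_ ->]; last exact: (submodule0 sN).
by apply: contrapT => y0; apply: nex; exists y.
Qed.
End TrivialModule.

Section SemisimpleCover.
Variables (k : fieldType) (A : hopfAlgType k).
Variables (m : nat) (gen : 'I_m -> A).
Hypothesis genP : forall a, exists c : 'I_m -> k, a = \sum_i c i *: gen i.
Hypothesis chev : chevalley_property A.

(** The generator of the regular module of [A] modulo its radical has this
    property. *)
Definition universal (R : lmodType A) (g : R) := forall (Y : lmodType A) (y : Y),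
  completely_reducible Y -> forall a, a *: g = 0 -> a *: y = 0.

(** The annihilator of [g] is chosen minimal among annihilators of elements of
    completely reducible modules.  The annihilator of a pair is the intersection
    of the two annihilators, so minimality makes that of [g] contained in all of
    them. *)
Lemma exists_cover : exists (R : lmodType A) (g : R),
  [/\ completely_reducible R, forall r, cyclic g r & universal g].
Proof.
pose ann (R : lmodType A) (g : R) : set A^o := [set a | a *: g = 0].
have sann (R : lmodType A) (g : R) : submodule (ann R g).
  split=> [|a b|a b]; rewrite /ann /=; first by rewrite scale0r.
    by move=> ag bg; rewrite scalerDl ag bg addr0.
  by move=> bg; rewrite -scalerA bg scaler0.
have zann (R : lmodType A) (g : R) := submodule_zsub (@const_scalars k A) (sann R g).
have ann0 (R : lmodType A) (g : R) : [set 0] `<=` ann R g.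
  by move=> _ ->; exact: (submodule0 (sann R g)).
have fann (R : lmodType A) (g : R) : fin_len (@const_scalars k A) (ann R g) setT.
  exact: (fin_lenr (zann R g) (ann0 R g) (fin_lenA genP)).
(* Minimal annihilator means maximal colength. *)
pose P l := exists (R : lmodType A) (g : R), completely_reducible R /\
  len (@const_scalars k A) (ann R g) setT = l.
have exP : exists l, `[< P l >].
  exists (len (@const_scalars k A) (ann (trivial_mod A) 0) setT); apply/asboolP.
  by exists (trivial_mod A), 0; split=> //; exact/cr_irreducible/trivial_mod_irreducible.
have bdP l : `[< P l >] -> (l <= len (@const_scalars k A) [set (0%R : A^o)] setT)%N.
  move=> /asboolP [R [g [_ <-]]]; rewrite (len_add (zann R g) _ (ann0 R g)) ?leq_addl //.
  exact: fin_lenA genP.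
case: (ex_maxnP exP bdP) => l /asboolP [R [g [crR lE]]] maxl.
have uR : universal g.
  move=> Y y crY a ag; pose gy : (R * Y)%type := (g, y).
  have sub : ann (R * Y)%type gy `<=` ann R g by move=> b /(congr1 fst).
  have /maxl : `[< P (len (@const_scalars k A) (ann _ gy) setT) >].
    by apply/asboolP; exists (R * Y)%type, gy; split=> //; exact: cr_prod.
  rewrite -lE => le.
  have l0 : len (@const_scalars k A) (ann _ gy) (ann R g) = 0%N.
    move: le; rewrite (len_add (zann R g) _ sub) //.
    by rewrite -[X in (_ <= X)%N]add0n leq_add2r leqn0 => /eqP.
  have /(_ a ag) := len_eq0 (zann _ gy) sub (fin_lenl (zann R g) (@subsetT _ _) (fann _ gy)) l0.
  by move=> /(congr1 snd).
exists (submodule_type (submodule_cyclic g)), (mk_sub (submodule_cyclic g) (cyclic_id g)); split.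
- exact: cr_submodule.
- exact: cyclic_submodule_type.
- by move=> Y y crY a /(congr1 val) ag; exact: (uR Y y crY a ag).
Qed.

Section Cover.
Variables (R : lmodType A) (g : R).
Hypotheses (crR : completely_reducible R) (gR : forall r, cyclic g r) (uR : universal g).

Lemma cover_basis : exists n (e : 'I_n -> kmod R) (c : 'I_n -> kmod R -> k), dual_basis e c.
Proof.
apply: exists_dual_basis; exists m, (fun i => gen i *: g : kmod R) => v.
have [a ->] := gR v; have [c ->] := genP a; exists c.
by rewrite scaler_suml; apply: eq_bigr => i _; rewrite kmodZA.
Qed.

(** By universality [R] maps onto the trivial module; a complement of the kernel
    is spanned by a left integral [t0] of [A] modulo its radical. *)
Lemma cover_integral : exists (t0 : R) (eR : kmod R -> k),
  [/\ forall a : A, a *: t0 = (counit a *: (1 : A)) *: t0, linear (eR : kmod R -> k^o),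
      forall (a : A) (r : R), eR (a *: r) = counit a * eR r & eR t0 = 1].
Proof.
have /choice [rho rhoP] := gR.
have eq_counit a b : a *: g = b *: g -> counit a = counit b.
  move=> ab; apply/eqP; rewrite -subr_eq0 -raddfB; apply/eqP.
  have := uR (1 : trivial_mod A) (cr_irreducible (trivial_mod_irreducible A)) (a := a - b).
  by rewrite scalerBl ab subrr trivial_mod_scaleE mulr1; apply.
pose eR (r : kmod R) : k := counit (rho r).
have eRg a : eR (a *: g) = counit a by apply: eq_counit; rewrite -rhoP.
have eR_act (a : A) (r : R) : eR (a *: r) = counit a * eR r.
  by rewrite {1}(rhoP r) scalerA eRg rmorphM.
have leR : linear (eR : kmod R -> k^o).
  move=> x r r'; have -> : x *: r + r' = ((x *: 1) * rho r + rho r') *: g :> R.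
    by rewrite scalerDl -scalerA -!rhoP.
  by rewrite eRg raddfD /= rmorphM /= linearZ /= rmorph1 mulr1.
pose N0 : set R := [set r | eR r = 0].
have sN0 : submodule N0.
  split=> [|x y x0 y0|a x x0]; rewrite /N0 /=.
  - exact: (linE0 leR).
  - by rewrite (linED leR) x0 y0 addr0.
  - by rewrite eR_act x0 mulr0.
(* [y] is the component of [g] in the complement. *)
have [N' [sN' NN' /(_ g) [x [y [N0x N'y gE]]]]] := crR sN0.
have eRy : eR y = 1.
  have : eR g = 1 by rewrite -(scale1r g) eRg rmorph1.
  by rewrite gE (linED leR) N0x add0r.
exists y, eR; split=> // a.
apply/eqP; rewrite -subr_eq0 -scalerBl; apply/eqP.
set b := a - _; have b0 : counit b = 0.
  by rewrite raddfB /= linearZ /= rmorph1 mulr1 subrr.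
suff : (N0 `&` N') (b *: y) by rewrite NN'.
by split; [rewrite /N0 /= eR_act b0 mul0r | exact: (submoduleZ sN')].
Qed.

Local Notation cop := (@comul k A : {lrmorphism A -> tensor A A}).
Local Notation RR := (tensor_mod cop R R : lmodType A).
Local Notation T := (tensor (kmod R) (kmod R)).

(** [R] is a sum of simple submodules, so [R (x) R] is a sum of images of tensor
    products of simple modules, to which the Chevalley property applies. *)
Lemma cr_cover_square : completely_reducible RR.
Proof.
apply: cr_of_images => M sM nM; apply: contrapT => nex; apply: nM.
have simpleM (x y : R) : simple_elt x -> simple_elt y ->
    M ((x : kmod R) \ox (y : kmod R) : T).
  move=> sx sy; apply: contrapT => nMxy; apply: nex.
  pose X := submodule_type (submodule_cyclic x); pose Y := submodule_type (submodule_cyclic y).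
  exists (tensor_mod cop X Y), (tensor_mod_map (val : X -> R) (val : Y -> R)).
  pose x' : kmod X := mk_sub (submodule_cyclic x) (cyclic_id x).
  pose y' : kmod Y := mk_sub (submodule_cyclic y) (cyclic_id y).
  exists (x' \ox y' : tensor (kmod X) (kmod Y)); split.
  - apply: chev; [exact: irreducible_simple_elt | | exact: irreducible_simple_elt |].
      exact: (fin_dim_cyclic genP (@cyclic_submodule_type _ _ _ _)).
    exact: (fin_dim_cyclic genP (@cyclic_submodule_type _ _ _ _)).
  - exact: tensor_mod_map_linear.
  - by rewrite tensor_mod_mapE.
have [tl tr] := tens_bilin (kmod R) (kmod R).
apply: subset_eq => // t _; elim/(@tensor_ind k (kmod R) (kmod R)): t => [|r r'|s t].
- exact: (submodule0 sM).
- have [s sP ->] := soc_cr genP r crR; have [s' sP' ->] := soc_cr genP r' crR.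
  rewrite (linE_sum (tl _)) big_seq.
  apply: (big_ind M) => [|x y|x /sP sx]; [exact: (submodule0 sM) | exact: (submoduleD sM) |].
  rewrite (linE_sum (tr _)) big_seq.
  apply: (big_ind M) => [|y z|y /sP' sy]; [exact: (submodule0 sM) | exact: (submoduleD sM) |].
  exact: simpleM.
- exact: (submoduleD sM).
Qed.

(** A surjective endomorphism of a finite-dimensional space is injective. *)
Lemma finite_tensor_injective (Phi : T -> T) : linear Phi ->
  (forall t, exists s, t = Phi s) -> injective Phi.
Proof.
move=> lPhi sPhi; have [n [e [c ec]]] := cover_basis.
have fK : subfield_like [set: k].
  split=> // z _; have [->|z0] := eqVneq z 0; [by left | right].
  by exists z^-1; rewrite ?mulVf.
have fT : fin_len [set: k] [set (0 : T)] setT.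
  pose s : seq T := [seq e i \ox e j | i <- enum 'I_n, j <- enum 'I_n].
  have zs := zspan_zsub fK s.
  suff -> : [set: T] = zspan [set: k] s by exact: fin_len_zspan.
  apply: subset_eq => // t _; rewrite (coord_sum ec t).
  apply: (big_ind (zspan setT s)) => [|x y|i _]; [exact: (zsub0 zs) | exact: (zsubD zs) |].
  have [tl tr] := tens_bilin (kmod R) (kmod R).
  rewrite (dual_span ec (coord c i t)) (linE_sum (tr _)).
  apply: (big_ind (zspan setT s)) => [|x y|j _]; [exact: (zsub0 zs) | exact: (zsubD zs) |].
  rewrite (linEZ (tr _)); apply: (zsubZ zs) => //; apply: (zspan_mem fK).
  by apply: allpairs_f; rewrite mem_enum.
have z0 : zsub [set: k] [set (0 : T)].
  by split=> [//|x y -> ->|z x _ ->]; rewrite ?subr0 ?scaler0.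
have zT : zsub [set: k] [set: T] by [].
have zPhi : zlinear [set: k] Phi by exact: linear_zlinear.
have imT : sadd (Phi @` setT) [set 0] = [set: T].
  apply: subset_eq => // t _; have [s ->] := sPhi t.
  by exists (Phi s), 0; split; rewrite ?addr0 //; exists s.
have := len_push zPhi z0 zT; rewrite imT setTI => /(_ fT) lE.
have zK : zsub [set: k] (Phi @^-1` [set 0]) by exact: zsub_preimage.
have K0 : [set (0 : T)] `<=` Phi @^-1` [set 0] by move=> _ ->; exact: zlinear0 zPhi.
have l0 : len [set: k] [set (0 : T)] (Phi @^-1` [set 0]) = 0%N.
  have := len_add zK zT K0 (@subsetT _ _) fT; rewrite lE -[X in X = _]add0n.
  by move/addIn.
have ker0 := len_eq0 z0 K0 (fin_lenl zK (@subsetT _ _) fT) l0.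
move=> s t st; apply/eqP; rewrite -subr_eq0; apply/eqP/ker0.
by rewrite /preimage /= zPhi.1 st subrr.
Qed.

(** [v (x) a g |-> a (g (x) v)] is well defined because [R (x) R] is completely
    reducible.  It is onto because [a g (x) v] is the sum of the
    [a_1 (g (x) S(a_2) v)], hence bijective. *)
Lemma cover_doubling : exists Phi Theta : T -> T,
  [/\ linear Phi, linear Theta, cancel Phi Theta
    & forall (v : kmod R) (x : A) (r : R), Phi (v \ox ((x *: r : R) : kmod R)) =
        tact (@kact k A R) (@kact k A R) (comul x) (Phi (v \ox (r : kmod R)))].
Proof.
have [tl tr] := tens_bilin (kmod R) (kmod R).
have [al ar] := tact_bilin (kact_bilin R) (kact_bilin R).
have /choice [rho rhoP] := gR.
pose act (a : A) (t : T) : T := tact (@kact k A R) (@kact k A R) (comul a) t.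
have actE (a : A) (t : T) : act a t = (a *: (t : RR)) by [].
have actM a b t : act (a * b) t = act a (act b t) by rewrite !actE [RHS]scalerA.
have act_eq a b v : a *: g = b *: g -> act a ((g : kmod R) \ox v) = act b ((g : kmod R) \ox v).
  move=> ab; apply/eqP; rewrite -subr_eq0; apply/eqP.
  rewrite !actE -[LHS](scalerBl (V := RR)); apply: (uR _ cr_cover_square).
  by rewrite scalerBl ab subrr.
pose phi (v r : kmod R) : T := act (rho r) ((g : kmod R) \ox v).
have lact t : linear (fun a : A => act a t).
  exact: (lin_comp (al t) (@comul_linear k A)).
have bphi : bilin phi.
  split=> [r|v] x u u'; rewrite /phi; first by rewrite tr /act ar.
  rewrite -(lact _ x); apply: act_eq.
  by rewrite -rhoP scalerDl kmodZA -!rhoP.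
pose Phi := tlift phi.
have lPhi : linear Phi by exact: tlift_linear.
have PhiE (v : kmod R) a : Phi (v \ox ((a *: g : R) : kmod R)) = act a ((g : kmod R) \ox v).
  by rewrite /Phi (tliftE bphi); apply: act_eq; rewrite -rhoP.
have surj t : exists s, t = Phi s.
  elim/tensor_ind: t => [|r v|s t [s' ->] [t' ->]]; first by exists 0; rewrite (linE0 lPhi).
    have [a ->] := gR r.
    pose F0 (x y : A) : T := (((antipode y *: (v : R)) : R) : kmod R) \ox ((x *: g : R) : kmod R).
    exists (tlift F0 (comul a)); rewrite (lin_tlift _ _ lPhi).
    have -> : tlift (fun x y => Phi (F0 x y)) (comul a) =
        tlift (fun x y => act x ((g : kmod R) \ox ((antipode y *: (v : R) : R) : kmod R))) (comul a).
      by apply: eq_tlift => x y; rewrite PhiE.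
    have actr x : linear (fun y : A => kact y x : kmod R) := (kact_bilin R).1 x.
    pose M := tlift (fun y z : A => y * antipode z).
    have bM : bilin (fun y z : A => y * antipode z) by apply: bilin_mul => //; exact: antipode_linear.
    pose F (x : A) (t : tensor A A) : T := kact x (g : kmod R) \ox kact (M t) v.
    have bF : bilin F.
      split=> [t|x]; first exact: (lin_comp (tl _) (actr g)).
      exact: (lin_comp (tr _) (lin_comp (actr v) (tlift_linear bM))).
    pose G (t : tensor A A) (z : A) : T :=
      tlift (fun x y => kact x (g : kmod R) \ox kact (y * antipode z) v) t.
    have bG1 z : bilin (fun x y => kact x (g : kmod R) \ox kact (y * antipode z) v).
      split=> [y|x]; first exact: (lin_comp (tl _) (actr g)).
      exact: (lin_comp (tr _) (lin_comp (actr v) (bM.1 z))).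
    have bG : bilin G.
      split=> [z|t]; first exact: (tlift_linear (bG1 z)).
      move=> x z z'; rewrite /G -tlift_funlin; apply: eq_tlift => y y'.
      by rewrite bM.2 actr tr.
    have LM t : tlift F (tassoc t) = tlift G t.
      move: t; apply: tensor_ext; [|exact: tlift_linear|].
        exact: (lin_comp (tlift_linear bF) (@tassoc_linear _ _ _ _)).
      move=> t z; rewrite (tliftE bG); move: t; apply: tensor_ext.
      + move=> x u u'; rewrite (tens_bilin _ _).1 tassoc_linear; exact: tlift_linear.
      + exact: bG.1.
      move=> x y; rewrite tassocE (tliftE bF) /F /M (tliftE bM).
      by symmetry; exact: (tliftE (bG1 z)).
    (* [a_1 g (x) a_2 S(a_3) v], bracketed in the two ways. *)
    transitivity (tlift G (tmap comul id (comul a))).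
      rewrite -LM comulA (tlift_tmap _ _ _ bF).
      have lg : linear (fun x : A => kact x (g : kmod R) \ox v) by exact: (lin_comp (tl _) (actr g)).
      rewrite -[in LHS](comul_counitr a) [LHS](lin_tlift _ _ lg); apply: eq_tlift => x y.
      rewrite /F /M antipoder (linEZ lg) /= -(linEZ (tr _)); congr (_ \ox _).
    rewrite (tlift_tmap _ _ _ bG); apply: eq_tlift => x z.
    rewrite /act /tact /G; apply: eq_tlift => x1 x2.
    rewrite tmapE; [|exact: (kact_bilin R).2|exact: (kact_bilin R).2].
    by rewrite /kact scalerA.
  by exists (s' + t'); rewrite (linED lPhi).
have injPhi := finite_tensor_injective lPhi surj.
have /choice [Theta ThetaP] := surj.
exists Phi, Theta; split=> // [x s t|t|v x r].
- by apply: injPhi; rewrite lPhi -!ThetaP.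
- by apply: injPhi; rewrite -ThetaP.
- by have [a ->] := gR r; rewrite scalerA !PhiE -/(act _ _) actM.
Qed.

End Cover.
End SemisimpleCover.

(** * Fibers of a Hopf algebra over a central Hopf subalgebra *)

(** [V] is a quotient of the cover [R], and [R (x) W] is completely reducible by
    [cr_tensR]. *)
Lemma cr_tensor_irreducible (k : fieldType) (A : hopfAlgType k) m (gen : 'I_m -> A)
    (B : algType k) (d : {lrmorphism B -> tensor A B}) (Z : set B)
    (V : lmodType A) (W : lmodType B) :
  (forall a, exists c : 'I_m -> k, a = \sum_i c i *: gen i) ->
  chevalley_property A ->
  (forall b, tassoc (tmap comul id (d b)) = tmap id d (d b)) ->
  (forall b, tlift (fun x b' => counit x *: b') (d b) = b) ->
  subfield_like Z -> (forall z b, Z z -> z * b = b * z) ->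
  (forall z, Z z -> d z = 1 \ox z) ->
  fin_len Z [set 0] [set: B^o] ->
  irreducible_module V -> irreducible_module W ->
  completely_reducible (tensor_mod d V W : lmodType B).
Proof.
move=> genP chev d_assoc d_counit fZ Zc dZ finB irrV irrW.
have [R [g [crR gR uR]]] := exists_cover genP.
have [n [e [c ec]]] := cover_basis genP gR.
have [t0 [eR [t0A leR eRA eRt0]]] := cover_integral crR gR uR.
have [Phi [Theta [lPhi lTheta PhiK PhiA]]] := cover_doubling genP chev crR gR uR.
have [[w w0] _] := irrW; have Ww := irreducible_cyclic irrW w0.
have crRW : completely_reducible (tensR d R W).
  apply: (cr_tensR ec dZ Zc d_assoc lPhi lTheta PhiK PhiA d_counit t0A leR eRA eRt0 finB Ww).
  split; first by apply: submodule_annihilator; split=> [//|x y -> ->|a x ->]; rewrite ?addr0 ?scaler0.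
    by rewrite /annihilator /= scale1r.
  move=> b bw; have [b' wE] := irreducible_cyclic irrW bw w.
  by exists b'; rewrite /annihilator /= scalerBl scale1r -scalerA -wE subrr.
have [[v v0] _] := irrV; have Vv := irreducible_cyclic irrV v0.
have /choice [rho rhoP] := gR.
pose f (r : R) : V := rho r *: v.
have fE a : f (a *: g) = a *: v.
  apply/eqP; rewrite -subr_eq0 -scalerBl; apply/eqP.
  by apply: (uR _ _ (cr_irreducible irrV)); rewrite scalerBl -rhoP subrr.
have lf : linear f.
  by move=> a x y; rewrite [x]rhoP [y]rhoP scalerA -scalerDl !fE scalerDl scalerA.
apply: (cr_surj (f := tensor_mod_map (d := d) f (id : W -> W))) crRW => //.
  exact: tensor_mod_map_linear.
move=> t; elim/(@tensor_ind k (kmod V) (kmod W)): t => [|x y|s t [s' ->] [t' ->]].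
- exists 0; symmetry.
  by exact: (linE0 (tensor_mod_map_klinear d lf (fun _ _ _ => erefl))).
- have [a ->] := Vv x; exists (((a *: g : R) : kmod R) \ox y : tensor (kmod R) (kmod W)).
  by rewrite tensor_mod_mapE // fE.
- exists (s' + t'); symmetry.
  exact: (linED (tensor_mod_map_klinear d lf (fun _ _ _ => erefl))).
Qed.

Section FiberFacts.
Variables (k : fieldType) (H : hopfAlgType k) (C : centralHopfSubalg H).
Variable fg : fin_gen_over C.

Local Notation A := (id_fiber fg).

(** Modulo the kernel of the counit the coefficients in [C] become scalars. *)
Lemma id_fiber_generators : exists m (gen : 'I_m -> A),
  forall a, exists c : 'I_m -> k, a = \sum_i c i *: gen i.
Proof.
have [s sP] := fg; exists (size s), (fun i => id_pi fg s`_i) => a.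
have [h ->] := id_piP a; have [c [Cc ->]] := sP h; exists (fun i => counit (c i)).
have [lp _ pM] := fiber_pi_hom fg (eps_spec C).
rewrite [LHS](linE_sum lp); apply: eq_bigr => i _.
by rewrite [LHS]pM [X in X * _](id_pi_C fg (Cc i)) -scalerAl mul1r.
Qed.

Section OneFiber.
Variable m : maxSpec C.

Local Notation B := (fiber fg m).
Local Notation p := (id_pi fg).
Local Notation pm := (fiber_pi fg m).

Let lp : linear p. Proof. exact: alg_hom_linear (fiber_pi_hom fg _). Qed.
Let lpm : linear pm. Proof. exact: alg_hom_linear (fiber_pi_hom fg m). Qed.

(** The residue field [C / m] inside the fiber. *)
Definition base_scalars : set B := [set pm c | c in (C : set H)].

Lemma coaction_assoc (b : B) :
  tassoc (tmap (@comul k A) id (coaction fg m b)) = tmap id (coaction fg m) (coaction fg m b).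
Proof.
have [h ->] := fiber_piP b; rewrite [coaction fg m _]coaction_funE /coaction_lift.
have lid (V : lmodType k) : linear (@id V) by exact: lin_id.
have lc : linear (@comul k A) by exact: comul_linear.
have lcH : linear (@comul k H) by exact: comul_linear.
have ld : linear (coaction fg m) by exact: linearP.
have lpp := tmap_linear lp lp.
rewrite !tmap_comp //.
rewrite (eq_tmap (f' := tmap p p \o comul) (g' := pm \o id)) //; last exact: id_comulE.
rewrite -[in LHS]tmap_comp // tassoc_tmap // comulA tmap_comp //; last exact: tmap_linear.
by apply: eq_tmap => // x; rewrite /= [RHS]coaction_funE.
Qed.

Lemma coaction_counit (b : B) :
  tlift (fun (x : A) (b' : B) => counit x *: b') (coaction fg m b) = b.
Proof.
have [h ->] := fiber_piP b; rewrite [coaction fg m _]coaction_funE /coaction_lift.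
rewrite tlift_tmap; last first.
  split=> [y|x] a u v; first by rewrite linearP /= scalerDl scalerA.
  by rewrite scalerDr !scalerA mulrC.
rewrite -[in RHS](comul_counitl h) (lin_tlift _ _ lpm).
by apply: eq_tlift => x y; rewrite [counit _]id_counitE (linEZ lpm).
Qed.

Lemma base_scalars_central z (b : B) : base_scalars z -> z * b = b * z.
Proof.
move=> [c Cc <-]; have [h ->] := fiber_piP b; have [_ _ pM] := fiber_pi_hom fg m.
by rewrite -!pM (chs_central h Cc).
Qed.

Lemma base_scalars_coaction z : base_scalars z -> coaction fg m z = 1 \ox z.
Proof. by move=> [c Cc <-]; rewrite [LHS]coaction_funE; exact: coaction_lift_C. Qed.

Lemma base_scalars_subfield : subfield_like base_scalars.
Proof.
have [C1 CL CM] := chs_subalgebra C; have [_ p1 pM] := fiber_pi_hom fg m.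
have [mC m0 mD mM] := max_ideal m.
split=> [|_ _ [x Cx <-] [y Cy <-]|_ _ [x Cx <-] [y Cy <-]|_ [x Cx <-]].
- by exists 1.
- exists (x - y); last exact: (linEB lpm).
  by rewrite addrC -scaleN1r; exact: CL.
- by exists (x * y); [exact: CM | exact: pM].
have [mx|nmx] := pselect (m x); [left; exact: fiber_pi0 | right].
have CD u v : C u -> C v -> C (u + v).
  by move=> Cu Cv; have := CL 1 _ _ Cu Cv; rewrite scale1r.
(* [J] is the ideal [m + C x] of [C], which contains [1] by maximality of [m]. *)
pose J : set H := [set u | exists2 c, C c & m (u - c * x)].
have [c Cc mc] : J 1.
  apply: contrapT => nJ1; apply: nmx.
  have JE : J = (m : set H).
    apply: (max_max _ _ nJ1).
      split=> [u [c Cc mu]||u v [c Cc mu] [c' Cc' mv]|a u Ca [c Cc mu]].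
      - by rewrite -[u](subrK (c * x)); apply: CD; [exact: mC | exact: CM].
      - by exists 0; rewrite ?mul0r ?subr0 //; exact: mC.
      - exists (c + c'); first exact: CD.
        by rewrite mulrDl opprD addrACA; exact: mD.
      - exists (a * c); first exact: CM.
        by rewrite -mulrA -mulrBr; exact: mM.
    by move=> u mu; exists 0; rewrite ?mul0r ?subr0 //; exact: mC.
  have : J x by exists 1; rewrite // mul1r subrr.
  by rewrite JE.
exists (pm c); first by exists c.
rewrite -pM -p1; apply/eqP; rewrite eq_sym -subr_eq0 -(linEB lpm).
by apply/eqP/fiber_pi0.
Qed.

Lemma fiber_fin_len : fin_len base_scalars [set 0] [set: B^o].
Proof.
have [s sP] := fg; have [_ _ pM] := fiber_pi_hom fg m.
apply: (fin_len_regular (gen := fun i : 'I_(size s) => pm s`_i) base_scalars_subfield) => b.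
have [h ->] := fiber_piP b; have [c [Cc ->]] := sP h; exists (fun i => pm (c i)).
split=> [i|]; first by exists (c i).
by rewrite (linE_sum lpm); apply: eq_bigr => i _; rewrite pM.
Qed.

End OneFiber.
End FiberFacts.

Lemma cr_eq_coproduct (k : fieldType) (B A1 A2 : algType k)
    (d d' : {lrmorphism B -> tensor A1 A2}) (V : lmodType A1) (W : lmodType A2) :
  d =1 d' -> completely_reducible (tensor_mod d V W : lmodType B) ->
  completely_reducible (tensor_mod d' V W : lmodType B).
Proof.
move=> dd'; apply: (cr_surj (f := id : tensor_mod d V W -> tensor_mod d' V W)).
  move=> b x y; congr (_ + _).
  by rewrite -[LHS]/(tact (@kact k A1 V) (@kact k A2 W) (d b) x) dd'.
by move=> t; exists t.
Qed.

Theorem proposition3p9 (k : closedFieldType) (char0 : [pchar k] =i pred0)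
  (H : hopfAlgType k) (affH : affine H)
  (C : centralHopfSubalg H) (fg : fin_gen_over C) :
  Chev fg = [set: maxSpec C] <-> chevalley_property (id_fiber fg).
Proof.
split=> [chevT V W irrV _ irrW _|chev].
  have chev_eps : Chev fg (eps_spec C) by rewrite chevT.
  by apply: cr_eq_coproduct (chev_eps V W irrV irrW) => q.
apply/seteqP; split=> // m _ V W irrV irrW.
have [n [gen genP]] := id_fiber_generators fg.
apply: (cr_tensor_irreducible genP chev) irrV irrW.
- exact: coaction_assoc.
- exact: coaction_counit.
- exact: base_scalars_subfield.
- exact: base_scalars_central.
- exact: base_scalars_coaction.
- exact: fiber_fin_len.
Qed.
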